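(* Fix $\epsilon>0$. Consider the preconditioned gradient flow $\dot w=-\frac{1}{s|\alpha_s|}(A^\dagger A)^{-1}\nabla L(w)$ described in the context, with summary statistics $r_t,\theta_t,v_t$ and the constant $\delta$. Suppose the initialization $w_0$ and the weights $(a_m)_{m=1}^M$ are such that: (i) $0<r_0\le1$; (ii) $\cos s\theta_0\ge 1/2$; (iii) $v_0=1-r_0^2$; (iv) $\delta\le\min\big(\epsilon/2,\,O(s^{-s}r_0^4)\big)$. Then $r_T\ge1-\epsilon$, $\cos s\theta_T\ge1-\epsilon$ and $v_T\le\epsilon$ after time $T$, where $$T\le\begin{cases}O\big(\log\frac1\epsilon\big) & s=1,\\ O\big(2^{s^2}r_0^{-4s}+\log\frac1\epsilon\big) & s>1.\end{cases}$$
   Context: For $x\in\mathbb{C}^N$, $p_k(x)=\frac1{\sqrt k}\sum_{n=1}^Nx_n^k$, $p(x)=(p_1(x),p_2(x),\dots)$; for square-summable $u,v\in\mathbb{C}^\infty$, $\langle u,v\rangle=\sum_iu_i\overline{v_i}$, $\|u\|^2=\langle u,u\rangle$, $\langle u,p(x)\rangle=\sum_ju_j\overline{p_j(x)}$. $V$ is the distribution on $(S^1)^N$ of eigenvalues of an $N\times N$ Haar unitary matrix. Teacher: $f(z)=\sum_{j=1}^{\sqrt N}\frac{\alpha_j}{\sqrt{j!}}z^j$, $h^*\in\mathbb{C}^\infty$ unit norm supported on its first $\sqrt N$ coordinates; $s=\min\{j\ge1:\alpha_j\ne0\}$ (information exponent); $g(z)=\frac{\alpha_s}{|\alpha_s|\sqrt{s!}}z^s$.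 $A\in\mathbb{C}^{\infty\times M}$ has entries $A_{km}=c_k\sqrt k\,a_m^k$, $a_m\in S^1$, where $\sigma(z)=\sum_k c_kz^k$ is the activation; $A^\dagger A$ is assumed invertible. Loss: $L(w)=\mathbb{E}_{x\sim V}[-\operatorname{Re}(f(\langle h^*,p(x)\rangle)\overline{g(\langle Aw,p(x)\rangle)})]+\frac{|\alpha_s|}2\|Aw\|^{2s}$. With $w=w_R+iw_C$, $\nabla L=\nabla_{w_R}L+i\nabla_{w_C}L$ and $\dot w=\dot w_R+i\dot w_C$. Summary statistics at time $t$: $m_t=\langle Aw_t,h^*\rangle=r_te^{i\theta_t}$ (polar form), $v_t=\|P^\perp_{h^*}Aw_t\|^2$ with $P^\perp_{h^*}$ the projection onto the orthogonal complement of $h^*$; $\delta=1-\|P_Ah^*\|^2$ with $P_A$ the orthogonal projection onto the range of $A$. $O(\cdot)$ hides constants not depending on $\epsilon$, $s$, $r_0$. *)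

(* Defs.v *)
From HB Require Import structures.
From mathcomp Require Import all_boot all_order all_algebra.
From mathcomp Require Import all_classical all_reals all_analysis.
From mathcomp Require Import complex.
Set Implicit Arguments. Unset Strict Implicit. Unset Printing Implicit Defensive.
Import Order.TTheory GRing.Theory Num.Theory.
Import numFieldNormedType.Exports.
Local Open Scope ring_scope.
Local Open Scope classical_set_scope.

Section Defs.
Variable R : realType.
Local Notation C := (R[i]).

Definition cRe (z : C) : R := complex.Re z.
Definition cIm (z : C) : R := complex.Im z.
Definition cabs (z : C) : R := Num.sqrt (cRe z ^+ 2 + cIm z ^+ 2).
Definition cconj (z : C) : C := conjc z.
Definition rC (r : R) : C := (r%:C)%C.
Definition imag_unit : C := ('i)%C.

(* An infinite sequence u in C^infty is represented by u : nat -> C, where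
   u k is the k-th coordinate; coordinate 0 is unused (always 0 below). *)

Definition cseries (u : nat -> C) : C :=
  ((limn (series (fun k => cRe (u k)))) +i* (limn (series (fun k => cIm (u k)))))%C.

Definition cinner (u v : nat -> C) : C := cseries (fun k => u k * cconj (v k)).

Definition sqnorm (u : nat -> C) : R := limn (series (fun k => (cabs (u k)) ^+ 2)).

(* p_k(x) = k^{-1/2} sum_n x_n^k   (p_0 = 0 since 0^-1 = 0) *)
Definition psum (N : nat) (x : 'I_N -> C) (k : nat) : C :=
  rC (Num.sqrt (k%:R))^-1 * \sum_(n < N) x n ^+ k.

Definition isqrt (N : nat) : nat := (\max_(k < N.+1 | (k * k <= N)%N) k)%N.

Definition Amat (M : nat) (c : nat -> C) (a : 'I_M -> C) (k : nat) (m : 'I_M) : C :=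
  c k * rC (Num.sqrt (k%:R)) * a m ^+ k.

Definition Aw (M : nat) (c : nat -> C) (a : 'I_M -> C) (w : 'cV[C]_M) (k : nat) : C :=
  \sum_(m < M) Amat c a k m * w m 0.

Definition AtA (M : nat) (c : nat -> C) (a : 'I_M -> C) : 'M[C]_M :=
  \matrix_(m, m') cseries (fun k => cconj (Amat c a k m) * Amat c a k m').

Definition Adag (M : nat) (c : nat -> C) (a : 'I_M -> C) (u : nat -> C) : 'cV[C]_M :=
  \col_m cseries (fun k => cconj (Amat c a k m) * u k).

(* P_A u : orthogonal projection onto range(A) (A^dagger A invertible) *)
Definition PA (M : nat) (c : nat -> C) (a : 'I_M -> C) (u : nat -> C) : nat -> C :=
  Aw c a (invmx (AtA c a) *m Adag c a u).

Definition delta (M : nat) (c : nat -> C) (a : 'I_M -> C) (h : nat -> C) : R :=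
  1 - sqnorm (PA c a h).

Definition teacher (alpha : nat -> C) (K : nat) (z : C) : C :=
  \sum_(1 <= j < K.+1) alpha j / rC (Num.sqrt (j`!)%:R) * z ^+ j.

Definition gfun (alpha : nat -> C) (s : nat) (z : C) : C :=
  alpha s / rC (cabs (alpha s) * Num.sqrt (s`!)%:R) * z ^+ s.

Definition unitary_mx (N : nat) (U : 'M[C]_N) : Prop :=
  U *m (map_mx cconj U)^T = 1%:M.

(* U is a Haar-distributed random N x N unitary matrix on the probability
   space (T, P): unitary, with measurable entries, and with law invariant
   under left multiplication by any fixed unitary matrix. *)
Definition haar_unitary (N : nat) (d : measure_display) (T : measurableType d)
  (P : probability T R) (U : T -> 'M[C]_N) : Prop :=
  [/\ forall t, unitary_mx (U t),
      forall i j, measurable_fun setT (fun t => cRe (U t i j)) /\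
                  measurable_fun setT (fun t => cIm (U t i j)) &
      forall Q : 'M[C]_N, unitary_mx Q ->
      forall F : 'M[C]_N -> R, (forall B, 0 <= F B) ->
        measurable_fun setT (F \o U) ->
        measurable_fun setT (fun t => F (Q *m U t)) ->
        (\int[P]_t (F (Q *m U t))%:E = \int[P]_t (F (U t))%:E)%E].

(* x t is the vector of eigenvalues (with multiplicity) of U t, chosen
   measurably; the law of x is then V. *)
Definition eigenvalues_of (N : nat) (d : measure_display) (T : measurableType d)
  (U : T -> 'M[C]_N) (x : T -> 'I_N -> C) : Prop :=
  (forall t, char_poly (U t) = \prod_(n < N) ('X - (x t n)%:P)) /\
  (forall n, measurable_fun setT (fun t => cRe (x t n)) /\
             measurable_fun setT (fun t => cIm (x t n))).

Definition loss (N M : nat) (d : measure_display) (T : measurableType d)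
  (P : probability T R) (x : T -> 'I_N -> C)
  (c : nat -> C) (a : 'I_M -> C) (alpha : nat -> C) (s : nat) (h : nat -> C)
  (w : 'cV[C]_M) : R :=
  Rintegral P setT (fun t =>
     - cRe (teacher alpha (isqrt N) (cinner h (psum (x t)))
            * cconj (gfun alpha s (cinner (Aw c a w) (psum (x t))))))
  + cabs (alpha s) / 2 * (sqnorm (Aw c a w)) ^+ s.

Definition cgrad (M : nat) (L : 'cV[C]_M -> R) (w : 'cV[C]_M) : 'cV[C]_M :=
  \col_m ((derive1 (fun r : R => L (w + rC r *: delta_mx m 0)) 0)
          +i* (derive1 (fun r : R => L (w + (rC r * imag_unit) *: delta_mx m 0)) 0))%C.

Definition solves_flow (M : nat) (F : 'cV[C]_M -> 'cV[C]_M) (w : R -> 'cV[C]_M) : Prop :=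
  (forall t : R, 0 < t -> forall m : 'I_M,
     is_derive t 1 (fun u => cRe (w u m 0)) (cRe (F (w t) m 0)) /\
     is_derive t 1 (fun u => cIm (w u m 0)) (cIm (F (w t) m 0))) /\
  (forall m : 'I_M,
     (fun u => cRe (w u m 0)) x @[x --> 0^'+] --> cRe (w 0 m 0) /\
     (fun u => cIm (w u m 0)) x @[x --> 0^'+] --> cIm (w 0 m 0)).

Definition precond_rhs (M : nat) (c : nat -> C) (a : 'I_M -> C) (alpha : nat -> C)
  (s : nat) (L : 'cV[C]_M -> R) (w : 'cV[C]_M) : 'cV[C]_M :=
  - (rC (s%:R * cabs (alpha s))^-1 *: (invmx (AtA c a) *m cgrad L w)).

Definition mstat (M : nat) (c : nat -> C) (a : 'I_M -> C) (h : nat -> C) (w : 'cV[C]_M) : C :=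
  cinner (Aw c a w) h.
Definition rstat M c a h w : R := cabs (@mstat M c a h w).
(* cos(s theta) where m = r e^{i theta} *)
Definition cos_s_theta M c a h (s : nat) w : R :=
  cRe ((@mstat M c a h w) ^+ s) / (rstat c a h w) ^+ s.
(* v = || P^perp_{h*} A w ||^2, with P^perp_{h*} u = u - <u,h*> h* (h* unit) *)
Definition vstat M c a h w : R :=
  sqnorm (fun k => Aw c a w k - @mstat M c a h w * h k).

End Defs.

(* Main.v *)
(** For a Haar unitary [U], invariance under one-parameter subgroups gives loop
    equations for the mixed moments of the traces [tr (U ^+ k)].  Multiplying
    out, the unknown moments of weight [n <= N] satisfy a linear system whose
    off-diagonal part has sup norm at most [n - 1 < N], so it has a unique
    solution, and the moments of independent complex Gaussians of variances
    [k] solve it.  Every monomial of the teacher paired with [g] has weight at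
    most [sqrt N * sqrt N <= N], hence the loss is
    [|alpha_s| (- Re (m ^+ s) + |A w| ^+ 2s / 2)] with [m = <A w, h>].

    The preconditioned flow then closes on [m] and [rho = |A w|^2]:
    [m' = q * conj m ^+ (s-1) - rho ^+ (s-1) * m] and
    [rho' = 2 Re (m ^+ s) - 2 rho ^+ s], with [q = 1 - delta].  Writing
    [S = |m|^2] and [P = Re (m ^+ s)], both [q - S / rho] and
    [sin^2 (s theta)] decay at a rate bounded below by [P], so [S / rho] and
    [cos (s theta)] never get worse; this keeps [P] above a multiple of
    [r_0 ^+ 2s], after a time of order [r_0 ^- 4s] above an absolute constant,
    and from then on everything converges exponentially fast. *)
Require Import Defs.
From HB Require Import structures.
From mathcomp Require Import all_boot all_order all_algebra.
From mathcomp Require Import all_classical all_reals all_analysis.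
From mathcomp Require Import complex.
From mathcomp Require Import measurable_realfun ring lra zify.
Import Order.TTheory GRing.Theory Num.Theory.
Import numFieldNormedType.Exports.
Set Implicit Arguments.
Unset Strict Implicit.
Unset Printing Implicit Defensive.
Local Open Scope ring_scope.

(** * Differential inequalities along the flow *)

(** The obstacle on the random matrix side is that [A w] has infinitely many coordinates, so the
    monomials in the conjugate traces have unbounded weight whatever [N] is. Hence [moment_pairing]
    restricts only the weight of the unconjugated side, which the finite support of [h] controls;
    the right side of a loop equation lowers that weight for every conjugate side. The full series
    [<A w, p (x)>] is reached from its truncations uniformly in the sample, because
    [|(A w)_k| <= sqrt k * |c_k| * sum |w_m|] and [|p_k| <= N / sqrt k].

    On the dynamical side, [S / rho] and [sin^2 (s theta)] are the variables to follow because the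
    damping [rho ^ (s-1)] cancels in both quotients. The exponent [4s] in the time is the price of
    the norm: while the alignment is poor, [rho ^ s] is only known to stay above the order of
    [r_0 ^ 2s], and it recovers from there at a quadratic speed. *)

Section FlowCalculus.
Variable R : realType.
Implicit Types (f g y df dg : R -> R) (t : R).

(** The regularity that [solves_flow] provides: a derivative at positive times and mere continuity
    from the right at the initial time. All estimates must therefore hold from [0] on without a
    derivative at [0]. *)
Definition flow_deriv f df : Prop :=
  (forall t, 0 < t -> is_derive t 1 f (df t)) /\
  (f x @[x --> 0^'+] --> f 0)%classic.

Lemma flow_deriv_eq f df dg :
  flow_deriv f df -> (forall t, 0 < t -> df t = dg t) -> flow_deriv f dg.
Proof. by move=> [fd f0] e; split=> // t t0; rewrite -e//; exact: fd. Qed.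

Lemma flow_deriv_cst (k : R) : flow_deriv (fun=> k) (fun=> 0).
Proof. by split=> [t _|]; [exact: is_derive_cst | exact: cvg_cst]. Qed.

Lemma flow_derivD f g df dg : flow_deriv f df -> flow_deriv g dg ->
  flow_deriv (fun t => f t + g t) (fun t => df t + dg t).
Proof.
move=> [fd f0] [gd g0]; split=> [t t0|]; last exact: cvgD.
by have := fd _ t0; have := gd _ t0 => ? ?; exact: is_deriveD.
Qed.

Lemma flow_derivM f g df dg : flow_deriv f df -> flow_deriv g dg ->
  flow_deriv (fun t => f t * g t) (fun t => f t * dg t + g t * df t).
Proof.
move=> [fd f0] [gd g0]; split=> [t t0|]; last exact: cvgM.
by have := fd _ t0; have := gd _ t0 => ? ?; exact: is_deriveM.
Qed.

Lemma flow_derivZ (k : R) f df : flow_deriv f df ->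
  flow_deriv (fun t => k * f t) (fun t => k * df t).
Proof.
move=> fd; apply: flow_deriv_eq (flow_derivM (flow_deriv_cst k) fd) _.
by move=> t _; rewrite mulr0 addr0.
Qed.

Lemma flow_derivN f df : flow_deriv f df ->
  flow_deriv (fun t => - f t) (fun t => - df t).
Proof.
move=> /(flow_derivZ (-1)) [fd f0]; split=> [t t0|].
  by have := fd t t0; rewrite mulN1r; under eq_fun do rewrite mulN1r.
by move: f0; rewrite mulN1r; under eq_fun do rewrite mulN1r.
Qed.

Lemma flow_derivB f g df dg : flow_deriv f df -> flow_deriv g dg ->
  flow_deriv (fun t => f t - g t) (fun t => df t - dg t).
Proof. by move=> fd /flow_derivN gd; exact: flow_derivD. Qed.

Lemma flow_derivX n f df : flow_deriv f df ->
  flow_deriv (fun t => f t ^+ n.+1) (fun t => n.+1%:R * f t ^+ n * df t).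
Proof.
move=> fd; elim: n => [|n IH].
  have -> : (fun t => f t ^+ 1) = f by apply/funext.
  by apply: flow_deriv_eq fd _ => t _; rewrite expr0 !mul1r.
apply: flow_deriv_eq (flow_derivM fd IH) _ => t _.
rewrite -(natr1 n.+1) (exprSr (f t) n); ring.
Qed.

Lemma flow_derivV f df : (forall t, 0 <= t -> f t != 0) -> flow_deriv f df ->
  flow_deriv (fun t => (f t)^-1) (fun t => - df t / f t ^+ 2).
Proof.
move=> fn0 [fd f0]; split=> [t t0|]; last by apply: cvgV => //; exact: fn0.
have := fd _ t0 => ?; apply: is_derive_eq (is_deriveV _ _) _.
  exact/fn0/ltW.
by rewrite /GRing.scale /= mulNr mulrC mulNr.
Qed.

Lemma flow_deriv_expR (lam : R) :
  flow_deriv (fun t => expR (lam * t)) (fun t => lam * expR (lam * t)).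
Proof.
have d t : is_derive t 1 (fun t => expR (lam * t)) (lam * expR (lam * t)).
  rewrite mulrC; apply: (@is_derive1_comp _ expR (fun t => lam * t)).
  by apply: is_derive_eq; rewrite /GRing.scale /= mulr1.
split=> [t _|]; first exact: d.
apply: cvg_at_right_filter.
suff : {for 0, continuous (fun t => expR (lam * t))} by [].
by apply: differentiable_continuous; apply/derivable1_diffP; have [] := d 0.
Qed.

(* On [a, t], past the last time where [y] is at most [B], [y] is nonincreasing. *)
Lemma flow_nonincr_above y dy (a B : R) : 0 <= a -> flow_deriv y dy ->
  y a <= B -> (forall t, a < t -> B < y t -> dy t <= 0) ->
  forall t, a <= t -> y t <= B.
Proof.
move=> a0 [yd y0] yaB dyle b ab; rewrite leNgt; apply/negP => yb.
pose A := [set t | a <= t <= b /\ y t <= B]%classic.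
have Aa : A a by split=> //; rewrite lexx.
have ubA : ubound A b by move=> x [/andP[]].
have supA : has_sup A by split; [exists a | exists b].
set c := sup A.
have ac : a <= c by apply: ub_le_sup => //; exists b.
have cb : c <= b by apply: ge_sup => //; exists a.
have cont t : 0 < t -> {for t, continuous y}.
  move=> t0; apply: differentiable_continuous.
  by apply/derivable1_diffP; have [] := yd _ t0.
have ycB : y c <= B.
  move: ac; rewrite le_eqVlt => /predU1P[<-//|ac]; rewrite leNgt; apply/negP => yc.
  have c0 : 0 < c by apply: le_lt_trans ac.
  have : \forall x \near c, B < y x.
    exact: (cont _ c0 _ (lt_nbhsr yc)).
  case/nbhs_ballP => e /= e0 He.
  have [x [/andP[ax xb] yx] cx] := sup_adherent e0 supA.
  have xc : x <= c by apply: ub_le_sup => //; [exists b | split=> //; rewrite ax xb].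
  suff /He : ball c e x by rewrite ltNge yx.
  by rewrite /ball /= ltr_distlC cx /= (le_lt_trans xc)// ltrDl.
have {}cb : c < b.
  by move: cb; rewrite le_eqVlt => /predU1P[cb|//]; move: yb; rewrite -cb ltNge ycB.
have above x : c < x -> x <= b -> B < y x.
  move=> cx xb; rewrite ltNge; apply/negP => yx.
  have : x <= c by apply: ub_le_sup; [exists b | split=> //; rewrite xb (le_trans ac (ltW cx))].
  by rewrite leNgt cx.
have [||x] := @MVT _ y dy _ _ cb.
- by move=> x; rewrite in_itv /= => /andP[cx _]; apply: yd; rewrite (le_lt_trans a0)// (le_lt_trans ac).
- apply/(continuous_within_itvP _ cb); split.
  + by move=> x; rewrite in_itv /= => /andP[cx _]; apply: cont; rewrite (le_lt_trans a0)// (le_lt_trans ac).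
  + case: (eqVneq c 0) => [->//|c0]; apply: cvg_at_right_filter; apply: cont.
    by rewrite lt_neqAle eq_sym c0 (le_trans a0).
  + by apply: cvg_at_left_filter; apply: cont; rewrite (le_lt_trans a0)// (le_lt_trans ac).
rewrite in_itv /= => /andP[cx xb] e.
have : dy x * (b - c) <= 0.
  rewrite pmulr_lle0 ?subr_gt0//; apply: dyle; first exact: le_lt_trans cx.
  by apply: above => //; exact: ltW.
by rewrite -e subr_le0 leNgt (le_lt_trans ycB yb).
Qed.

(** Multiplication by [expR (lam * t)] reduces this to [flow_nonincr_above] at the level
    [B * expR (lam * a)]. As [B >= 0], exceeding that level forces [y > 0], so the differential
    inequality is only asked where [y] is positive; this allows functions such as [e - rho], which
    are controlled on one side only. *)
Lemma flow_gronwall y dy (a lam B : R) : 0 <= a -> flow_deriv y dy ->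
  0 <= B -> y a <= B -> (forall t, a < t -> 0 < y t -> dy t <= - lam * y t) ->
  forall t, a <= t -> y t <= B * expR (- lam * (t - a)).
Proof.
move=> a0 yd B0 yaB H t at_.
have zd := flow_derivM yd (flow_deriv_expR lam).
suff zB : y t * expR (lam * t) <= B * expR (lam * a).
  rewrite (_ : - lam * (t - a) = lam * a - lam * t); last by ring.
  by rewrite expRB mulrA ler_pdivlMr ?expR_gt0.
apply: (flow_nonincr_above a0 zd) at_; first by rewrite ler_pM2r ?expR_gt0.
move=> u au yu.
have {}yu : 0 < y u.
  rewrite -(pmulr_lgt0 _ (expR_gt0 (lam * u))).
  by apply: le_lt_trans yu; rewrite mulr_ge0 // expR_ge0.
have := H _ au yu; rewrite -(ler_pM2r (expR_gt0 (lam * u))); lra.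
Qed.

End FlowCalculus.

(** * Convergence of the summary statistics *)

Section SummaryDynamics.
Variable R : realType.

Lemma bernoulli_le (x : R) k : 0 <= x <= 1 -> 1 - k%:R * x <= (1 - x) ^+ k.
Proof.
move=> /andP[x0 x1]; elim: k => [|k IH]; first by rewrite mul0r subr0 expr0.
rewrite exprSr -natr1; apply: le_trans (_ : (1 - k%:R * x) * (1 - x) <= _); last first.
  by rewrite ler_wpM2r// subr_ge0.
have : 0 <= k%:R * x * x by rewrite !mulr_ge0.
lra.
Qed.

(** Here [s = n.+1], and [S], [P], [I], [rho] stand for [|m| ^ 2], [Re (m ^ s)], [Im (m ^ s)] and
    [|A w| ^ 2]. [SPI] computes [|m ^ s| ^ 2] in two ways, [S_le_rho] is Cauchy-Schwarz, and the two
    conditions on [P 0] together say [cos (s theta_0) >= 1/2]. *)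
Variables (n : nat) (q : R) (S P I rho : R -> R).
Hypothesis q01 : 1 / 2 <= q <= 1.
Hypothesis dS : flow_deriv S (fun t => 2 * q * P t - 2 * rho t ^+ n * S t).
Hypothesis dP : flow_deriv P
  (fun t => n.+1%:R * q * S t ^+ n - n.+1%:R * rho t ^+ n * P t).
Hypothesis dI : flow_deriv I (fun t => - n.+1%:R * rho t ^+ n * I t).
Hypothesis drho : flow_deriv rho (fun t => 2 * P t - 2 * rho t ^+ n.+1).
Hypothesis SPI : forall t, 0 <= t -> S t ^+ n.+1 = P t ^+ 2 + I t ^+ 2.
Hypothesis S_ge0 : forall t, 0 <= t -> 0 <= S t.
Hypothesis S_le_rho : forall t, 0 <= t -> S t <= rho t.
Hypothesis rho0 : rho 0 = 1.
Hypothesis P0_gt0 : 0 < P 0.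
Hypothesis P0_ge : S 0 ^+ n.+1 <= 4 * P 0 ^+ 2.

Let rho_ge0 t : 0 <= t -> 0 <= rho t.
Proof. by move=> t0; apply: le_trans (S_le_rho t0); exact: S_ge0. Qed.

Lemma sqr_P_le t : 0 <= t -> P t ^+ 2 <= rho t ^+ n.+1.
Proof.
move=> t0; apply: (@le_trans _ _ (S t ^+ n.+1)).
  by rewrite SPI// lerDl sqr_ge0.
by apply: lerXn2r; rewrite ?nnegrE ?S_ge0 ?rho_ge0// S_le_rho.
Qed.

(** Above the level [1], [P <= rho ^ (s/2) <= rho ^ s], so [rho] cannot grow there. *)
Lemma rho_le1 t : 0 <= t -> rho t <= 1.
Proof.
apply: (flow_nonincr_above (lexx 0) drho); first by rewrite rho0.
move=> {}t t0 rt; have R1 : 1 <= rho t ^+ n.+1 by rewrite exprn_ege1// ltW.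
rewrite -mulrBr pmulr_rle0// subr_le0.
have RR : 0 <= rho t ^+ n.+1 by exact: le_trans R1.
have [P0|/ltW P0] := leP (P t) 0; first exact: le_trans RR.
rewrite -(@ler_pXn2r _ 2) ?nnegrE//.
apply: le_trans (sqr_P_le (ltW t0)) _.
by rewrite expr2 ler_peMr.
Qed.

Let rhoX_le1 t k : 0 <= t -> rho t ^+ k <= 1.
Proof. by move=> t0; rewrite exprn_ile1 ?rho_ge0 ?rho_le1. Qed.

Let S_le1 t : 0 <= t -> S t <= 1.
Proof. by move=> t0; rewrite (le_trans (S_le_rho t0)) ?rho_le1. Qed.

(** The barrier is [P 0 * expR (- s t)]: the drive [q * S ^ n] is nonnegative and [rho ^ n <= 1], so
    [P] decays at rate at most [s]. Strict positivity at every time makes [S] and [rho] invertible,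
    which the quotients below need. *)
Lemma P_gt0 t : 0 <= t -> 0 < P t.
Proof.
move=> t0; rewrite -subr_lt0 sub0r.
set y := fun t => P 0 * expR (- n.+1%:R * t) - P t.
have yd := flow_derivB (flow_derivZ (P 0) (flow_deriv_expR (- n.+1%:R))) dP.
have : y t <= 0.
  apply: (flow_nonincr_above (lexx 0) yd) t0.
    by rewrite mulr0 expR0 mulr1 subrr.
  move=> {}t t0 /= yt; set E := P 0 * _ in yt.
  have E0 : 0 < E by rewrite mulr_gt0 ?expR_gt0.
  rewrite [X in X - _]mulrCA -/E.
  have S0 : 0 <= n.+1%:R * q * S t ^+ n.
    by rewrite !mulr_ge0 ?exprn_ge0 ?S_ge0 ?ltW//; case/andP: q01; lra.
  suff : n.+1%:R * (rho t ^+ n * P t) <= n.+1%:R * E by lra.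
  rewrite ler_pM2l ?ltr0n//.
  have [P0|/ltW P0] := leP (P t) 0.
    apply: le_trans (ltW E0); by rewrite mulr_ge0_le0// exprn_ge0// rho_ge0// ltW.
  apply: (@le_trans _ _ (P t)); last by lra.
  by rewrite ler_piMl// rhoX_le1// ltW.
by rewrite /y subr_le0 oppr_lt0; apply: lt_le_trans; rewrite mulr_gt0// expR_gt0.
Qed.

Lemma S_gt0 t : 0 <= t -> 0 < S t.
Proof.
move=> t0; rewrite lt_neqAle S_ge0// andbT eq_sym; apply/negP => /eqP S0.
have := SPI t0; rewrite S0 expr0n /= => e.
have : 0 < P t ^+ 2 by rewrite exprn_gt0// P_gt0.
by have := sqr_ge0 (I t); lra.
Qed.

Lemma rho_gt0 t : 0 <= t -> 0 < rho t.
Proof. by move=> t0; rewrite (lt_le_trans (S_gt0 t0)) ?S_le_rho. Qed.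

Let rho_neq0 t : 0 <= t -> rho t != 0.
Proof. by move=> t0; rewrite gt_eqF// rho_gt0. Qed.

Let S_neq0 t : 0 <= t -> S t != 0.
Proof. by move=> t0; rewrite gt_eqF// S_gt0. Qed.

(** [S / rho] is the squared cosine of the angle between [A w] and [h]. Its largest value on the
    range of [A] is [q], the squared norm of the projection of [h]. *)
Definition gap t := q - S t / rho t.

Lemma gap_deriv : flow_deriv gap (fun t => - (2 * P t / rho t) * gap t).
Proof.
have := flow_derivB (flow_deriv_cst q) (flow_derivM dS (flow_derivV rho_neq0 drho)).
move/flow_deriv_eq; apply => t /ltW t0; rewrite /gap exprSr; field.
exact: rho_neq0.
Qed.

Definition sin2 t := I t ^+ 2 / S t ^+ n.+1.

Lemma sin2_deriv :
  flow_deriv sin2 (fun t => - (2 * n.+1%:R * q * P t / S t) * sin2 t).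
Proof.
have Sn0 t : 0 <= t -> S t ^+ n.+1 != 0 by move=> t0; rewrite expf_neq0// S_neq0.
have := flow_derivM (flow_derivX 1 dI) (flow_derivV Sn0 (flow_derivX n dS)).
move/flow_deriv_eq; apply => t /ltW t0; rewrite /sin2 !(exprSr (S t)) expr1; field.
by rewrite S_neq0// expf_neq0// S_neq0.
Qed.

Lemma sin2_ge0 t : 0 <= t -> 0 <= sin2 t.
Proof. by move=> t0; rewrite divr_ge0 ?sqr_ge0// exprn_ge0 ?S_ge0. Qed.

Lemma sqr_P t : 0 <= t -> P t ^+ 2 = (1 - sin2 t) * S t ^+ n.+1.
Proof.
move=> t0; rewrite mulrBl mul1r divfK ?expf_neq0 ?S_neq0// SPI//; ring.
Qed.

Lemma sqr_P_rho t : 0 <= t ->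
  P t ^+ 2 = (1 - sin2 t) * (S t / rho t) ^+ n.+1 * rho t ^+ n.+1.
Proof. by move=> t0; rewrite sqr_P// -mulrA -exprMn divfK// rho_neq0. Qed.

Section Decay.
Variables a lam B : R.
Hypotheses (a0 : 0 <= a) (B0 : 0 <= B).
Hypothesis lamP : forall t, a < t -> lam <= P t.

(** [rho <= 1] makes the rate [2 P / rho] at least [P]. With [lam = 0] this is a monotonicity
    statement, the form used as long as only [P > 0] is known. *)
Lemma gap_decay t : gap a <= B -> a <= t -> gap t <= B * expR (- lam * (t - a)).
Proof.
move=> ga; apply: (flow_gronwall a0 gap_deriv B0 ga) => {}t at_ g0.
have t0 : 0 <= t by exact: ltW (le_lt_trans a0 at_).
rewrite ler_pM2r// lerN2; apply: le_trans (lamP at_) _.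
rewrite ler_pdivlMr ?rho_gt0//.
rewrite mulrC ler_pM2r ?P_gt0//; have := rho_le1 t0; lra.
Qed.

(** [S <= 1] and [2 s q >= 1], a consequence of [q >= 1/2], make the rate [2 s q P / S] at least
    [P]. *)
Lemma sin2_decay t : sin2 a <= B -> a <= t -> sin2 t <= B * expR (- lam * (t - a)).
Proof.
move=> ga; apply: (flow_gronwall a0 sin2_deriv B0 ga) => {}t at_ g0.
have t0 : 0 <= t by exact: ltW (le_lt_trans a0 at_).
rewrite ler_pM2r// lerN2; apply: le_trans (lamP at_) _.
rewrite ler_pdivlMr ?S_gt0//.
rewrite mulrC ler_pM2r ?P_gt0//; apply: le_trans (S_le1 t0) _.
have : (1:R) <= n.+1%:R by rewrite ler1n.
case/andP: q01; nra.
Qed.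

End Decay.

(** The factor [1 - u] is at most [1], so [(1 - u) ^ s <= 1 - u]. It turns an alignment bound free
    of [s] into [e ^ s * rho ^ s <= P ^ 2], and so keeps the constants of the last phase independent
    of [s]. *)
Lemma expn_le_mul_expn (e u k : R) : 0 <= u -> u <= 1 -> 0 <= e -> e <= (1 - u) * k ->
  k <= 1 -> e ^+ n.+1 <= (1 - u) * k ^+ n.+1.
Proof.
move=> u0 u1 e0 eu k1; have uk : 0 <= (1 - u) * k by exact: le_trans eu.
have [k0|k0] := leP 0 k; last first.
  have u01 : 1 - u = 0.
    apply/eqP; rewrite eq_le subr_ge0 u1 andbT leNgt; apply/negP => u10.
    by move: uk; rewrite pmulr_rge0// leNgt k0.
  have -> : e = 0 by apply/eqP; rewrite eq_le e0 andbT (le_trans eu)// u01 mul0r.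
  by rewrite u01 mul0r expr0n.
apply: (@le_trans _ _ (((1 - u) * k) ^+ n.+1)); first by rewrite lerXn2r.
rewrite exprMn ler_wpM2r ?exprn_ge0// exprS ler_piMr ?subr_ge0//.
by rewrite exprn_ile1 ?subr_ge0// gerBl.
Qed.

(** The error budget in sixteenths of [eps]: eight for [1 - q], one for the gap, one for the
    phase. *)
Lemma alignment_ge (q' k u eps : R) : q' <= 1 -> 0 < eps -> eps < 1 -> 1 - q' <= eps / 2 ->
  q' - k <= eps / 16 -> u <= eps / 16 -> 0 <= u -> 1 - 10 / 16 * eps <= (1 - u) * k.
Proof. by move=> *; nra. Qed.

(** With [Q = r ^ s], [p >= 2/5] gives [Q >= 4/25], and [2 (p - Q) >= p ^ 2 - Q ^ 2 >= Q (e ^ s - Q)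
    >= Q ^ 2 (e - r)] because [p + Q <= 2]. The constant [1/40] is just below [(4/25) ^ 2]. *)
Lemma norm_restoring (e r p : R) : 0 <= r -> r <= 1 -> r < e -> 2 / 5 <= p ->
  p ^+ 2 <= r ^+ n.+1 -> e ^+ n.+1 * r ^+ n.+1 <= p ^+ 2 ->
  1 / 40 * (e - r) <= 2 * (p - r ^+ n.+1).
Proof.
move=> r0 r1 er p_ge p2 pe; set Rt := r ^+ n.+1 in p2 pe *.
have R0 : 0 <= Rt by rewrite exprn_ge0.
have R1 : Rt <= 1 by rewrite exprn_ile1.
have eR : r ^+ n * (e - r) <= e ^+ n.+1 - Rt.
  rewrite mulrBr -exprSr lerD2r exprSr ler_wpM2r ?lerXn2r ?nnegrE//; lra.
have Rn : Rt <= r ^+ n by rewrite /Rt exprSr ler_piMr// exprn_ge0.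
have {eR Rn} : Rt * (e - r) <= e ^+ n.+1 - Rt.
  by apply: le_trans eR; rewrite ler_wpM2r// subr_ge0 ltW.
move: (e ^+ n.+1) Rt R0 R1 p2 pe => E Q Q0 Q1 p2 pe EQ.
have Q4 : 4 / 25 <= Q by nra.
have p1 : p <= 1 by nra.
have h1 : Q * (Q * (e - r)) <= Q * (E - Q) by rewrite ler_wpM2l.
have h2 : 16 / 625 * (e - r) <= Q * (Q * (e - r)).
  by rewrite mulrA ler_wpM2r ?subr_ge0 ?(ltW er)//; nra.
have [Qp|pQ] := leP Q p.
  have h3 : p ^+ 2 - Q ^+ 2 <= 2 * (p - Q) by nra.
  lra.
have : p ^+ 2 < Q * Q by nra.
lra.
Qed.

(* Once the signal [P] is bounded below, the gap and the phase error decay at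
   rate [P], and then [rho] is driven up to [e], because
   [P ^+ 2 - rho ^+ 2s >= rho ^+ s * (e ^+ s - rho ^+ s)]. *)
Lemma phase2 (eps a : R) : 0 < eps < 1 -> 1 - q <= eps / 2 -> 0 <= a ->
  (forall t, a <= t -> 2 / 5 <= P t) ->
  exists T, [/\ 0 <= T, T <= a + 133 * ln (1 + eps^-1),
    1 - eps <= Num.sqrt (S T), 1 - eps <= P T / Num.sqrt (S T) ^+ n.+1 &
    rho T - S T <= eps].
Proof.
case/andP=> e0 e1 qe a0 Pge.
have [q0 q1] : 1 / 2 <= q /\ q <= 1 by case/andP: q01.
set L := ln (1 + eps^-1).
have ie : 1 < eps^-1 by rewrite invf_gt1.
have L0 : 0 < L by rewrite ln_gt0// ltrDl invr_gt0.
have lnle (c : R) k : 0 < c -> c * eps^-1 <= (1 + eps^-1) ^+ k ->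
    ln (c / eps) <= k%:R * L.
  move=> c0 H; rewrite mulr_natl -lnXn; last by lra.
  by rewrite ler_ln// posrE; [rewrite divr_gt0 | rewrite exprn_gt0; lra].
have expR_ln (c : R) : 0 < c -> c * expR (- ln (c / eps)) = eps.
  by move=> c0; rewrite expRN lnK ?posrE ?divr_gt0//; field; rewrite !gt_eqF.
have gap_le1 : gap a <= 1.
  by have := divr_ge0 (S_ge0 a0) (rho_ge0 a0); rewrite /gap; lra.
have sin2_le1 t : 0 <= t -> sin2 t <= 1.
  move=> t0; have := sqr_P t0; have := sqr_ge0 (P t) => + E; rewrite E.
  by rewrite pmulr_lge0 ?exprn_gt0 ?S_gt0// subr_ge0.
set l16 := ln (16 / eps).
(* Since [eps < 1], [16 <= (1 + 1/eps) ^ 4]. *)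
have l16_le : l16 <= 5 * L.
  apply: lnle => //; have {}ie := ltW ie; rewrite exprSr ler_pM//.
  - by rewrite invr_ge0 ltW.
  - by apply: (@le_trans _ _ (2 ^+ 4)); [lra | by rewrite lerXn2r ?nnegrE; lra].
  - by lra.
have l16_ge0 : 0 <= l16 by rewrite ln_ge0//; lra.
(* The time in which a decay of rate [2/5] brings [1] down to [eps / 16]. *)
set T2 := a + 5 / 2 * l16.
have T2a : a <= T2 by rewrite lerDl mulr_ge0//; lra.
have T20 : 0 <= T2 by exact: le_trans T2a.
have small t : T2 <= t -> 1 * expR (- (2 / 5) * (t - a)) <= eps / 16.
  move=> tT; rewrite mul1r -(expR_ln 16 _)// mulrAC mulfV// mul1r ler_expR -/l16.
  rewrite /T2 in tT; lra.
have gapT t : T2 <= t -> gap t <= eps / 16.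
  move=> tT; apply: le_trans (small _ tT).
  apply: (gap_decay a0) => //; last exact: le_trans tT.
  by move=> u au; apply: Pge; exact: ltW.
have sinT t : T2 <= t -> sin2 t <= eps / 16.
  move=> tT; apply: le_trans (small _ tT).
  apply: (sin2_decay a0) => //; [|exact: sin2_le1|exact: le_trans tT].
  by move=> u au; apply: Pge; exact: ltW.
set e := 1 - 10 / 16 * eps.
have e_ge0 : 0 <= e by rewrite /e; lra.
set l4 := ln (4 / eps).
have l4_le : l4 <= 3 * L.
  apply: lnle => //; have {}ie := ltW ie; rewrite exprSr ler_pM//.
  - by rewrite invr_ge0 ltW.
  - by apply: (@le_trans _ _ (2 ^+ 2)); [lra | by rewrite lerXn2r ?nnegrE; lra].
  - by lra.
have l4_ge0 : 0 <= l4 by rewrite ln_ge0//; lra.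
(* The rate [1/40] of [norm_restoring] brings [e - rho] from at most [1] to at most [eps / 4] in
   this time. In all [5/2 * 5 + 40 * 3 = 132.5] multiples of [L], whence [133]. *)
set T := T2 + 40 * l4.
have T2T : T2 <= T by rewrite lerDl mulr_ge0.
have T0 : 0 <= T by exact: le_trans T2T.
have erho : e - rho T <= eps / 4.
  have yd := flow_derivB (flow_deriv_cst e) drho.
  have rT2 := rho_ge0 T20.
  have := @flow_gronwall _ _ _ T2 (1/40) 1 T20 yd ler01.
  rewrite {1}/e => /(_ ltac:(lra)) H.
  apply: le_trans (H _ _ T2T) _; last first.
    rewrite -(expR_ln 4 _)// mulrAC mulfV// !mul1r ler_expR -/l4 /T; lra.
  move=> t T2t ert /=; have t0 : 0 <= t by exact: ltW (le_lt_trans T20 T2t).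
  set r := rho t in ert *; set Rt := r ^+ n.+1.
  have r0 : 0 <= r by exact: rho_ge0.
  have Pt := Pge t (le_trans T2a (ltW T2t)).
  have P2R : P t ^+ 2 <= Rt by exact: sqr_P_le.
  have PR : e ^+ n.+1 * Rt <= P t ^+ 2.
    rewrite sqr_P_rho// ler_wpM2r ?exprn_ge0//.
    have g := gapT _ (ltW T2t); have s2 := sinT _ (ltW T2t); rewrite /gap in g.
    have k1 : S t / r <= 1 by rewrite ler_pdivrMr ?rho_gt0// mul1r S_le_rho.
    apply: (expn_le_mul_expn (sin2_ge0 t0) (sin2_le1 _ t0) e_ge0 _ k1).
    exact: alignment_ge q1 e0 e1 qe g s2 (sin2_ge0 t0).
  have r1 : r <= 1 by exact: rho_le1.
  have er : r < e by rewrite -subr_gt0.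
  have := norm_restoring r0 r1 er Pt P2R PR; rewrite -/Rt; lra.
have gT := gapT _ T2T; have sT := sinT _ T2T; rewrite /gap in gT.
have rT1 := rho_le1 T0.
have kT : 1 - 9 / 16 * eps <= S T / rho T by lra.
have ST : (1 - eps) ^+ 2 <= S T.
  have -> : S T = S T / rho T * rho T by rewrite divfK// rho_neq0.
  rewrite expr2 ler_pM//; rewrite /e in erho; lra.
exists T; split=> //.
- rewrite /T /T2; lra.
- by rewrite -(@ler_pXn2r _ 2) ?nnegrE ?sqrtr_ge0 ?sqr_sqrtr ?S_ge0//; lra.
- set z := _ / _; have z0 : 0 <= z.
    by rewrite divr_ge0 ?exprn_ge0 ?sqrtr_ge0// ltW// P_gt0.
  have z2 : z ^+ 2 = 1 - sin2 T.
    rewrite /z expr_div_n sqr_P// -exprM mulnC exprM sqr_sqrtr ?S_ge0// mulfK//.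
    by rewrite expf_neq0 ?S_neq0.
  by have := sin2_ge0 T0; nra.
- have : (1 - S T / rho T) * rho T <= (1 - S T / rho T) * 1.
    rewrite ler_wpM2l// subr_ge0 ler_pdivrMr ?rho_gt0// mul1r; exact: S_le_rho.
  rewrite mulrBl divfK ?rho_neq0//; lra.
Qed.

(** For [s = 1] the equation of [P] is [P' = q - P], without [rho]. After time [ln 2],
    [P >= q - 1/2 >= 7/16 > 2/5]. *)
Lemma phase1_linear : n = 0%N -> 15 / 16 <= q ->
  forall t, ln 2 <= t -> 2 / 5 <= P t.
Proof.
move=> n0 q_ge t; have ln20 : 0 <= ln 2 :> R by rewrite ln_ge0// ler1n.
move=> lt; have t0 : 0 <= t by exact: le_trans lt.
have [_ q1] : 1 / 2 <= q /\ q <= 1 by case/andP: q01.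
have yd := flow_derivB (flow_deriv_cst q) dP.
suff : q - P t <= 1 * expR (- 1 * (t - 0)).
  have : expR (- 1 * (t - 0)) <= expR (- ln 2) by rewrite ler_expR; lra.
  rewrite [X in _ <= X -> _]expRN lnK ?posrE//; lra.
apply: (flow_gronwall (lexx 0) yd ler01) t0; first by have := P_gt0 (lexx 0); lra.
by move=> u u0 _; rewrite n0 !expr0; lra.
Qed.

(** * Escape from the initialization for [s > 1] *)

Section Phase1.
Hypothesis n_gt0 : (0 < n)%N.
Hypothesis q_ge : 1 - (16 * n.+1%:R)^-1 <= q.

Let s_ge2 : 2 <= n.+1%:R :> R. Proof. by rewrite ler_nat ltnS. Qed.

(* A lower bound of [kappa ^+ s], where [kappa = S / rho] is the squared cosine
   of the angle between the learned direction and the signal. *)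
Let K := (q * S 0) ^+ n.+1.

Let q0 : 0 <= q. Proof. by case/andP: q01; lra. Qed.
Let q1 : q <= 1. Proof. by case/andP: q01. Qed.

Let K_ge0 : 0 < K.
Proof. by rewrite exprn_gt0// mulr_gt0 ?S_gt0//; case/andP: q01; lra. Qed.

Let K_le1 : K <= 1.
Proof.
rewrite exprn_ile1 ?mulr_ge0 ?S_ge0// mulr_ile1 ?S_ge0//.
exact: S_le1.
Qed.

Lemma kappaX_ge t : 0 <= t -> K <= (S t / rho t) ^+ n.+1.
Proof.
move=> t0; have k0 u : 0 <= u -> 0 <= S u / rho u.
  by move=> u0; rewrite divr_ge0 ?S_ge0 ?rho_ge0.
rewrite lerXn2r ?nnegrE ?k0 ?mulr_ge0 ?S_ge0//.
have S01 := S_le1 (lexx 0); have S00 := S_ge0 (lexx 0).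
(* The bound [q - q * S 0] is used because the decay lemma asks for a nonnegative level, which the
   assumptions made here do not give for [gap 0 = q - S 0] itself. *)
have g0 : gap 0 <= q - q * S 0.
  by rewrite /gap rho0 divr1 lerD2l lerN2 ler_piMl.
have B0 : 0 <= q - q * S 0 by rewrite subr_ge0 ler_piMr.

have := @gap_decay 0 0 (q - q * S 0) (lexx _) B0 _ t g0 t0.
rewrite oppr0 mul0r expR0 mulr1 /gap => H.
have : q - S t / rho t <= q - q * S 0.
  by apply: H => u u0; exact/ltW/P_gt0/ltW.
lra.
Qed.

(** The phase error starts at most at [3/4 = 1 - (1/2) ^ 2] and never grows, so [P ^ 2] keeps at
    least a quarter of [|m| ^ 2s]. *)
Lemma sqr_P_ge t : 0 <= t ->
  (S t / rho t) ^+ n.+1 * rho t ^+ n.+1 <= 4 * P t ^+ 2.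
Proof.
move=> t0; rewrite sqr_P_rho// 2!mulrA ler_wpM2r ?rho_ge0//.
rewrite exprn_ge0 ?rho_ge0//.
rewrite ler_peMl ?exprn_ge0 ?divr_ge0 ?S_ge0 ?rho_ge0//.
have s0 : sin2 0 <= 3 / 4.
  have := P0_ge; rewrite sqr_P//.
  have SX : 0 < S 0 ^+ n.+1 by rewrite exprn_gt0// S_gt0.
  rewrite mulrA -{1}(mul1r (S 0 ^+ _)) ler_pM2r//; lra.
have B0 : (0:R) <= 3 / 4 by lra.
have := @sin2_decay 0 0 (3 / 4) (lexx _) B0 _ t s0 t0.
rewrite oppr0 mul0r expR0 mulr1 => H.
suff : sin2 t <= 3 / 4 by lra.
by apply: H => u u0; exact/ltW/P_gt0/ltW.
Qed.

(** Where [rho ^ s < K / 4], [4 P ^ 2 >= K * rho ^ s >= 4 * rho ^ 2s], so [P >= rho ^ s] and [rho]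
    does not decrease. Initially [rho = 1 >= K / 4]. *)
Lemma rhoX_ge t : 0 <= t -> K / 4 <= rho t ^+ n.+1.
Proof.
move=> t0; rewrite -subr_le0.
have yd := flow_derivB (flow_deriv_cst (K / 4)) (flow_derivX n drho).
have := @flow_nonincr_above _ _ _ 0 0 (lexx _) yd; rewrite rho0 expr1n => H.
apply: (H _ _ _ t0); first by have := K_le1; lra.
move=> u u0 ru; have {}u0 := ltW u0.
rewrite sub0r oppr_le0 mulr_ge0// ?mulr_ge0 ?exprn_ge0 ?rho_ge0//.
rewrite subr_ge0 ler_pM2l//.
rewrite -(@ler_pXn2r _ 2) ?nnegrE ?exprn_ge0 ?rho_ge0 ?(ltW (P_gt0 _))//.
have := sqr_P_ge u0; have := kappaX_ge u0.
have : 0 <= rho u ^+ n.+1 by rewrite exprn_ge0 ?rho_ge0.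
move: ru; nra.
Qed.

Lemma P_ge t : 0 <= t -> K / 4 <= P t.
Proof.
move=> t0; rewrite -(@ler_pXn2r _ 2) ?nnegrE ?(ltW (P_gt0 t0))//; last first.
  by rewrite divr_ge0// ltW.
have := sqr_P_ge t0; have := kappaX_ge t0; have := rhoX_ge t0; have := K_ge0.
set k := (_ / _) ^+ _; set r := _ ^+ _; move=> *.
have : K * r <= k * r by rewrite ler_wpM2r//; lra.
have : K * (K / 4) <= K * r by rewrite ler_wpM2l// ltW.
lra.
Qed.

(** Two waiting times. During the first one, [P >= K / 4] brings the gap and the phase error below
    [1 / (16 s)]; then [S / rho >= 1 - 1 / (8 s)], Bernoulli gives [(S / rho) ^ s >= 7/8], and
    [P ^ 2 >= 3/4 * rho ^ s]. From then on [R = rho ^ s] satisfies [R' >= R ^ 2 / 2] below [1/2],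
    and [R >= K / 4] turns this into a decay of [1/2 - R] at rate [(K / 4) ^ 2]. The second time
    halves its initial bound [1/2], so [R >= 1/4] and [P ^ 2 >= 3/16 > 4/25]. *)
Lemma phase1 t : 4 / K * ln (16 * n.+1%:R) + 16 / K ^+ 2 * ln 2 <= t ->
  2 / 5 <= P t.
Proof.
set a := 4 / K * _; set b := 16 / K ^+ 2 * _.
have a0 : 0 <= a.
  by rewrite mulr_ge0 ?divr_ge0 ?(ltW K_ge0)// ln_ge0//; have := s_ge2; lra.
have b0 : 0 <= b by rewrite mulr_ge0 ?divr_ge0 ?sqr_ge0// ln_ge0//; lra.
move=> abt; have at_ : a <= t by lra.
have t0 : 0 <= t by lra.
have small u : a <= u -> 1 * expR (- (K / 4) * (u - 0)) <= (16 * n.+1%:R)^-1.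
  move=> au; rewrite mul1r -[leRHS]lnK ?posrE ?invr_gt0; last first.
    by have := s_ge2; lra.
  rewrite ler_expR lnV ?posrE; last by have := s_ge2; lra.
  rewrite subr0 mulNr lerN2.
  have -> : ln (16 * n.+1%:R) = K / 4 * a :> R.
    by rewrite /a; field; rewrite gt_eqF// K_ge0.
  by rewrite ler_pM2l// divr_gt0.
have is16 : (16 * n.+1%:R)^-1 <= 32^-1 :> R.
  by rewrite lef_pV2 ?posrE; have := s_ge2; lra.
have is0 : 0 <= (16 * n.+1%:R)^-1 :> R by rewrite invr_ge0 mulr_ge0.
have [i16 i16E] : exists i, i = (16 * n.+1%:R)^-1 :> R by eexists.
have qg := q_ge; rewrite -i16E in small is16 is0 qg.
have gapu u : a <= u -> gap u <= i16.
  move=> au; have u0 : 0 <= u by exact: le_trans au.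
  apply: le_trans (small _ au); apply: (gap_decay (lexx 0)) => //.
    by move=> v v0; exact/P_ge/ltW.
  by rewrite /gap rho0 divr1; have := S_ge0 (lexx 0); have := q1; lra.
have sinu u : a <= u -> sin2 u <= 32^-1.
  move=> au; have u0 : 0 <= u by exact: le_trans au.
  apply: le_trans is16; apply: le_trans (small _ au).
  apply: (sin2_decay (lexx 0)) => //; first by move=> v v0; exact/P_ge/ltW.
  have := sqr_P (lexx 0); have := sqr_ge0 (P 0) => + E; rewrite E.
  by rewrite pmulr_lge0 ?exprn_gt0 ?S_gt0// subr_ge0.
have PR u : a <= u -> 3 / 4 * rho u ^+ n.+1 <= P u ^+ 2.
  move=> au; have u0 : 0 <= u by exact: le_trans au.
  rewrite sqr_P_rho// ler_wpM2r ?exprn_ge0 ?rho_ge0//.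
  have g := gapu _ au; have s := sinu _ au; rewrite /gap in g.
  have : (1 - (8 * n.+1%:R)^-1) ^+ n.+1 <= (S u / rho u) ^+ n.+1.
    have e8 : (8 * n.+1%:R)^-1 = 2 * i16 :> R.
      by rewrite i16E; field; rewrite nat1r pnatr_eq0.
    rewrite lerXn2r ?nnegrE ?divr_ge0 ?S_ge0 ?rho_ge0//; rewrite e8.
      by move: is16; lra.
    by move: qg g; lra.
  have : 7 / 8 <= (1 - (8 * n.+1%:R)^-1) ^+ n.+1 :> R.
    apply: le_trans (bernoulli_le _ _); last first.
      by rewrite invr_ge0 mulr_ge0//= invf_le1; have := s_ge2; lra.
    by rewrite invfM mulrCA mulfV ?pnatr_eq0//; lra.
  move: s; nra.
have yd := flow_derivB (flow_deriv_cst (1 / 2)) (flow_derivX n drho).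
have := @flow_gronwall _ _ _ a ((K / 4) ^+ 2) (1 / 2) a0 yd _ _ _ t at_.
move=> H; have {H} : 1 / 2 - rho t ^+ n.+1 <= 1 / 2 * expR (- (K / 4) ^+ 2 * (t - a)).
  apply: H; first by lra.
    by rewrite lerBlDr lerDl exprn_ge0 ?rho_ge0.
  move=> u au yu; have u0 : 0 <= u by exact: ltW (le_lt_trans a0 au).
  have P2 := PR _ (ltW au).
  have RK := rhoX_ge u0.
  have Rn : rho u ^+ n.+1 <= rho u ^+ n.
    by rewrite exprSr ler_piMr ?exprn_ge0 ?rho_le1 ?rho_ge0.
  set r := rho u ^+ n.+1 in yu P2 RK Rn *; have Pu := P_gt0 u0.
  have r0 : 0 < r by apply: lt_le_trans RK; rewrite divr_gt0.
  (* While [r < 1/2], [P ^ 2 >= 3/4 * r >= (6/5 * r) ^ 2], because [36/25 * 1/2 < 3/4]. *)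
  have PR5 : r / 5 <= P u - r.
    suff : 6 / 5 * r <= P u by lra.
    by rewrite -(@ler_pXn2r _ 2) ?nnegrE ?(ltW Pu)//; nra.
  have h1 : 1 * r <= n.+1%:R * rho u ^+ n.
    by rewrite ler_pM// ?(ltW r0)//; have := s_ge2; lra.
  have h2 : r * (2 * (r / 5)) <= n.+1%:R * rho u ^+ n * (2 * P u - 2 * r).
    by rewrite ler_pM//; lra.
  have h3 : 2 * r <= n.+1%:R * rho u ^+ n.
    by rewrite ler_pM// ?(ltW r0)//; have := s_ge2; lra.
  have h4 : 2 * r * (2 * (r / 5)) <= n.+1%:R * rho u ^+ n * (2 * P u - 2 * r).
    by rewrite ler_pM//; lra.
  have h5 : (K / 4) ^+ 2 * (1 / 2 - r) <= r ^+ 2 * (1 / 2).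
    rewrite ler_pM ?sqr_ge0//; [lra | | lra].
    by rewrite lerXn2r ?nnegrE// ?(ltW r0)// divr_ge0 ?(ltW K_ge0).
  rewrite sub0r mulNr lerN2; lra.
have : expR (- (K / 4) ^+ 2 * (t - a)) <= 1 / 2.
  rewrite -[leRHS]lnK ?posrE// ler_expR mul1r lnV ?posrE// mulNr lerN2.
  have -> : ln 2 = (K / 4) ^+ 2 * b :> R.
    by rewrite /b; field; rewrite gt_eqF// K_ge0.
  by rewrite ler_pM2l ?exprn_gt0 ?divr_gt0//; lra.
move=> h1 h2; have := PR _ at_ => h3.
rewrite -(@ler_pXn2r _ 2) ?nnegrE ?(ltW (P_gt0 t0))//; lra.
Qed.

End Phase1.

End SummaryDynamics.

(** Since [r <= 1] and [s <= s ^ s], the smallness assumption yields [1 - q <= 1 / (16 s)].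
    Bernoulli then gives [q ^ s >= 15/16], so [K >= r ^ 2s / 2], and the waiting time [1 / K ^ 2]
    becomes [r ^- 4s]. *)
Lemma summary_dynamics_converge (R : realType) (n : nat) (q eps r : R)
    (S P I rho : R -> R) :
  0 < eps -> 0 < r <= 1 -> q <= 1 ->
  1 - q <= Num.min (eps / 2) (16^-1 * r ^+ 4 / n.+1%:R ^+ n.+1) ->
  flow_deriv S (fun t => 2 * q * P t - 2 * rho t ^+ n * S t) ->
  flow_deriv P (fun t => n.+1%:R * q * S t ^+ n - n.+1%:R * rho t ^+ n * P t) ->
  flow_deriv I (fun t => - n.+1%:R * rho t ^+ n * I t) ->
  flow_deriv rho (fun t => 2 * P t - 2 * rho t ^+ n.+1) ->
  (forall t, 0 <= t -> S t ^+ n.+1 = P t ^+ 2 + I t ^+ 2) ->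
  (forall t, 0 <= t -> 0 <= S t) ->
  (forall t, 0 <= t -> S t <= rho t) ->
  rho 0 = 1 -> S 0 = r ^+ 2 -> 1 / 2 <= P 0 / r ^+ n.+1 ->
  exists T, 0 <= T /\
    T <= (if n.+1 == 1%N then 400 * ln (1 + eps^-1)
          else 400 * (2 ^+ (n.+1 * n.+1) / r ^+ (4 * n.+1) + ln (1 + eps^-1))) /\
    1 - eps <= Num.sqrt (S T) /\ 1 - eps <= P T / Num.sqrt (S T) ^+ n.+1 /\
    rho T - S T <= eps.
Proof.
move=> e0 /andP[r0 r1] q1 qmin dS dP dI drho SPI S_ge0 S_le_rho rho0 S0 P0r.
have [qe qr] : 1 - q <= eps / 2 /\ 1 - q <= 16^-1 * r ^+ 4 / n.+1%:R ^+ n.+1.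
  by move: qmin; rewrite le_min => /andP[].
have L0 : 0 < ln (1 + eps^-1) by rewrite ln_gt0// ltrDl invr_gt0.
have bound0 : 0 <= 2 ^+ (n.+1 * n.+1) / r ^+ (4 * n.+1) :> R.
  by rewrite divr_ge0// exprn_ge0// ltW.
have sqrtS0 : Num.sqrt (S 0) = r by rewrite S0 sqrtr_sqr gtr0_norm.
(* For [eps >= 1] the initial point already qualifies; the logarithmic comparisons of [phase2] need
   [eps < 1]. *)
case: (leP 1 eps) => [e1|e1].
  exists 0; rewrite lexx sqrtS0; split=> //; split.
    case: ifP => _; apply: mulr_ge0 (ler0n _ _) _; first exact: ltW.
    exact: addr_ge0 bound0 (ltW L0).
  split; first lra.
  split; first lra.
  by rewrite rho0; have := S_ge0 0 (lexx 0); lra.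
have rX : 0 < r ^+ n.+1 by rewrite exprn_gt0.
have P0 : 0 < P 0 by move: P0r; rewrite ler_pdivlMr//; lra.
have P0S : S 0 ^+ n.+1 <= 4 * P 0 ^+ 2.
  rewrite S0 -exprM mulnC exprM; move: P0r; rewrite ler_pdivlMr//.
  by set x := r ^+ n.+1 in rX * => H; nra.
have sX : n.+1%:R <= n.+1%:R ^+ n.+1 :> R.
  by rewrite exprS ler_peMr// exprn_ege1// ler1n.
have q16 : 1 - (16 * n.+1%:R)^-1 <= q.
  rewrite lerBlDr addrC -lerBlDr; apply: le_trans qr _.
  rewrite invfM ler_pM ?invr_ge0 ?exprn_ge0 ?mulr_ge0 ?invr_ge0 ?(ltW r0)//.
    by rewrite ler_piMr// exprn_ile1// ltW.
  by rewrite lef_pV2 ?posrE ?exprn_gt0.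
have is16 : (16 * n.+1%:R)^-1 <= 16^-1 :> R.
  by rewrite lef_pV2 ?posrE// ler_peMr// ler1n.
have q_ge : 15 / 16 <= q by move: q16 is16; move: (16 * _)^-1 => i; lra.
have q01 : 1 / 2 <= q <= 1 by rewrite q1 andbT; lra.
have e01 : 0 < eps < 1 by rewrite e0.
have fin := phase2 q01 dS dP dI drho SPI S_ge0 S_le_rho rho0 P0 e01 qe.
suff [a [a0 Pa aT]] : exists a, [/\ 0 <= a, forall t, a <= t -> 2 / 5 <= P t &
    a + 133 * ln (1 + eps^-1) <=
      if n.+1 == 1%N then 400 * ln (1 + eps^-1)
      else 400 * (2 ^+ (n.+1 * n.+1) / r ^+ (4 * n.+1) + ln (1 + eps^-1))].
  have [T [T0 Ta ? ? ?]] := fin a a0 Pa.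
  by exists T; do !split=> //; exact: le_trans aT.
case: n rX dS dP dI drho SPI P0r P0S sX q16 is16 {fin bound0 qr qmin}
    => [|k] rX dS dP dI drho SPI P0r P0S sX q16 is16.
  have l2 : ln 2 <= ln (1 + eps^-1).
    by rewrite ler_ln ?posrE ?addr_gt0 ?invr_gt0// lerD2l invf_ge1 ?ltW.
  exists (ln 2); split.
  - by rewrite ln_ge0// ler1n.
  - exact: (phase1_linear q01 dP drho SPI S_ge0 S_le_rho rho0 P0 erefl).
  - by rewrite eqxx; lra.
have := phase1 q01 dS dP dI drho SPI S_ge0 S_le_rho rho0 P0 P0S isT q16.
set K := (q * S 0) ^+ k.+2; set s := k.+2 => PK.
have rs : r ^+ (2 * s) / 2 <= K.
  have r2 : 0 <= (r ^+ 2) ^+ s by rewrite exprn_ge0// sqr_ge0.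
  rewrite /K S0 exprMn exprM mulrC ler_wpM2r//.
  apply: (@le_trans _ _ ((1 - (16 * s%:R)^-1) ^+ s)); last first.
    by rewrite lerXn2r ?nnegrE//; move: q16 is16; rewrite -/s; move: (16 * _)^-1 => i; lra.
  apply: (@le_trans _ _ (1 - s%:R * (16 * s%:R)^-1)).
    by rewrite invfM mulrCA mulfV ?pnatr_eq0//; lra.
  apply: bernoulli_le; rewrite invr_ge0 mulr_ge0//=.
  by move: is16; rewrite -/s; move: (16 * _)^-1 => i; lra.
have r2s : 0 < r ^+ (2 * s) by rewrite exprn_gt0.
have K0 : 0 < K by apply: lt_le_trans rs; rewrite divr_gt0.
have iK : K^-1 <= 2 * (r ^+ (2 * s))^-1.
  have -> : 2 * (r ^+ (2 * s))^-1 = (r ^+ (2 * s) / 2)^-1 by rewrite invf_div.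
  by rewrite lef_pV2 ?posrE// divr_gt0.
set u := (r ^+ (2 * s))^-1 in iK; have u1 : 1 <= u.
  by rewrite invf_ge1// exprn_ile1// ltW.
have u2 : (r ^+ (4 * s))^-1 = u ^+ 2 by rewrite /u exprVn -exprM mulnAC.
have iK0 : 0 < K^-1 by rewrite invr_gt0.
have ln16 : 0 <= ln (16 * s%:R : R) <= (16 * s%:R : R).
  have : 1 <= s%:R :> R by rewrite ler1n.
  move: (s%:R) => z z1; apply/andP; split; first by rewrite ln_ge0//; lra.
  by rewrite ltW// ln_sublinear//; lra.
have ln2 : 0 <= ln (2 : R) <= 1.
  by rewrite ln_ge0 ?ler1n//=; apply: (@le_ln1Dx R 1); lra.
have s2 : s%:R <= 2 ^+ (s * s) :> R.
  rewrite -natrX ler_nat; apply: leq_trans (ltnW (ltn_expl s (isT : (1 < 2)%N))) _.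
  by rewrite leq_exp2l// leq_pmulr.
have s1 : 1 <= 2 ^+ (s * s) :> R by rewrite exprn_ege1// ler1n.
case/andP: ln16 => l16_ge0 l16_le; case/andP: ln2 => l2_ge0 l2_le.
exists (4 / K * ln (16 * s%:R) + 16 / K ^+ 2 * ln 2); split.
- rewrite addr_ge0// mulr_ge0//; first by rewrite mulr_ge0// ltW.
  by rewrite divr_ge0// exprn_ge0// ltW.
- exact: PK.
rewrite (_ : (s == 1%N) = false)// u2.
set X := 2 ^+ _ in s1 s2 *; set L := ln (1 + _) in L0 *.
have u0 : 0 <= u by lra.
(* [X = 2 ^ (s * s)] absorbs [ln (16 s) <= 16 s]. The two waiting times are at most
   [128 * u ^ 2 * X] and [64 * u ^ 2 * X], within the constant [400]. *)
have h1 : 4 / K * ln (16 * s%:R) <= 4 * (2 * u) * (16 * X).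
  rewrite ler_pM//; first by rewrite mulr_ge0// ltW.
    by rewrite ler_wpM2l.
  by apply: le_trans l16_le _; rewrite ler_wpM2l.
have h2 : 16 / K ^+ 2 * ln 2 <= 16 * (4 * u ^+ 2) * 1.
  rewrite -exprVn.
  rewrite ler_pM//; first by rewrite mulr_ge0// sqr_ge0.
  rewrite ler_wpM2l//.
  have -> : 4 * u ^+ 2 = (2 * u) ^+ 2 by ring.
  by rewrite lerXn2r ?nnegrE ?(ltW iK0)// mulr_ge0.
have h3 : u * X <= u ^+ 2 * X by rewrite ler_wpM2r ?expr2 ?ler_peMl//; lra.
have h4 : u ^+ 2 * 1 <= u ^+ 2 * X by rewrite ler_wpM2l ?sqr_ge0.
have : 0 <= u ^+ 2 * 1 by rewrite mulr1 sqr_ge0.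
lra.
Qed.

(** * Expectations of bounded complex random variables *)

Section ComplexExpectation.
Context {R : realType} {d : measure_display} {T : measurableType d}.
Implicit Types F G : T -> R[i].

Definition cmeasurable F : Prop :=
  measurable_fun setT (fun t => complex.Re (F t)) /\
  measurable_fun setT (fun t => complex.Im (F t)).

(** The norm of [R[i]] takes its values in [R[i]], and so does the bound. *)
Definition cbounded (I : Type) (F : I -> R[i]) : Prop :=
  exists C : R[i], forall t, `|F t| <= C.

Lemma cmeasurable_cst (z : R[i]) : cmeasurable (fun=> z).
Proof. by split; exact: measurable_cst. Qed.

Lemma cmeasurableD F G : cmeasurable F -> cmeasurable G ->
  cmeasurable (fun t => F t + G t).
Proof.
move=> [Fr Fi] [Gr Gi]; split.
  by under eq_fun do rewrite raddfD; exact: measurable_funD.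
by under eq_fun do rewrite raddfD; exact: measurable_funD.
Qed.

Lemma cmeasurableM F G : cmeasurable F -> cmeasurable G ->
  cmeasurable (fun t => F t * G t).
Proof.
move=> [Fr Fi] [Gr Gi]; have E t : F t * G t =
  ((complex.Re (F t) * complex.Re (G t) - complex.Im (F t) * complex.Im (G t)) +i*
   (complex.Re (F t) * complex.Im (G t) + complex.Im (F t) * complex.Re (G t)))%C.
  by case: (F t) => a b; case: (G t).
split; under eq_fun do rewrite E /=.
  by apply: measurable_funB; exact: measurable_funM.
by apply: measurable_funD; exact: measurable_funM.
Qed.

Lemma cmeasurableJ F : cmeasurable F -> cmeasurable (fun t => (F t)^*).
Proof.
move=> [Fr Fi]; split.
  have E t : complex.Re ((F t)^*) = complex.Re (F t) by case: (F t).
  by under eq_fun do rewrite E.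
have E t : complex.Im ((F t)^*) = - complex.Im (F t) by case: (F t).
by under eq_fun do rewrite E; exact: measurable_funN.
Qed.

Lemma cmeasurable_sum (I : Type) (r : seq I) (Q : pred I) (F : I -> T -> R[i]) :
  (forall i, cmeasurable (F i)) -> cmeasurable (fun t => \sum_(i <- r | Q i) F i t).
Proof.
move=> mF; elim: r => [|i r IH].
  by under eq_fun do rewrite big_nil; exact: cmeasurable_cst.
under eq_fun do rewrite big_cons; case: (Q i) => //.
exact: cmeasurableD.
Qed.

Variable P : probability T R.

Definition cexpect F : R[i] :=
  (Rintegral P setT (fun t => complex.Re (F t)) +i*
   Rintegral P setT (fun t => complex.Im (F t)))%C.

(** Admissible integrands. Boundedness gives integrability and, unlike integrability, survives
    products; traces of powers of unitary matrices have it. *)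
Definition cadm F : Prop := cmeasurable F /\ cbounded F.

Lemma eq_cexpect F G : F =1 G -> cexpect F = cexpect G.
Proof. by move=> /funext ->. Qed.

Lemma bounded_Rintegrable (f : T -> R) (B : R) : measurable_fun setT f ->
  (forall t, `|f t| <= B) -> P.-integrable setT (EFin \o f).
Proof.
move=> mf fB; apply: measurable_bounded_integrable => //.
  exact: le_lt_trans (probability_le1 _ _) (ltry _).
exists B; split; first exact: num_real.
by move=> M BM t _; apply: le_trans (fB t) _; exact: ltW.
Qed.

Lemma norm_Re_le (z C : R[i]) : `|z| <= C -> `|complex.Re z| <= complex.Re C.
Proof.
move=> /(le_trans (normc_ge_Re z)); rewrite lecE => /andP[_] /=.
by [].
Qed.

Lemma norm_Im_le (z C : R[i]) : `|z| <= C -> `|complex.Im z| <= complex.Re C.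
Proof.
move=> zC; have := @norm_Re_le (z * 'i%C) C; rewrite ReiNIm normrN; apply.
rewrite normrM (_ : `|'i%C| = 1) ?mulr1//.
by rewrite normc_def /= expr0n expr1n add0r sqrtr1.
Qed.

Lemma cadm_integrable F : cadm F ->
  P.-integrable setT (EFin \o (fun t => complex.Re (F t))) /\
  P.-integrable setT (EFin \o (fun t => complex.Im (F t))).
Proof.
move=> [[mr mi] [C FC]]; split; apply: (@bounded_Rintegrable _ (complex.Re C)) => // t.
  exact: norm_Re_le.
exact: norm_Im_le.
Qed.

Lemma cadm_cst z : cadm (fun=> z).
Proof. by split; [exact: cmeasurable_cst | exists `|z|]. Qed.

Lemma cadmD F G : cadm F -> cadm G -> cadm (fun t => F t + G t).
Proof.
move=> [mF [A FA]] [mG [B GB]]; split; first exact: cmeasurableD.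
by exists (A + B) => t; rewrite (le_trans (ler_normD _ _))// lerD.
Qed.

Lemma cadmM F G : cadm F -> cadm G -> cadm (fun t => F t * G t).
Proof.
move=> [mF [A FA]] [mG [B GB]]; split; first exact: cmeasurableM.
by exists (A * B) => t; rewrite normrM ler_pM.
Qed.

Lemma cadmZ z F : cadm F -> cadm (fun t => z * F t).
Proof. by move=> aF; apply: cadmM => //; exact: cadm_cst. Qed.

Lemma cadmB F G : cadm F -> cadm G -> cadm (fun t => F t - G t).
Proof.
move=> aF aG; under eq_fun do rewrite -mulN1r.
by apply: cadmD => //; exact: cadmZ.
Qed.

Lemma cadmJ F : cadm F -> cadm (fun t => (F t)^*).
Proof.
move=> [mF [A FA]]; split; first exact: cmeasurableJ.
by exists A => t; rewrite norm_conjC.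
Qed.

Lemma cadm_sum (I : Type) (r : seq I) (Q : pred I) (F : I -> T -> R[i]) :
  (forall i, cadm (F i)) -> cadm (fun t => \sum_(i <- r | Q i) F i t).
Proof.
move=> mF; elim: r => [|i r IH].
  by under eq_fun do rewrite big_nil; exact: cadm_cst.
under eq_fun do rewrite big_cons; case: (Q i) => //.
exact: cadmD.
Qed.

Lemma cadmX F k : cadm F -> cadm (fun t => F t ^+ k).
Proof.
move=> mF; elim: k => [|k IH].
  by under eq_fun do rewrite expr0; exact: cadm_cst.
by under eq_fun do rewrite exprS; exact: cadmM.
Qed.

Lemma cexpectD F G : cadm F -> cadm G ->
  cexpect (fun t => F t + G t) = cexpect F + cexpect G.
Proof.
move=> /cadm_integrable[Fr Fi] /cadm_integrable[Gr Gi].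
rewrite /cexpect; apply/eqP; rewrite eq_complex /=; apply/andP; split; apply/eqP.
  by rewrite -RintegralD//; apply: eq_Rintegral => t _; rewrite raddfD.
by rewrite -RintegralD//; apply: eq_Rintegral => t _; rewrite raddfD.
Qed.

Lemma cexpectZ z F : cadm F -> cexpect (fun t => z * F t) = z * cexpect F.
Proof.
move=> /cadm_integrable[Fr Fi]; case: z => a b.
have Z (k : R) (f : T -> R) : P.-integrable setT (EFin \o f) ->
  P.-integrable setT (EFin \o (fun t => k * f t)).
  by move=> fi; have := @integrableZl _ _ _ P setT measurableT k _ fi.
rewrite /cexpect; apply/eqP; rewrite eq_complex /=; apply/andP; split; apply/eqP.
  rewrite -!RintegralZl//= -RintegralB//; try exact: Z.
  by apply: eq_Rintegral => t _; case: (F t).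
rewrite -!RintegralZl//= -RintegralD//; try exact: Z.
by apply: eq_Rintegral => t _; case: (F t).
Qed.

Lemma cexpectB F G : cadm F -> cadm G ->
  cexpect (fun t => F t - G t) = cexpect F - cexpect G.
Proof.
move=> aF aG; rewrite -[in RHS]mulN1r -cexpectZ// -cexpectD//; last exact: cadmZ.
by apply: eq_cexpect => t; rewrite mulN1r.
Qed.

Lemma cexpect_cst z : cexpect (fun=> z) = z.
Proof.
have PT : fine (P setT) = 1 by rewrite probability_setT.
by rewrite /cexpect !Rintegral_cst// PT !mulr1; case: z.
Qed.

Lemma cexpectJ F : cadm F -> cexpect (fun t => (F t)^*) = (cexpect F)^*.
Proof.
move=> /cadm_integrable[Fr Fi]; apply/eqP; rewrite eq_complex /=.
apply/andP; split; apply/eqP.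
  by apply: eq_Rintegral => t _; case: (F t).
rewrite -mulN1r -RintegralZl//.
by apply: eq_Rintegral => t _; rewrite mulN1r; case: (F t).
Qed.

Lemma cexpect_sum (I : Type) (r : seq I) (Q : pred I) (F : I -> T -> R[i]) :
  (forall i, cadm (F i)) ->
  cexpect (fun t => \sum_(i <- r | Q i) F i t) = \sum_(i <- r | Q i) cexpect (F i).
Proof.
move=> aF; elim: r => [|i r IH].
  rewrite big_nil -[RHS](cexpect_cst 0); apply: eq_cexpect => t.
  by rewrite big_nil.
rewrite big_cons; case: ifP => Qi.
  rewrite -IH -cexpectD//; last exact: cadm_sum.
  by apply: eq_cexpect => t; rewrite big_cons Qi.
by rewrite -IH; apply: eq_cexpect => t; rewrite big_cons Qi.
Qed.

(** Bounding real and imaginary parts separately costs the factor [2]. The bound serves only for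
    errors that tend to zero and for finiteness, where this is harmless. *)
Lemma le_norm_cexpect F (C : R[i]) : cadm F -> (forall t, `|F t| <= C) ->
  `|cexpect F| <= 2 * C.
Proof.
move=> aF FC; have [Fr Fi] := cadm_integrable aF.
have C0 : 0 <= C by apply: le_trans (FC point).
have CE : C = (complex.Re C)%:C%C by rewrite RRe_real// ger0_real.
have le1 (f : T -> R) : P.-integrable setT (EFin \o f) ->
    (forall t, `|f t| <= complex.Re C) -> `|Rintegral P setT f| <= complex.Re C.
  move=> fi fC; apply: le_trans (le_normr_Rintegral _ fi) _ => //.
  have -> : complex.Re C = Rintegral P setT (fun=> complex.Re C).
    have PT : fine (P setT) = 1 by rewrite probability_setT.
    by rewrite Rintegral_cst// PT mulr1.
  apply: le_Rintegral => //.
  - apply: (@bounded_Rintegrable _ (complex.Re C)); last by move=> t; rewrite normr_id.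
    apply: measurableT_comp => //; apply/measurable_EFinP.
    by case/integrableP: fi.
  - apply: (@bounded_Rintegrable _ `|complex.Re C|) => // t; exact: lexx.
have nr := le1 _ Fr (fun t => norm_Re_le (FC t)).
have ni := le1 _ Fi (fun t => norm_Im_le (FC t)).
rewrite [cexpect F]complexE mulr2n mulrDl !mul1r.
apply: le_trans (ler_normD _ _) _; rewrite normrM.
rewrite (_ : `|'i%C| = 1 :> R[i]) ?mul1r; last first.
  by rewrite normc_def /= expr0n expr1n add0r sqrtr1.
have nR (x : R) : `|x%:C%C| = `|x|%:C%C by rewrite normc_def /= expr0n addr0 sqrtr_sqr.
by rewrite !nR CE lerD// lecR.
Qed.

End ComplexExpectation.

(** * Loop equations for Haar unitary matrices *)

Section UnitaryMatrices.
Context {R : realType} {N : nat}.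
Implicit Types (Q V X : 'M[R[i]]_N).

Definition adjmx V : 'M[R[i]]_N := (map_mx (@conjc R) V)^T.

Lemma adjmxE V i j : adjmx V i j = (V j i)^*.
Proof. by rewrite !mxE. Qed.

Lemma unitary_mxP V : unitary_mx V <-> V *m adjmx V = 1%:M.
Proof. by []. Qed.

Lemma unitary_mxC V : unitary_mx V -> adjmx V *m V = 1%:M.
Proof. by move=> /unitary_mxP; exact: mulmx1C. Qed.

Lemma adjmxM V X : adjmx (V *m X) = adjmx X *m adjmx V.
Proof. by rewrite /adjmx map_mxM trmx_mul. Qed.

Lemma adjmx1 : adjmx 1%:M = 1%:M.
Proof. by rewrite /adjmx map_mx1 trmx1. Qed.

Lemma adjmxX V k : adjmx (V ^+ k) = adjmx V ^+ k.
Proof.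
elim: k => [|k IH]; first exact: adjmx1.
by rewrite exprS exprSr adjmxM IH.
Qed.

Lemma mxtrace_adj V : \tr (adjmx V) = (\tr V)^*.
Proof. by rewrite /mxtrace rmorph_sum; apply: eq_bigr => i _; rewrite adjmxE. Qed.

Lemma unitary_mx_mul Q V : unitary_mx Q -> unitary_mx V -> unitary_mx (Q *m V).
Proof.
move=> /unitary_mxP Qu /unitary_mxP Vu; apply/unitary_mxP.
by rewrite adjmxM mulmxA -(mulmxA Q) Vu mulmx1.
Qed.

Lemma unitary_mxX V k : unitary_mx V -> unitary_mx (V ^+ k).
Proof.
move=> Vu; elim: k => [|k IH]; last by rewrite exprS; exact: unitary_mx_mul.
by apply/unitary_mxP; rewrite adjmx1 mulmx1.
Qed.

Lemma unitary_mx_norm V i j : unitary_mx V -> `|V i j| <= 1.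
Proof.
move=> /unitary_mxP /matrixP /(_ i i); rewrite !mxE eqxx (bigD1 j)//=.
rewrite adjmxE -normCK mulr1n => E.
rewrite -(@ler_pXn2r _ 2) ?nnegrE// expr1n -E lerDl sumr_ge0// => k _.
by rewrite adjmxE -normCK exprn_ge0.
Qed.

Lemma unitary_mx_trace_norm V k : unitary_mx V -> `|\tr (V ^+ k)| <= N%:R.
Proof.
move=> /(@unitary_mxX _ k) Vu; apply: le_trans (ler_norm_sum _ _ _) _.
rewrite -[N in N%:R]card_ord -sumr_const ler_sum// => i _.
exact: unitary_mx_norm.
Qed.

Lemma unitary_trace_subr V j k : unitary_mx V ->
  \tr (V ^+ k *m adjmx V ^+ j) =
  if (j <= k)%N then \tr (V ^+ (k - j)) else (\tr (V ^+ (j - k)))^*.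
Proof.
move=> Vu; have K m : V ^+ m *m adjmx V ^+ m = 1%:M.
  by rewrite -adjmxX; apply/unitary_mxP; exact: unitary_mxX.
case: leqP => [jk|/ltnW kj].
  by rewrite -{1}(subnK jk) exprD -mulmxA K mulmx1.
rewrite -{1}(subnKC kj) exprD mulmxA K mul1mx.
by rewrite -mxtrace_adj adjmxX.
Qed.

End UnitaryMatrices.

Section HaarInvariance.
Context {R : realType} {N : nat} {d : measure_display} {T : measurableType d}.
Variables (P : probability T R) (U : T -> 'M[R[i]]_N).
Hypothesis haarU : haar_unitary P U.

Let Uu t : unitary_mx (U t). Proof. by case: haarU. Qed.

(** [haar_unitary] states invariance for nonnegative functionals, so [f] is split into its positive
    and negative parts. The bound is asked on unitary matrices only, since polynomials in the
    entries are bounded nowhere else. *)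
Lemma haar_invariant_real (Q : 'M[R[i]]_N) (f : 'M[R[i]]_N -> R) (B : R) :
  unitary_mx Q -> measurable_fun setT (f \o U) ->
  measurable_fun setT (fun t => f (Q *m U t)) ->
  (forall V, unitary_mx V -> `|f V| <= B) ->
  Rintegral P setT (fun t => f (Q *m U t)) = Rintegral P setT (fun t => f (U t)).
Proof.
move=> Qu mf mfQ fB; have [_ _ inv] := haarU.
have split (V : T -> 'M[R[i]]_N) : (forall t, unitary_mx (V t)) ->
    measurable_fun setT (fun t => f (V t)) ->
    Rintegral P setT (fun t => f (V t)) =
    Rintegral P setT (fun t => Num.max (f (V t)) 0) -
    Rintegral P setT (fun t => Num.max (- f (V t)) 0).
  move=> Vu mV; rewrite -RintegralB//.
  - apply: eq_Rintegral => t _ /=; case: (leP (f (V t)) 0) => f0.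
      by rewrite max_l ?oppr_ge0// sub0r opprK.
    by rewrite max_r ?oppr_le0 ?subr0// ltW.
  - apply: (@bounded_Rintegrable _ _ _ _ _ B).
      by apply: measurable_maxr => //; exact: measurable_cst.
    by move=> t; apply: le_trans (fB _ (Vu t)); case: (leP (f (V t)) 0) => // _; rewrite normr0.
  - apply: (@bounded_Rintegrable _ _ _ _ _ B).
      by apply: measurable_maxr; [exact: measurable_funN | exact: measurable_cst].
    by move=> t; apply: le_trans (fB _ (Vu t)); case: (leP (- f (V t)) 0) => _; rewrite ?normrN// normr0.
rewrite (split U)// (split (fun t => Q *m U t))//; last first.
  by move=> t; exact: unitary_mx_mul.
congr (_ - _); rewrite /Rintegral; congr fine.
  apply: (inv Q Qu (fun V => Num.max (f V) 0)).
  - by move=> V; rewrite le_max lexx orbT.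
  - by apply: measurable_maxr => //; exact: measurable_cst.
  - by apply: measurable_maxr => //; exact: measurable_cst.
apply: (inv Q Qu (fun V => Num.max (- f V) 0)).
- by move=> V; rewrite le_max lexx orbT.
- by apply: measurable_maxr; [exact: measurable_funN | exact: measurable_cst].
- by apply: measurable_maxr; [exact: measurable_funN | exact: measurable_cst].
Qed.

Lemma haar_invariant (Q : 'M[R[i]]_N) (F : 'M[R[i]]_N -> R[i]) (C : R[i]) :
  unitary_mx Q -> cmeasurable (F \o U) -> cmeasurable (fun t => F (Q *m U t)) ->
  (forall V, unitary_mx V -> `|F V| <= C) ->
  cexpect P (fun t => F (Q *m U t)) = cexpect P (fun t => F (U t)).
Proof.
move=> Qu [mr mi] [mrQ miQ] FC; rewrite /cexpect; congr (_ +i* _)%C.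
  apply: (@haar_invariant_real Q (fun V => complex.Re (F V)) (complex.Re C)) => // V Vu.
  by apply: norm_Re_le; exact: FC.
apply: (@haar_invariant_real Q (fun V => complex.Im (F V)) (complex.Re C)) => // V Vu.
by apply: norm_Im_le; exact: FC.
Qed.

End HaarInvariance.

(** * Rational paths of unitary matrices through the identity *)

Section CayleyPath.
Context {R : realType} {N : nat}.
Implicit Types (V X Y : 'M[R[i]]_N) (t : R).

(** For an orthogonal projection [Q], unitarity of [1 + z Q] reduces to the scalar condition
    [|1 + z| = 1], so no matrix exponential is needed, and such [Q] still span all matrices over the
    complex numbers. *)
Definition projmx (Q : 'M[R[i]]_N) : Prop := adjmx Q = Q /\ Q *m Q = Q.

(* [1 + cayley t = (1 + i t) / (1 - i t)] runs through the unit circle, with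
   speed [2 i] at [t = 0]. *)
Definition cayley (t : R) : R[i] := 2 * 'i * t%:C%C / (1 - 'i * t%:C%C).

Definition cayley_mx Q t : 'M[R[i]]_N := 1%:M + cayley t *: Q.

Let conj_real (x : R) : (x%:C%C)^* = x%:C%C :> R[i]. Proof. exact: conjc_real. Qed.

Let den_ge1 t : 1 <= `|1 - 'i * t%:C%C| :> R[i].
Proof.
apply: le_trans (normc_ge_Re _).
rewrite -complexiE (_ : complex.Re _ = 1) ?normr1//.
by rewrite /= mul0r mul1r subr0 oppr0 addr0.
Qed.

Let den_neq0 t : 1 - 'i * t%:C%C != 0 :> R[i].
Proof. by rewrite -normr_gt0; apply: lt_le_trans (den_ge1 t). Qed.

(** The identity [|1 + cayley t| ^ 2 = 1], expanded. *)
Lemma cayley_unit t : cayley t + (cayley t)^* + cayley t * (cayley t)^* = 0.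
Proof.
have den2 : 1 + 'i * t%:C%C != 0 :> R[i].
  by have := den_neq0 (- t); rewrite rmorphN mulrN opprK.
have E : (cayley t)^* = - (2 * 'i * t%:C%C) / (1 + 'i * t%:C%C).
  rewrite /cayley fmorph_div !rmorphM rmorphB rmorph1 rmorphM rmorph_nat /=.
  by rewrite conj_real conjCi !(mulrN, mulNr) opprK.
rewrite E /cayley; have i2 : 'i * 'i = -1 :> R[i] by rewrite -expr2 sqrCi.
field: i2; by rewrite den2 den_neq0.
Qed.

Lemma cayley_approx t : 0 <= t ->
  `|cayley t - 2 * 'i * t%:C%C| <= 2 * t%:C%C ^+ 2.
Proof.
move=> t0; have i2 : 'i * 'i = -1 :> R[i] by rewrite -expr2 sqrCi.
have -> : cayley t - 2 * 'i * t%:C%C = - (2 * t%:C%C ^+ 2) / (1 - 'i * t%:C%C).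
  by rewrite /cayley; field: i2; exact: den_neq0.
rewrite normrM normrN normfV ger0_norm; last first.
  by rewrite mulr_ge0// exprn_ge0// ler0c.
rewrite ler_piMr// ?invf_le1 ?(lt_le_trans _ (den_ge1 t))//.
by rewrite mulr_ge0// exprn_ge0// ler0c.
Qed.

Lemma cayley_mx_unitary Q t : projmx Q -> unitary_mx (cayley_mx Q t).
Proof.
move=> [Qa QQ]; apply/unitary_mxP.
have -> : adjmx (cayley_mx Q t) = 1%:M + (cayley t)^* *: Q.
  apply/matrixP => i j; rewrite adjmxE !mxE rmorphD rmorphM rmorph_nat eq_sym.
  by rewrite -{2}Qa adjmxE.
rewrite mulmxDl mul1mx mulmxDr mulmx1 -scalemxAl -scalemxAr QQ.
rewrite -!addrA -[RHS]addr0; congr (_ + _).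
rewrite scalerA -!scalerDl addrCA addrA.
by rewrite [X in X *: _](_ : _ = 0) ?scale0r// -(cayley_unit t); ring.
Qed.

Lemma projmx_delta i : projmx (delta_mx i i).
Proof.
split; last by rewrite mul_delta_mx.
by apply/matrixP => a b; rewrite adjmxE !mxE rmorph_nat andbC.
Qed.

(** This is the orthogonal projection onto the line of [e_a + z e_b], a vector of squared norm
    [2]. *)
Lemma projmx_pair (a b : 'I_N) (z : R[i]) : a != b -> z * z^* = 1 ->
  projmx (2^-1 *: (delta_mx a a + delta_mx b b + z^* *: delta_mx a b + z *: delta_mx b a)).
Proof.
move=> ab zz; split.
  apply/matrixP => i j; rewrite adjmxE !mxE !(rmorphM, rmorphD, fmorphV, rmorph_nat) /=.
  rewrite conjCK !conjC1 ![(j == _) && _]andbC; congr (_ * _); exact: addrAC.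
set S := (_ + _ + _ + _ *: _).
have SS : S *m S = 2 *: S.
  have ba : b != a by rewrite eq_sym.
  rewrite /S !(mulmxDl, mulmxDr) -!scalemxAl -!scalemxAr.
  rewrite !mul_delta_mx !(mul_delta_mx_0 _ _ _ ab) !(mul_delta_mx_0 _ _ _ ba).
  rewrite !(scaler0, addr0, add0r) !scalerA.
  rewrite zz mulrC zz.
  by apply/matrixP => i j; rewrite !mxE; ring.
rewrite -scalemxAl -scalemxAr SS !scalerA; congr (_ *: _).
by rewrite -mulrA mulVf ?mulr1.
Qed.

End CayleyPath.

(** * Derivatives with a uniform second-order remainder *)

Section Derivations.
Context {R : realType} {N : nat} {d : measure_display} {T : measurableType d}.
Local Notation M := ('M[R[i]]_N).
Implicit Types (F G : M -> R[i]) (DF DG : M -> M -> R[i]) (A B : M -> M)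
  (DA DB : M -> M -> M).

Definition mx_measurable (V : T -> M) := forall i j, cmeasurable (fun t => V t i j).

(* [DF X V] is the derivative of [F] at the unitary matrix [V] along
   [X *m V], for [X] anti-hermitian, extended complex-linearly to all [X]. *)
Record derivation F DF : Prop := {
  dv_meas : forall V, mx_measurable V -> cmeasurable (F \o V);
  dvD_meas : forall X V, mx_measurable V -> cmeasurable (DF X \o V);
  dv_bnd : exists C : R[i], forall V, unitary_mx V -> `|F V| <= C;
  dvD_bnd : forall X, exists C : R[i], forall V, unitary_mx V -> `|DF X V| <= C;
  dv_lin : forall V c X Y, DF (c *: X + Y) V = c * DF X V + DF Y V;
  dv_exp : forall Q, projmx Q -> exists C : R[i], forall V t, unitary_mx V -> 0 < t <= 1 ->
    `|F (cayley_mx Q t *m V) - F V - t%:C%C * DF ((2 * 'i) *: Q) V| <= C * t%:C%C ^+ 2 }.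

Definition mx_derivation A DA : Prop :=
  forall i j, derivation (fun V => A V i j) (fun X V => DA X V i j).

Let mxDZE (A B : M) c i j : (A + c *: B) i j = A i j + c * B i j.
Proof. by rewrite !mxE. Qed.

Let mxNE (A : M) i j : (- A) i j = - A i j. Proof. by rewrite mxE. Qed.

Let mxZE (A : M) c i j : (c *: A) i j = c * A i j.
Proof. by rewrite !mxE. Qed.

Let addKx (x y : R[i]) : x + y - x = y. Proof. by rewrite addrC addKr. Qed.

Let tC (t : R) : 0 < t <= 1 -> 0 < t%:C%C <= (1 : R[i]).
Proof. by move=> /andP[t0 t1]; rewrite -[1]/(1%:C)%C -[0]/(0%:C)%C lecR ltcR t0. Qed.

Lemma derivation_cst c : derivation (fun=> c) (fun _ _ => 0).
Proof.
split.
- by move=> V _; exact: cmeasurable_cst.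
- by move=> X V _; exact: cmeasurable_cst.
- by exists `|c|.
- by move=> _; exists 0 => V _; rewrite normr0.
- by move=> *; rewrite mulr0 addr0.
- by move=> Q _; exists 0 => V t _ _; rewrite subrr mulr0 subr0 normr0 mul0r.
Qed.

Lemma derivationD F DF G DG : derivation F DF -> derivation G DG ->
  derivation (fun V => F V + G V) (fun X V => DF X V + DG X V).
Proof.
case=> mF mDF [a Fa] DFa lF eF [mG mDG [b Gb] DGb lG eG]; split.
- by move=> V mV; apply: cmeasurableD; [exact: mF | exact: mG].
- by move=> X V mV; apply: cmeasurableD; [exact: mDF | exact: mDG].
- by exists (a + b) => V Vu; rewrite (le_trans (ler_normD _ _))// lerD ?Fa ?Gb.
- move=> X; have [a' Fa'] := DFa X; have [b' Gb'] := DGb X.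
  by exists (a' + b') => V Vu; rewrite (le_trans (ler_normD _ _))// lerD ?Fa' ?Gb'.
- by move=> *; rewrite lF lG; ring.
- move=> Q pQ; have [a' Fa'] := eF Q pQ; have [b' Gb'] := eG Q pQ.
  exists (a' + b') => V t Vu t01.
  have H := lerD (Fa' _ _ Vu t01) (Gb' _ _ Vu t01).
  rewrite [leRHS]mulrDl; apply: le_trans H.
  apply: le_trans (ler_normD _ _).
  by rewrite le_eqVlt; apply/orP; left; apply/eqP; congr `|_|; ring.
Qed.

Lemma derivationM F DF G DG : derivation F DF -> derivation G DG ->
  derivation (fun V => F V * G V) (fun X V => DF X V * G V + F V * DG X V).
Proof.
case=> mF mDF [a Fa] DFa lF eF [mG mDG [b Gb] DGb lG eG]; split.
- by move=> V mV; apply: cmeasurableM; [exact: mF | exact: mG].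
- move=> X V mV; apply: cmeasurableD.
    by apply: cmeasurableM; [exact: mDF | exact: mG].
  by apply: cmeasurableM; [exact: mF | exact: mDG].
- by exists (a * b) => V Vu; rewrite normrM ler_pM ?Fa ?Gb.
- move=> X; have [a' Fa'] := DFa X; have [b' Gb'] := DGb X.
  exists (a' * b + a * b') => V Vu; rewrite (le_trans (ler_normD _ _))// !normrM.
  by rewrite lerD// ler_pM ?Fa ?Fa' ?Gb ?Gb'.
- by move=> *; rewrite lF lG; ring.
- move=> Q pQ; have [a' Fa'] := eF Q pQ; have [b' Gb'] := eG Q pQ.
  have [a1 Fa1] := DFa ((2 * 'i) *: Q).
  have [b1 Gb1] := DGb ((2 * 'i) *: Q).
  exists (a' * b + a * b' + a1 * (b' + b1)) => V t Vu t01.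
  have /andP[t0 t1] := tC t01; have QVu := unitary_mx_mul (cayley_mx_unitary t pQ) Vu.
  have := Fa' V t Vu t01; have := Gb' V t Vu t01.
  have := Fa1 V Vu; have := Gb1 V Vu; have := Fa V Vu; have := Gb _ QVu.
  move: (F _) (F _) (G _) (G _) (DF _ _) (DG _ _) t%:C%C t0 t1.
  move=> FQ FV GV GQ F' G' u u0 u1 hGQ hF hG' hF' eG1 eF1.
  have u2 : 0 < u ^+ 2 by rewrite exprn_gt0.
  have b'0 : 0 <= b' by rewrite -(pmulr_lge0 _ u2); apply: le_trans eG1.
  have dG : `|GQ - GV| <= (b' + b1) * u.
    rewrite -[GQ - GV](subrK (u * G')); apply: le_trans (ler_normD _ _) _.
    rewrite mulrDl lerD//.
      by apply: le_trans eG1 _; rewrite expr2 mulrA ler_piMr// mulr_ge0// ltW.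
    by rewrite normrM (ger0_norm (ltW u0)) mulrC ler_wpM2r// ltW.
  have -> : FQ * GQ - FV * GV - u * (F' * GV + FV * G') =
    (FQ - FV - u * F') * GQ + FV * (GQ - GV - u * G') + u * F' * (GQ - GV) by ring.
  rewrite [leRHS]mulrDl; apply: le_trans (ler_normD _ _) _; apply: lerD.
    rewrite [leRHS]mulrDl; apply: le_trans (ler_normD _ _) _; rewrite !normrM; apply: lerD.
      by rewrite mulrAC ler_pM.
    by rewrite -mulrA ler_pM.
  rewrite !normrM (ger0_norm (ltW u0)) expr2.
  have -> : a1 * (b' + b1) * (u * u) = u * a1 * ((b' + b1) * u) by ring.
  by rewrite ler_pM ?mulr_ge0 ?(ltW u0)// ler_wpM2l// ltW.
Qed.

Lemma derivation_sum (I : Type) (r : seq I) (F : I -> M -> R[i])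
    (DF : I -> M -> M -> R[i]) :
  (forall i, derivation (F i) (DF i)) ->
  derivation (fun V => \sum_(i <- r) F i V) (fun X V => \sum_(i <- r) DF i X V).
Proof.
move=> dF; elim: r => [|i r IH].
  have := derivation_cst 0; congr derivation; apply/funext => X.
    by rewrite big_nil.
  by apply/funext => V; rewrite big_nil.
have := derivationD (dF i) IH; congr derivation; apply/funext => X.
  by rewrite big_cons.
by apply/funext => V; rewrite big_cons.
Qed.

(** [rem j s] deletes one occurrence only, so that summing over the entries of [s] counts repeated
    factors with their multiplicity. *)
Lemma derivation_prod (f : nat -> M -> R[i]) (Df : nat -> M -> M -> R[i]) (s : seq nat) :
  (forall j, derivation (f j) (Df j)) ->
  derivation (fun V => \prod_(j <- s) f j V)
    (fun X V => \sum_(j <- s) Df j X V * \prod_(i <- rem j s) f i V).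
Proof.
move=> dF; elim: s => [|k s IH].
  have := derivation_cst 1; congr derivation; apply/funext => X.
    by rewrite big_nil.
  by apply/funext => V; rewrite big_nil.
have := derivationM (dF k) IH; congr derivation; apply/funext => X.
  by rewrite big_cons.
apply/funext => V.
rewrite big_cons /= eqxx; congr (_ + _); rewrite mulr_sumr.
rewrite big_seq [RHS]big_seq; apply: eq_bigr => j js; rewrite mulrCA; congr (_ * _).
case: eqVneq => [->|_]; last by rewrite big_cons.
by rewrite [RHS](big_rem j).
Qed.

Lemma mx_derivation_id : mx_derivation id (fun X V => X *m V).
Proof.
have bX (X : M) (i : 'I_N) V j : unitary_mx V ->
    `|(X *m V) i j| <= \sum_k `|X i k|.
  move=> Vu; rewrite mxE; apply: le_trans (ler_norm_sum _ _ _) _.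
  by apply: ler_sum => k _; rewrite normrM ler_piMr// unitary_mx_norm.
move=> i j; split.
- by move=> V mV; exact: mV.
- move=> X V mV; rewrite /comp; under eq_fun do rewrite mxE.
  apply: cmeasurable_sum => k; apply: cmeasurableM; last exact: mV.
  exact: cmeasurable_cst.
- by exists 1 => V; exact: unitary_mx_norm.
- by move=> X; exists (\sum_k `|X i k|) => V Vu; exact: bX.
- by move=> V c X Y; rewrite mulmxDl -scalemxAl !mxE.
- move=> Q _; exists (2 * \sum_k `|Q i k|) => V t Vu /andP[t0 _].
  rewrite /cayley_mx mulmxDl mul1mx -!scalemxAl mxDZE mxZE addKx mulrA.
  rewrite (mulrC t%:C%C) -mulrBl normrM [leRHS]mulrAC ler_pM//; last exact: bX.
  exact: cayley_approx (ltW t0).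
Qed.

(** For anti-hermitian [X], [(X V)^* = V^* X^* = - V^* X]. The last form is linear in [X] over the
    complex numbers, whereas [X^*] is not. *)
Lemma mx_derivation_adj : mx_derivation adjmx (fun X V => - (adjmx V *m X)).
Proof.
have bX (X : M) (i : 'I_N) V j : unitary_mx V ->
    `|(adjmx V *m X) i j| <= \sum_k `|X k j|.
  move=> Vu; rewrite mxE; apply: le_trans (ler_norm_sum _ _ _) _.
  by apply: ler_sum => k _; rewrite normrM ler_piMl// adjmxE norm_conjC unitary_mx_norm.
move=> i j; split.
- by move=> V mV; rewrite /comp; under eq_fun do rewrite adjmxE; exact/cmeasurableJ/mV.
- move=> X V mV; rewrite /comp; under eq_fun do rewrite mxE mxE -mulN1r.
  apply: cmeasurableM; first exact: cmeasurable_cst.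
  apply: cmeasurable_sum => k; apply: cmeasurableM; last exact: cmeasurable_cst.
  by under eq_fun do rewrite adjmxE; exact/cmeasurableJ/mV.
- by exists 1 => V Vu; rewrite adjmxE norm_conjC unitary_mx_norm.
- by move=> X; exists (\sum_k `|X k j|) => V Vu; rewrite mxE normrN; exact: bX.
- by move=> V c X Y; rewrite mulmxDr -scalemxAr !mxE; ring.
- move=> Q [Qa QQ]; exists (2 * \sum_k `|Q k j|) => V t Vu /andP[t0 _].
  have -> : adjmx (cayley_mx Q t *m V) = adjmx V + (cayley t)^* *: (adjmx V *m Q).
    rewrite adjmxM /cayley_mx; have -> : adjmx (1%:M + cayley t *: Q) = 1%:M + (cayley t)^* *: Q.
      apply/matrixP => a b; rewrite adjmxE !mxE rmorphD rmorphM rmorph_nat eq_sym.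
      by rewrite -{2}Qa adjmxE.
    by rewrite mulmxDr mulmx1 -scalemxAr.
  rewrite -scalemxAr mxDZE mxNE mxZE addKx.
  set z := (adjmx V *m Q) i j.
  have -> : (cayley t)^* * z - t%:C%C * - (2 * 'i * z) =
     (cayley t - 2 * 'i * t%:C%C)^* * z.
    have tr : (t%:C%C)^* = t%:C%C :> R[i] by exact: conjc_real.
    by rewrite rmorphB !rmorphM rmorph_nat /= conjCi tr; ring.
  rewrite normrM norm_conjC [leRHS]mulrAC ler_pM//; last exact: bX.
  exact: cayley_approx (ltW t0).
Qed.

Lemma mx_derivationM A DA B DB : mx_derivation A DA -> mx_derivation B DB ->
  mx_derivation (fun V => A V *m B V) (fun X V => DA X V *m B V + A V *m DB X V).
Proof.
move=> dA dB i j.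
have := derivation_sum (index_enum 'I_N) (fun k => derivationM (dA i k) (dB k j)).
congr derivation; apply/funext => X; first by rewrite mxE.
by apply/funext => V; rewrite !mxE -big_split.
Qed.

Lemma mx_derivation_cst B : mx_derivation (fun=> B 0) (fun _ _ => 0).
Proof.
move=> i j; have := derivation_cst (B 0 i j); congr derivation.
by apply/funext => X; apply/funext => V; rewrite mxE.
Qed.

(** Each factor [V] in turn becomes [X *m V], so the exponent to the right of [X] is [k - l], never
    [0]. *)
Lemma mx_derivationX k : mx_derivation (fun V => V ^+ k)
  (fun X V => \sum_(l < k) V ^+ l *m X *m V ^+ (k - l)).
Proof.
elim: k => [|k IH].
  have := mx_derivation_cst (fun=> 1%:M); congr mx_derivation.
  by apply/funext => X; apply/funext => V; rewrite big_ord0.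
have := mx_derivationM mx_derivation_id IH; congr mx_derivation.
  by apply/funext => V; rewrite exprS.
apply/funext => X; apply/funext => V; rewrite big_ord_recl /= subn0; congr (_ + _).
  by rewrite expr0 mul1mx -mulmxA exprS.
rewrite mulmx_sumr; apply: eq_bigr => l _; rewrite !mulmxA exprS subSS.
by [].
Qed.

Lemma mx_derivation_adjX k : mx_derivation (fun V => adjmx V ^+ k)
  (fun X V => - \sum_(l < k) adjmx V ^+ (k - l) *m X *m adjmx V ^+ l).
Proof.
elim: k => [|k IH].
  have := mx_derivation_cst (fun=> 1%:M); congr mx_derivation.
  by apply/funext => X; apply/funext => V; rewrite big_ord0 oppr0.
have := mx_derivationM IH mx_derivation_adj; congr mx_derivation.
  by apply/funext => V; rewrite exprSr.
apply/funext => X; apply/funext => V; rewrite big_ord_recl /= subn0 opprD addrC; congr (_ + _).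
  by rewrite expr0 mulmx1 mulmxN mulmxA exprSr.
rewrite mulNmx mulmx_suml; congr (- _); apply: eq_bigr => l _.
have E : adjmx V ^+ l *m adjmx V = adjmx V ^+ l.+1 by rewrite exprSr.
by rewrite -[LHS]mulmxA E subSS.
Qed.

Let mxXD (A : M) a b : A ^+ a *m A ^+ b = A ^+ (a + b).
Proof. by rewrite exprD. Qed.

Lemma derivation_trace k : derivation (fun V => \tr (V ^+ k))
  (fun X V => k%:R * \tr (X *m V ^+ k)).
Proof.
have := derivation_sum (index_enum 'I_N) (fun i => mx_derivationX k i i).
congr derivation; apply/funext => X; apply/funext => V.
rewrite -/(mxtrace _) raddf_sum /=.
rewrite -[k in k%:R]card_ord mulr_natl -sumr_const; apply: eq_bigr => l _.
by rewrite -mulmxA mxtrace_mulC -mulmxA mxXD subnK// ltnW.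
Qed.

Lemma derivation_trace_adj k : derivation (fun V => (\tr (V ^+ k))^*)
  (fun X V => - (k%:R * \tr (X *m adjmx V ^+ k))).
Proof.
have := derivation_sum (index_enum 'I_N) (fun i => mx_derivation_adjX k i i).
congr derivation.
  by apply/funext => V; rewrite -mxtrace_adj adjmxX.
apply/funext => X; apply/funext => V.
transitivity (\tr (- (\sum_(l < k) adjmx V ^+ (k - l) *m X *m adjmx V ^+ l))) => //.
rewrite (linearN (@mxtrace _ N)) (linear_sum (@mxtrace _ N)) /=; congr (- _).
rewrite -[k in k%:R]card_ord mulr_natl -sumr_const; apply: eq_bigr => l _.
by rewrite -mulmxA mxtrace_mulC -mulmxA mxXD subnKC// ltnW.
Qed.

End Derivations.

(** * Schwinger-Dyson equations for trace monomials *)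

Section LoopEquation.
Context {R : realType} {N : nat} {d : measure_display} {T : measurableType d}.
Variables (P : probability T R) (U : T -> 'M[R[i]]_N).
Hypothesis haarU : haar_unitary P U.
Local Notation M := ('M[R[i]]_N).
Implicit Types (F : M -> R[i]) (DF : M -> M -> R[i]) (mu nu : seq nat).

Let Uu t : unitary_mx (U t). Proof. by case: haarU. Qed.

Let mU : mx_measurable U.
Proof. by move=> i j; case: haarU => _ mU _; split; case: (mU i j). Qed.

Lemma mx_measurableM (Q : M) : mx_measurable (fun t => Q *m U t).
Proof.
move=> i j; under eq_fun do rewrite mxE.
apply: cmeasurable_sum => k; apply: cmeasurableM => //; exact: cmeasurable_cst.
Qed.

Lemma derivation_cadm F DF : @derivation R N d T F DF -> cadm (F \o U).
Proof.
case=> mF _ [C FC] _ _ _; split; first exact: mF.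
by exists C => t; exact: FC.
Qed.

Lemma derivation_cadmD F DF X : @derivation R N d T F DF -> cadm (DF X \o U).
Proof.
case=> _ mDF _ FC _ _; split; first exact: mDF.
by have [C HC] := FC X; exists C => t; exact: HC.
Qed.

(** Invariance makes the expectation of [F] constant along the Cayley path. The uniform remainder
    [C * t ^ 2] then leaves the norm of the expected derivative at most [2 * C * t] for all [t] in
    []0, 1]], so no differentiation under the integral is required. *)
Lemma expect_derivation_proj F DF Q : @derivation R N d T F DF -> projmx Q ->
  cexpect P (fun t => DF ((2 * 'i) *: Q) (U t)) = 0.
Proof.
move=> dF pQ; have aF := derivation_cadm dF.
have aD : cadm (fun t => DF ((2 * 'i) *: Q) (U t)) := derivation_cadmD _ dF.
have [C HC] := dv_exp dF pQ; have [B FB] := dv_bnd dF.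
have C0 : 0 <= C.
  have := HC (U point) 1 (Uu point); rewrite ltr01 lexx expr1n mulr1 => /(_ isT).
  exact: le_trans.
have aFQ t : cadm (fun u => F (cayley_mx Q t *m U u)).
  split; first by apply: (dv_meas dF); exact: mx_measurableM.
  by exists B => u; apply: FB; exact: (unitary_mx_mul (cayley_mx_unitary t pQ)).
have small (t : R) : 0 < t <= 1 ->
    `|cexpect P (fun u => DF ((2 * 'i) *: Q) (U u))| <= 2 * C * t%:C%C.
  move=> t01; have t0 : 0 < t%:C%C :> R[i] by rewrite -[0]/(0%:C)%C ltcR; case/andP: t01.
  rewrite -(ler_pM2l t0) -{1}(ger0_norm (ltW t0)) -normrM -cexpectZ//.
  rewrite -normrN -sub0r -(subrr (cexpect P (fun u => F (U u)))).
  rewrite -{1}(@haar_invariant _ _ _ _ _ _ haarU (cayley_mx Q t) _ B)//; first last.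
  - by case: (aFQ t).
  - by case: aF.
  - exact: cayley_mx_unitary.
  rewrite -cexpectB// -cexpectB//; [|exact: cadmB|exact: cadmZ].
  have -> : t%:C%C * (2 * C * t%:C%C) = 2 * (C * t%:C%C ^+ 2) by ring.
  apply: le_norm_cexpect; first by apply: cadmB; [exact: cadmB|exact: cadmZ].
  by move=> u; exact: HC.
apply/eqP; rewrite -normr_le0; move: small.
set z := `|_| => small.
have zE : z = (complex.Re z)%:C%C by rewrite RRe_real// normr_real.
have CE : C = (complex.Re C)%:C%C by rewrite RRe_real// ger0_real.
have {}small (t : R) : 0 < t <= 1 -> complex.Re z <= 2 * complex.Re C * t.
  move=> /small; rewrite zE CE -(rmorph_nat (real_complex R)) -!rmorphM lecR /=.
  by [].
rewrite zE -[0]/(0%:C)%C lecR leNgt; apply/negP => z0.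
have C0' : 0 <= complex.Re C by move: C0; rewrite {1}CE -[0]/(0%:C)%C lecR.
have z1 := small 1; rewrite ltr01 lexx mulr1 in z1; have {}z1 := z1 isT.
have Cp : 0 < complex.Re C by lra.
(* At this [t] the upper bound is half of [z]; [t <= 1] follows from the bound at time [1]. *)
pose t := complex.Re z / (4 * complex.Re C).
have t01 : 0 < t <= 1.
  apply/andP; split; first by rewrite divr_gt0 ?mulr_gt0.
  by rewrite ler_pdivrMr ?mulr_gt0// mul1r; lra.
have := small t t01.
have -> : 2 * complex.Re C * t = complex.Re z / 2 by rewrite /t; field; rewrite gt_eqF.
lra.
Qed.

(** [DF] is complex-linear in the direction, so vanishing on projections suffices. For [a != b],
    [z = 1] and [z = 'i] in [projmx_pair] give the sum and the difference of the values at
    [delta_mx a b] and [delta_mx b a]. *)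
Lemma expect_derivation F DF (a b : 'I_N) : @derivation R N d T F DF ->
  cexpect P (fun t => DF (delta_mx a b) (U t)) = 0.
Proof.
move=> dF; pose Z X := cexpect P (fun t => DF X (U t)).
have aD X : cadm (fun t => DF X (U t)) := derivation_cadmD X dF.
have Zlin c X Y : Z (c *: X + Y) = c * Z X + Z Y.
  rewrite /Z -cexpectZ// -cexpectD//; last exact: cadmZ.
  by apply: eq_cexpect => t; rewrite (dv_lin dF).
have Z0 : Z 0 = 0.
  have := Zlin (-1) 0 0; rewrite scaler0 addr0 mulN1r addNr//.
have ZZ c X : Z (c *: X) = c * Z X by rewrite -[c *: X]addr0 Zlin Z0 addr0.
have ZD X Y : Z (X + Y) = Z X + Z Y by rewrite -[X in X + Y]scale1r Zlin mul1r.
have i2 : 2 * 'i != 0 :> R[i] by rewrite mulf_neq0// neq0Ci.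
have Zproj Q : projmx Q -> Z Q = 0.
  move=> pQ; have := expect_derivation_proj dF pQ; rewrite -/(Z _) ZZ => /eqP.
  by rewrite mulf_eq0 (negPf i2) => /eqP.
rewrite -/(Z _); have [<-|ab] := eqVneq a b; first exact/Zproj/projmx_delta.
have halfE z : z * z^* = 1 -> z^* * Z (delta_mx a b) + z * Z (delta_mx b a) = 0.
  move=> zz; have /eqP := Zproj _ (projmx_pair ab zz).
  rewrite ZZ !ZD !ZZ (Zproj _ (projmx_delta a)) (Zproj _ (projmx_delta b)) !add0r.
  by rewrite mulf_eq0 invr_eq0 pnatr_eq0 /= => /eqP.
have h1 := halfE 1; have hi := halfE 'i.
rewrite conjC1 !mul1r in h1; rewrite conjCi mulrN -expr2 sqrCi opprK in hi.
have {}h1 := h1 erefl; have {}hi := hi erefl.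
have ii : 'i * 'i = -1 :> R[i] by rewrite -expr2 sqrCi.
have : Z (delta_mx a b) *+ 2 = 0.
  rewrite (_ : _ *+ 2 = (Z (delta_mx a b) + Z (delta_mx b a)) +
    'i * (- 'i * Z (delta_mx a b) + 'i * Z (delta_mx b a))); last by ring: ii.
  by rewrite h1 hi mulr0 addr0.
by move=> /eqP; rewrite mulrn_eq0 /= => /eqP.
Qed.

Definition trpow k (V : M) : R[i] := \tr (V ^+ k).

Definition trmono mu nu (V : M) : R[i] :=
  (\prod_(j <- mu) trpow j V) * \prod_(j <- nu) (trpow j V)^*.

Definition moment mu nu : R[i] := cexpect P (fun t => trmono mu nu (U t)).

Definition trmonoD mu nu (X V : M) : R[i] :=
  (\sum_(j <- mu) j%:R * \tr (X *m V ^+ j) * \prod_(i <- rem j mu) trpow i V) *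
    (\prod_(j <- nu) (trpow j V)^*) +
  (\prod_(j <- mu) trpow j V) *
    (\sum_(j <- nu) - (j%:R * \tr (X *m adjmx V ^+ j)) * \prod_(i <- rem j nu) (trpow i V)^*).

Lemma derivation_trmono mu nu : @derivation R N d T (trmono mu nu) (trmonoD mu nu).
Proof.
apply: derivationM.
  exact: (derivation_prod mu (fun j => derivation_trace j)).
exact: (derivation_prod nu (fun j => derivation_trace_adj j)).
Qed.

Lemma cadm_trmono mu nu : cadm (fun t => trmono mu nu (U t)).
Proof. exact: derivation_cadm (derivation_trmono mu nu). Qed.

Let delta_entry (A B : M) a b : (A *m delta_mx a b *m B) a b = A a a * B b b.
Proof.
rewrite mxE (bigD1 b)//= big1 ?addr0; last first.
  move=> j jb; rewrite mxE big1 ?mul0r// => k _.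
  by rewrite mxE (negPf jb) andbF mulr0.
rewrite mxE (bigD1 a)//= big1 ?addr0; last first.
  by move=> j ja; rewrite mxE (negPf ja) mulr0.
by rewrite mxE !eqxx mulr1.
Qed.

Let sum_delta (A B : M) : \sum_a \sum_b A a b * \tr (delta_mx a b *m B) = \tr (A *m B).
Proof.
rewrite {2}/mxtrace; apply: eq_bigr => a _; rewrite mxE; apply: eq_bigr => b _.
congr (_ * _); rewrite /mxtrace (bigD1 a)//= big1 ?addr0.
  rewrite mxE (bigD1 b)//= big1 ?addr0; first by rewrite mxE !eqxx mul1r.
  by move=> j jb; rewrite mxE (negPf jb) andbF mul0r.
move=> i ia; rewrite mxE big1// => j _; by rewrite mxE (negPf ia) mul0r.
Qed.

(** Sum over all [a], [b] of the vanishing expected derivative of [(V ^ k)_ab * trmono mu nu V]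
    along [delta_mx a b]. Differentiating [V ^ k] splits its trace into [tr V ^ l * tr V ^ (k - l)],
    a factor [tr V ^ j] merges with it into [tr V ^ (k + j)], and a conjugate factor contracts
    [V ^ k] with the adjoint of [V ^ j]. The term [l = 0] carries [tr 1 = N]. *)
Lemma loop_equation k mu nu :
  \sum_(l < k) moment [:: val l, (k - l)%N & mu] nu +
  \sum_(j <- mu) j%:R * moment ((k + j)%N :: rem j mu) nu =
  \sum_(j <- nu) j%:R * (if (j <= k)%N then moment ((k - j)%N :: mu) (rem j nu)
                         else moment mu ((j - k)%N :: rem j nu)).
Proof.
pose DF a b (X V : M) := (\sum_(l < k) V ^+ l *m X *m V ^+ (k - l)) a b * trmono mu nu V +
  (V ^+ k) a b * trmonoD mu nu X V.
have dF a b : @derivation R N d T (fun V => (V ^+ k) a b * trmono mu nu V) (DF a b).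
  exact: derivationM (mx_derivationX k a b) (derivation_trmono mu nu).
have E0 : cexpect P (fun t => \sum_a \sum_b DF a b (delta_mx a b) (U t)) = 0.
  have aD a b : cadm (fun t => DF a b (delta_mx a b) (U t)) := derivation_cadmD _ (dF a b).
  rewrite cexpect_sum; last by move=> a; exact: cadm_sum.
  rewrite big1// => a _; rewrite cexpect_sum// big1// => b _.
  exact: expect_derivation (dF a b).
apply/eqP; rewrite -subr_eq0; apply/eqP; apply: etrans E0; rewrite /moment.
have aM := cadm_trmono.
have -> : \sum_(l < k) cexpect P (fun t => trmono [:: val l, (k - l)%N & mu] nu (U t)) =
  cexpect P (fun t => \sum_(l < k) trmono [:: val l, (k - l)%N & mu] nu (U t)).
  by rewrite cexpect_sum.
have -> : \sum_(j <- mu) j%:R * cexpect P (fun t => trmono ((k + j)%N :: rem j mu) nu (U t)) =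
  cexpect P (fun t => \sum_(j <- mu) j%:R * trmono ((k + j)%N :: rem j mu) nu (U t)).
  rewrite cexpect_sum; last by move=> j; exact: cadmZ.
  by apply: eq_bigr => j _; rewrite (cexpectZ _ _ (aM _ _)).
pose H j V := if (j <= k)%N then trmono ((k - j)%N :: mu) (rem j nu) V
              else trmono mu ((j - k)%N :: rem j nu) V.
have aH j : cadm (fun t => H j (U t)) by rewrite /H; case: (j <= k)%N; exact: aM.
have -> : \sum_(j <- nu) j%:R * (if (j <= k)%N
      then cexpect P (fun t => trmono ((k - j)%N :: mu) (rem j nu) (U t))
      else cexpect P (fun t => trmono mu ((j - k)%N :: rem j nu) (U t))) =
  cexpect P (fun t => \sum_(j <- nu) j%:R * H j (U t)).
  rewrite cexpect_sum; last by move=> j; exact: cadmZ.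
  by apply: eq_bigr => j _; rewrite (cexpectZ _ _ (aH j)) /H; case: (j <= k)%N.
have aZ (r : seq nat) (f : nat -> M -> R[i]) : (forall j, cadm (fun t => f j (U t))) ->
    cadm (fun t => \sum_(j <- r) j%:R * f j (U t)).
  by move=> af; apply: cadm_sum => j; exact: cadmZ.
have aS : cadm (fun t => \sum_(l < k) trmono [:: val l, (k - l)%N & mu] nu (U t)).
  by apply: cadm_sum => l; exact: aM.
have aS2 : cadm (fun t => \sum_(j <- mu) j%:R * trmono ((k + j)%N :: rem j mu) nu (U t)).
  by apply: (aZ mu (fun j => trmono ((k + j)%N :: rem j mu) nu)) => j; exact: aM.
have aS3 := aZ nu H aH.
rewrite -(cexpectD _ aS aS2) -(cexpectB _ (cadmD aS aS2) aS3).
apply: eq_cexpect => t; move: (Uu t); move: (U t) => V Vu.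
have -> : \sum_a \sum_b DF a b (delta_mx a b) V =
  (\sum_(l < k) trpow l V * trpow (k - l) V) * trmono mu nu V +
  ((\sum_(j <- mu) j%:R * trpow (k + j) V * \prod_(i <- rem j mu) trpow i V) *
    (\prod_(j <- nu) (trpow j V)^*) +
  (\prod_(j <- mu) trpow j V) *
    (\sum_(j <- nu) - (j%:R * \tr (V ^+ k *m adjmx V ^+ j)) * \prod_(i <- rem j nu) (trpow i V)^*)).
  rewrite /DF /=; under [LHS]eq_bigr do rewrite big_split /=; rewrite big_split /=; congr (_ + _).
    under [LHS]eq_bigr do rewrite -mulr_suml; rewrite -mulr_suml; congr (_ * _).
    under [LHS]eq_bigr => a _ do under eq_bigr => b _ do rewrite summxE.
    under [LHS]eq_bigr do rewrite exchange_big; rewrite exchange_big /=.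
    apply: eq_bigr => l _; rewrite /trpow /mxtrace mulr_suml; apply: eq_bigr => a _.
    by rewrite mulr_sumr; apply: eq_bigr => b _; rewrite delta_entry.
  rewrite /trmonoD; under [LHS]eq_bigr => a _ do under eq_bigr => b _ do rewrite mulrDr.
  under [LHS]eq_bigr do rewrite big_split; rewrite big_split /=; congr (_ + _).
    under [LHS]eq_bigr => a _ do under eq_bigr => b _ do rewrite mulrA.
    under [LHS]eq_bigr do rewrite -mulr_suml; rewrite -mulr_suml; congr (_ * _).
    under [LHS]eq_bigr => a _ do under eq_bigr => b _ do rewrite mulr_sumr.
    under [LHS]eq_bigr do rewrite exchange_big; rewrite exchange_big /=.
    apply: eq_bigr => j _; rewrite /trpow exprD -[_ * V ^+ j]/(_ *m _) -sum_delta.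
    rewrite mulr_sumr mulr_suml; apply: eq_bigr => a _.
    by rewrite mulr_sumr mulr_suml; apply: eq_bigr => b _; ring.
  under [LHS]eq_bigr => a _ do under eq_bigr => b _ do rewrite mulrCA.
  under [LHS]eq_bigr do rewrite -mulr_sumr; rewrite -mulr_sumr; congr (_ * _).
  under [LHS]eq_bigr => a _ do under eq_bigr => b _ do rewrite mulr_sumr.
  under [LHS]eq_bigr do rewrite exchange_big; rewrite exchange_big /=.
  apply: eq_bigr => j _; rewrite -sum_delta.
  rewrite mulr_sumr -sumrN mulr_suml; apply: eq_bigr => a _.
  by rewrite mulr_sumr -sumrN mulr_suml; apply: eq_bigr => b _; ring.
rewrite addrA; congr (_ + _ + _).
- rewrite mulr_suml; apply: eq_bigr => l _.
  by rewrite /trmono !big_cons; ring.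
- rewrite mulr_suml; apply: eq_bigr => j _.
  by rewrite /trmono !big_cons; ring.
- rewrite mulr_sumr -sumrN; apply: eq_bigr => j _.
  rewrite unitary_trace_subr// /H /trmono /trpow; case: ifP => _; rewrite big_cons; ring.
Qed.

End LoopEquation.

(** * Gaussian moments of traces *)

Section Pairing.
Implicit Types (mu nu : seq nat) (j k l : nat).
Local Open Scope nat_scope.

(* The moment of [prod_(j <- mu) p_j * prod_(j <- nu) conj p_j] for independent
   complex Gaussians [p_j] of variance [j]. *)
Fixpoint pairing mu nu : nat :=
  if mu is k :: mu' then k * count_mem k nu * pairing mu' (rem k nu)
  else nu == [::].

Lemma big_pred1_seq (s : seq nat) k (F : nat -> nat) :
  \sum_(j <- s | j == k) F j = count_mem k s * F k.
Proof.
elim: s => [|j s IH]; first by rewrite big_nil.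
by rewrite big_cons /= IH; case: eqP => [->|_]; rewrite ?mulSn.
Qed.

Lemma wickl k mu nu :
  pairing (k :: mu) nu = \sum_(j <- nu | j == k) j * pairing mu (rem j nu).
Proof. by rewrite big_pred1_seq /= mulnA (mulnC k). Qed.

Lemma pairing_perm mu nu : pairing mu nu != 0 -> perm_eq mu nu.
Proof.
elim: mu nu => [|k mu IH] nu /=; first by case: nu.
rewrite !muln_eq0 !negb_or => /andP[/andP[_ c0]] /IH p.
have kn : k \in nu by rewrite -has_pred1 has_count lt0n.
by rewrite (permPr (perm_to_rem kn)) perm_cons.
Qed.

Lemma pairing_cons_r l mu nu :
  pairing mu (l :: nu) = l * count_mem l mu * pairing (rem l mu) nu.
Proof.
elim: mu nu => [|k mu IH] nu; first by rewrite /= muln0 mul0n.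
rewrite /= (eq_sym l k); case: eqVneq => [->|kl].
  (* The two sides count [k] in [nu] and in [mu]; these counts agree as soon as the pairing does not
     vanish. *)
  case: (eqVneq (pairing mu nu) 0) => [->|/pairing_perm p].
    by rewrite !muln0.
  by rewrite (permP p).
by rewrite /= IH !add0n; ring.
Qed.

Lemma wickr l mu nu :
  pairing mu (l :: nu) = \sum_(j <- mu | j == l) j * pairing (rem j mu) nu.
Proof. by rewrite big_pred1_seq pairing_cons_r mulnA (mulnC l). Qed.

(* Gaussian moments satisfy the loop equation, [N] standing for [p_0]. *)
Lemma pairing_loop N k mu nu :
  N * pairing (k :: mu) nu + \sum_(l < k) pairing [:: val l, (k - l)%N & mu] nu +
  \sum_(j <- mu) j * pairing ((k + j) :: rem j mu) nu =
  \sum_(j <- nu) j * (if j < k then pairing ((k - j) :: mu) (rem j nu)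
                      else if j == k then N * pairing mu (rem j nu)
                      else pairing mu ((j - k) :: rem j nu)).
Proof.
(* The three terms on the left are, after one contraction, exactly the parts [j = k], [j < k] and
   [j > k] of the right side. *)
have -> : N * pairing (k :: mu) nu =
    \sum_(j <- nu) (if j == k then j * (N * pairing mu (rem j nu)) else 0).
  rewrite -big_mkcond wickl big_distrr /=; apply: eq_bigr => j _; lia.
have -> : \sum_(l < k) pairing [:: val l, (k - l)%N & mu] nu =
    \sum_(j <- nu) (if j < k then j * pairing ((k - j) :: mu) (rem j nu) else 0).
  under [LHS]eq_bigr => l _ do rewrite wickl big_mkcond /=.
  rewrite exchange_big /=; apply: eq_bigr => j _.
  case: ltnP => jk.
    rewrite (bigD1 (Ordinal jk))//= eqxx big1 ?addn0// => l; rewrite -val_eqE /= eq_sym.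
    by move=> /negPf ->.
  by rewrite big1// => l _; case: eqP => // jl; have := ltn_ord l; lia.
have -> : \sum_(j <- mu) j * pairing ((k + j) :: rem j mu) nu =
    \sum_(j <- nu) (if k < j then j * pairing mu ((j - k) :: rem j nu) else 0).
  under [LHS]eq_bigr => j _ do rewrite wickl big_mkcond big_distrr /=.
  rewrite exchange_big /=; apply: eq_bigr => j _.
  case: ltnP => kj; last first.
    rewrite big1// => i _; case: eqP => ji; last by rewrite muln0.
    by move: kj; rewrite ji -{2}(addn0 k) leq_add2l leqn0 => /eqP ->.
  rewrite wickr big_distrr /= [RHS]big_mkcond; apply: eq_bigr => i _.
  case: eqP => ji; case: eqP => ij; rewrite ?muln0 //; [exact: mulnCA | lia | lia].
rewrite -!big_split /=; apply: eq_bigr => j _.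
by case: ltngtP; rewrite ?muln0 //=; lia.
Qed.

(** A crude bound, only there to make a supremum over [mu] finite. *)
Lemma pairing_bound (w m : nat) mu nu : all (fun j => j <= w) mu -> size nu <= m ->
  pairing mu nu <= (w * m).+1 ^ size mu.
Proof.
elim: mu nu => [|k mu IH] nu /=; first by case: (nu == _).
move=> /andP[kw muw] nm; rewrite expnS leq_mul//.
  by apply: leqW; rewrite leq_mul// (leq_trans (count_size _ _)).
apply: IH => //; apply: leq_trans nm.
by rewrite size_subseq// rem_subseq.
Qed.

End Pairing.

(** * Uniqueness of the solution of the loop equations *)

Section HaarMoments.
Context {R : realType} {N : nat} {d : measure_display} {T : measurableType d}.
Variables (P : probability T R) (U : T -> 'M[R[i]]_N).
Hypothesis haarU : haar_unitary P U.
Implicit Types (mu nu : seq nat).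
Local Notation moment := (moment P U).

Let Uu t : unitary_mx (U t). Proof. by case: haarU. Qed.

Lemma moment_perm mu mu' nu nu' : perm_eq mu mu' -> perm_eq nu nu' ->
  moment mu nu = moment mu' nu'.
Proof.
move=> pm pn; apply: eq_cexpect => t; rewrite /trmono.
by rewrite (perm_big _ pm) (perm_big _ pn).
Qed.

Lemma moment_cons0l mu nu : moment (0%N :: mu) nu = N%:R * moment mu nu.
Proof.
rewrite -(cexpectZ P N%:R (cadm_trmono haarU mu nu)).
apply: eq_cexpect => t.
by rewrite /trmono big_cons /trpow expr0 mxtrace1 mulrA.
Qed.

Lemma le_norm_moment mu nu : `|moment mu nu| <= 2 * N%:R ^+ (size mu + size nu).
Proof.
apply: le_norm_cexpect => [|t]; first exact: (cadm_trmono haarU).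
rewrite normrM exprD !normr_prod.
have nP (s : seq nat) (f : nat -> R[i]) : (forall j, `|f j| <= N%:R) ->
    \prod_(j <- s) `|f j| <= N%:R ^+ size s.
  move=> fN; elim: s => [|j s IH]; first by rewrite big_nil.
  by rewrite big_cons exprS ler_pM// prodr_ge0.
have tN j : `|trpow j (U t)| <= N%:R by exact: unitary_mx_trace_norm.
rewrite ler_pM ?prodr_ge0//; first exact: nP.
by apply: nP => j; rewrite norm_conjC.
Qed.

(** Induction on the weight of [mu], for all [nu] at once: every term on the right of the loop
    equation has a left list of smaller weight, except that [j = k] contributes an explicit factor
    [N] to one. Subtracting the equation of [pairing] leaves a homogeneous system for the errors at
    the given weight. *)
Theorem moment_pairing mu nu : all (leq 1) mu -> all (leq 1) nu ->
  (sumn mu <= N)%N -> moment mu nu = (pairing mu nu)%:R.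
Proof.
move: {2}(sumn mu) (erefl (sumn mu)) => n; elim/ltn_ind: n mu nu => n IH.
case: n IH => [|n] IH mu0 nu sn mu0_gt nu_gt nN.
  have -> : mu0 = [::] by case: mu0 sn mu0_gt {nN} => //= -[].
  (* For [k = 0] the equation expresses invariance under scalar phases: the total weight of [nu]
     times the moment is zero. *)
  have := loop_equation haarU 0 [::] nu.
  rewrite big_ord0 big_nil addr0 big_seq.
  have -> : \sum_(i <- nu | i \in nu) i%:R *
      (if (i <= 0)%N then moment [:: (0 - i)%N] (rem i nu) else moment [::] ((i - 0)%N :: rem i nu)) =
      (sumn nu)%:R * moment [::] nu.
    rewrite sumnE natr_sum mulr_suml [RHS]big_seq; apply: eq_bigr => j jn.
    have := allP nu_gt _ jn; rewrite ltnNge => /negPf ->; congr (_ * _).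
    by rewrite subn0; apply: moment_perm => //; rewrite perm_sym perm_to_rem.
  move=> /esym/eqP; rewrite mulf_eq0 pnatr_eq0 => /orP[/eqP s0|/eqP m0].
    have -> : nu = [::] by case: nu s0 nu_gt => //= -[].
    rewrite -[RHS](cexpect_cst P) /=; apply: eq_cexpect => t.
    by rewrite /trmono !big_nil mulr1.
  rewrite m0 /=; case: eqP => // nu0; move: m0; rewrite nu0 => <-.
  rewrite -[RHS](cexpect_cst P) /=; apply: eq_cexpect => t.
  by rewrite /trmono !big_nil mulr1.
pose E la := moment la nu - (pairing la nu)%:R.
pose ok la := all (leq 1) la /\ sumn la = n.+1.
pose e la := complex.Re `|E la|.
have eE la : `|E la| = (e la)%:C%C by rewrite RRe_real// normr_real.
have e0 la : 0 <= e la by rewrite -ler0c -eE.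
(* The term [l = 0] isolates [N] times the error. The others number [k - 1] splittings and mergings
   of total coefficient [sumn mu], in all one less than the weight [n.+1]. *)
have contr (B : R) : (forall la, ok la -> e la <= B) ->
    forall la, ok la -> N%:R * e la <= n%:R * B.
  move=> eB [|k mu] [la_gt la_n] //.
  move: la_gt => /= /andP[k0 mu_gt]; move: la_n => /= kn.
  have B0 : 0 <= B by apply: le_trans (eB (k :: mu) _) => //; split; rewrite //= k0.
  case: k k0 kn => // k _ kn.
  have loop := loop_equation haarU k.+1 mu nu.
  rewrite big_ord_recl moment_cons0l subn0 in loop.
  have /(congr1 (fun x : nat => x%:R : R[i])) ploop := pairing_loop N k.+1 mu nu.
  rewrite big_ord_recl [X in (_ + (X + _) + _)%N]/= !mul0n add0n in ploop.
  rewrite !natrD natrM !natr_sum in ploop.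
  have rhsE : \sum_(j <- nu) j%:R *
     (if (j <= k.+1)%N then moment ((k.+1 - j)%N :: mu) (rem j nu)
      else moment mu ((j - k.+1)%N :: rem j nu)) = \sum_(i <- nu)
        (i * (if (i < k.+1)%N then pairing ((k.+1 - i)%N :: mu) (rem i nu)
          else if i == k.+1 then (N * pairing mu (rem i nu))%N
          else pairing mu ((i - k.+1)%N :: rem i nu)))%:R :> R[i].
    rewrite big_seq [RHS]big_seq; apply: eq_bigr => j jn.
    have j0 := allP nu_gt _ jn; rewrite natrM; congr (_ * _).
    have nu'_gt : all (leq 1) (rem j nu) by apply/allP => i /mem_rem; exact: (allP nu_gt).
    case: ltngtP => jk.
    - by apply: (IH (sumn ((k.+1 - j)%N :: mu))) => //=; try lia; rewrite subn_gt0 jk.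
    - by apply: (IH (sumn mu)) => //=; try lia; rewrite subn_gt0 jk.
    - rewrite jk subnn moment_cons0l natrM; congr (_ * _).
      by apply: (IH (sumn mu)) => //=; rewrite ?jk // in nu'_gt *; lia.
  have NE : N%:R * E (k.+1 :: mu) =
     - (\sum_(l < k) E [:: (bump 0 l)%N, (k.+1 - bump 0 l)%N & mu] +
        \sum_(j <- mu) j%:R * E ((k.+1 + j)%N :: rem j mu)).
    rewrite /E; under [X in _ = - (_ + X)]eq_bigr => j _ do rewrite mulrBr.
    rewrite !big_split /= !sumrN mulrBr.
    have sE : \sum_(j <- mu) (j * pairing ((k.+1 + j)%N :: rem j mu) nu)%:R =
        \sum_(j <- mu) j%:R * (pairing ((k.+1 + j)%N :: rem j mu) nu)%:R :> R[i].
      by apply: eq_bigr => j _; rewrite natrM.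
    move: loop; rewrite rhsE -ploop sE.
    move: (\sum_(l < k) _) (\sum_(l < k) _) (\sum_(j <- mu) _) (\sum_(j <- mu) _).
    move=> a b a' b'; rewrite -/(pairing (k.+1 :: mu) nu).
    move: (N%:R * moment _ _) (N%:R * _%:R) => x y H.
    by rewrite (_ : x = y + a + a' - b - b'); [ring | rewrite -H; ring].
  rewrite -lecR rmorphM rmorph_nat /= -eE -[N%:R]normr_nat -normrM NE normrN.
  apply: le_trans (ler_normD _ _) _.
  have n_split : n%:R * B = \sum_(l < k) B + \sum_(j <- mu) j%:R * B.
    rewrite sumr_const card_ord -[B *+ k]mulr_natl -mulr_suml -natr_sum -sumnE -mulrDl -natrD.
    by congr (_%:R * _); lia.
  rewrite n_split rmorphD !rmorph_sum lerD//.
    apply: le_trans (ler_norm_sum _ _ _) _; apply: ler_sum => l _.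
    rewrite eE lecR eB//; split.
      by rewrite /= subn_gt0 ltnS ltn_ord.
    by rewrite /= -kn /bump /=; have := ltn_ord l; lia.
  apply: le_trans (ler_norm_sum _ _ _) _; rewrite big_seq [leRHS]big_seq.
  apply: ler_sum => j jm; rewrite normrM normr_nat rmorphM rmorph_nat ler_wpM2l//.
  rewrite eE lecR eB//; split.
    by rewrite /=; apply/allP => i /mem_rem; exact: (allP mu_gt).
  rewrite -kn /= -addnA; congr (_ + _)%N.
  by rewrite (perm_sumn (perm_to_rem jm)).
(* The contraction only concludes once the supremum of the errors is known to be finite; lists of
   positive entries and weight [n.+1] have bounded length and entries. *)
have [B0 HB0] : exists B0 : R, forall la, ok la -> e la <= B0.
  pose m := size nu.
  exists (2 * N%:R ^+ (n.+1 + m) + ((n.+1 * m).+1 ^ n.+1)%:R) => la [la_gt la_n].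
  have sz : (size la <= n.+1)%N.
    rewrite -la_n; elim: la la_gt {la_n} => //= k la IHla /andP[k0 /IHla H].
    by rewrite -add1n leq_add.
  have bd : all (fun j => j <= n.+1)%N la.
    apply/allP => j jl; rewrite -la_n (perm_sumn (perm_to_rem jl)) /=; exact: leq_addr.
  have N1 : (0 < N)%N by apply: leq_trans nN; rewrite sn.
  rewrite -lecR -eE; apply: le_trans (ler_normB _ _) _.
  rewrite rmorphD rmorphM rmorphXn !rmorph_nat lerD//.
    apply: le_trans (le_norm_moment _ _) _; rewrite ler_wpM2l//.
    by rewrite ler_weXn2l ?ler1n// leq_add2r.
  rewrite normr_nat ler_nat; apply: leq_trans (pairing_bound bd (leqnn m)) _.
  by rewrite leq_pexp2l.
pose A := [set r : R | exists2 la, ok la & r = e la]%classic.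
have okmu : ok mu0 by [].
have supA : has_sup A.
  split; first by exists (e mu0); exists mu0.
  by exists B0 => r [la ola ->]; exact: HB0.
have eS la : ok la -> e la <= sup A.
  by move=> ola; apply: ub_le_sup; [case: supA | exists la].
have NP : 0 < N%:R :> R by rewrite ltr0n; apply: leq_trans nN; rewrite sn.
have S0 : N%:R * sup A <= n%:R * sup A.
  rewrite mulrC -ler_pdivlMr//; apply: ge_sup; first by case: supA.
  move=> r [la ola ->]; rewrite ler_pdivlMr// mulrC; exact: contr.
have : sup A <= 0.
  have nlt : n%:R + 1 <= N%:R :> R by rewrite natr1 ler_nat -sn.
  rewrite leNgt; apply/negP => S1.
  have : (n%:R + 1) * sup A <= N%:R * sup A by rewrite ler_wpM2r// ltW.
  lra.
move=> S1; have : e mu0 = 0 by apply/eqP; rewrite eq_le e0 andbT (le_trans (eS _ okmu)).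
move=> e00; have := eE mu0; rewrite e00 => /eqP; rewrite normr_eq0 subr_eq0 => /eqP.
by [].
Qed.

End HaarMoments.

(** * Complex series *)

Section ComplexSeries.
Context {R : realType}.
Implicit Types (u v : nat -> R[i]) (z : R[i]).

(** [cseries] is total, with a meaningless value on divergent series; [csum_to] records the
    convergence along with the value. *)
Definition csum_to u z : Prop :=
  (series (fun k => complex.Re (u k)) n @[n --> \oo] --> complex.Re z)%classic /\
  (series (fun k => complex.Im (u k)) n @[n --> \oo] --> complex.Im z)%classic.

Lemma cconjE z : cconj z = z^*.
Proof. by []. Qed.

Lemma cabsE z : `|z| = (cabs z)%:C%C.
Proof. by rewrite normc_def. Qed.

Lemma cabs_ge0 z : 0 <= cabs z.
Proof. exact: sqrtr_ge0. Qed.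

Lemma cabs_le_norm z (x : R) : (cabs z <= x) = (`|z| <= x%:C%C).
Proof. by rewrite cabsE lecR. Qed.

Lemma cabsM z w : cabs (z * w) = cabs z * cabs w.
Proof. by apply: complexI; rewrite rmorphM /= -!cabsE normrM. Qed.

Lemma cabsX z k : cabs (z ^+ k) = cabs z ^+ k.
Proof. by apply: complexI; rewrite rmorphXn /= -!cabsE normrX. Qed.

Lemma cabsJ z : cabs z^* = cabs z.
Proof. by apply: complexI; rewrite -!cabsE norm_conjC. Qed.

Lemma cabs_rC (x : R) : cabs (rC x) = `|x|.
Proof. by rewrite /cabs /= expr0n addr0 sqrtr_sqr. Qed.

Lemma cabs0 : cabs (0 : R[i]) = 0.
Proof. by apply: complexI; rewrite -cabsE normr0. Qed.

Lemma cabs_eq0 z : (cabs z == 0) = (z == 0).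
Proof. by rewrite -(inj_eq (@complexI R)) -cabsE normr_eq0. Qed.

Lemma cabs_sum (I : Type) (r : seq I) (F : I -> R[i]) :
  cabs (\sum_(i <- r) F i) <= \sum_(i <- r) cabs (F i).
Proof.
rewrite cabs_le_norm rmorph_sum; apply: le_trans (ler_norm_sum _ _ _) _.
by apply: ler_sum => i _; rewrite cabsE.
Qed.

Lemma sqr_cabs z : cabs z ^+ 2 = complex.Re (z * z^*).
Proof.
rewrite /cabs sqr_sqrtr ?addr_ge0 ?sqr_ge0//; case: z => a b /=.
by rewrite mulrN opprK !expr2.
Qed.

Lemma mul_conj z : z * z^* = (cabs z ^+ 2)%:C%C.
Proof. by rewrite -normCK cabsE rmorphXn. Qed.

Lemma Re_le_cabs z : `|complex.Re z| <= cabs z.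
Proof. by rewrite -lecR -cabsE; exact: normc_ge_Re. Qed.

Lemma Im_le_cabs z : `|complex.Im z| <= cabs z.
Proof.
rewrite -(sqrtr_sqr (complex.Im z)) ler_wsqrtr// lerDr sqr_ge0//.
Qed.

Lemma csum_to_cseries u z : csum_to u z -> cseries u = z.
Proof.
move=> [ur ui]; apply/eqP; rewrite eq_complex /=.
by rewrite (cvg_lim _ ur)// (cvg_lim _ ui)// !eqxx.
Qed.

Let ReD z w : complex.Re (z + w) = complex.Re z + complex.Re w.
Proof. by case: z; case: w. Qed.

Let ImD z w : complex.Im (z + w) = complex.Im z + complex.Im w.
Proof. by case: z; case: w. Qed.

Lemma csum_toD u v z w : csum_to u z -> csum_to v w ->
  csum_to (fun k => u k + v k) (z + w).
Proof.
move=> [ur ui] [vr vi]; split.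
  rewrite ReD (_ : series _ = series (fun k => complex.Re (u k)) + series (fun k => complex.Re (v k))).
    exact: cvgD.
  by rewrite -seriesD; congr series; apply/funext => k; rewrite ReD.
rewrite ImD (_ : series _ = series (fun k => complex.Im (u k)) + series (fun k => complex.Im (v k))).
  exact: cvgD.
by rewrite -seriesD; congr series; apply/funext => k; rewrite ImD.
Qed.

Lemma csum_toZ c u z : csum_to u z -> csum_to (fun k => c * u k) (c * z).
Proof.
have serM (x : R) (f : nat -> R) l : (series f n @[n --> \oo] --> l)%classic ->
    (x * series f n @[n --> \oo] --> x * l)%classic.
  by move=> fl; apply: cvgM fl; exact: cvg_cst.
case: c => a b [ur ui]; split.
  have -> : series (fun k => complex.Re ((a +i* b)%C * u k)) =
      (fun n => a * series (fun k => complex.Re (u k)) n -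
                b * series (fun k => complex.Im (u k)) n).
    apply/funext => n; rewrite /series /= !mulr_sumr -sumrB.
    by apply: eq_bigr => k _; case: (u k).
  rewrite (_ : complex.Re _ = a * complex.Re z - b * complex.Im z); last by case: (z).
  by apply: cvgB; exact: serM.
have -> : series (fun k => complex.Im ((a +i* b)%C * u k)) =
    (fun n => a * series (fun k => complex.Im (u k)) n +
              b * series (fun k => complex.Re (u k)) n).
  apply/funext => n; rewrite /series /= !mulr_sumr -big_split.
  by apply: eq_bigr => k _; case: (u k).
rewrite (_ : complex.Im _ = a * complex.Im z + b * complex.Re z); last by case: (z).
by apply: cvgD; exact: serM.
Qed.

Lemma csum_toJ u z : csum_to u z -> csum_to (fun k => (u k)^*) z^*.
Proof.
have re (w : R[i]) : complex.Re w^* = complex.Re w by case: w.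
have im (w : R[i]) : complex.Im w^* = - complex.Im w by case: w.
move=> [ur ui]; split.
  rewrite re (_ : series _ = series (fun k => complex.Re (u k)))//.
  by congr series; apply/funext => k; rewrite re.
rewrite im (_ : series _ = - series (fun k => complex.Im (u k))); first exact: cvgN.
by rewrite -seriesN; congr series; apply/funext => k; rewrite im.
Qed.

Lemma csum_to0 : csum_to (fun=> 0) 0.
Proof.
have z : series (fun _ : nat => 0 : R) = (fun=> 0).
  by apply/funext => n; rewrite /series /= big1.
by split; rewrite z; exact: cvg_cst.
Qed.

Lemma csum_to_sum (I : Type) (r : seq I) (u : I -> nat -> R[i]) (z : I -> R[i]) :
  (forall i, csum_to (u i) (z i)) ->
  csum_to (fun k => \sum_(i <- r) u i k) (\sum_(i <- r) z i).
Proof.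
move=> uz; elim: r => [|i r IH].
  rewrite big_nil (_ : (fun k => _) = fun=> 0); first exact: csum_to0.
  by apply/funext => k; rewrite big_nil.
rewrite big_cons (_ : (fun k => _) = fun k => u i k + \sum_(i <- r) u i k).
  exact: csum_toD.
by apply/funext => k; rewrite big_cons.
Qed.

Lemma csum_to_finite u n : (forall k, (n <= k)%N -> u k = 0) ->
  csum_to u (\sum_(k < n) u k).
Proof.
move=> u0; have fin (f : nat -> R) : (forall k, (n <= k)%N -> f k = 0) ->
    (series f m @[m --> \oo] --> \sum_(k < n) f k)%classic.
  move=> f0; apply: cvg_near_cst; exists n => // m /= nm.
  rewrite /series /= (big_cat_nat (n := n))//= big_mkord big_nat [X in _ + X]big1 ?addr0//.
  by move=> k /andP[nk _]; exact: f0.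
split; rewrite raddf_sum; apply: fin => k nk; by rewrite u0.
Qed.

Definition csummable u : Prop := cvgn (series (fun k => cabs (u k))).

Lemma csummable_le u (b : nat -> R) :
  (forall k, cabs (u k) <= b k) -> cvgn (series b) -> csummable u.
Proof.
move=> ub; apply: series_le_cvg => // k; first exact: cabs_ge0.
by apply: le_trans (ub k); exact: cabs_ge0.
Qed.

Lemma cvg_series_dominated (f b : nat -> R) :
  (forall k, `|f k| <= b k) -> cvgn (series b) -> cvgn (series f).
Proof.
move=> fb cb; apply: normed_cvg; apply: series_le_cvg cb => k /=; rewrite ?normr_ge0//.
by apply: le_trans (fb k).
Qed.

Lemma series_tail_le (f b : nat -> R) n :
  (forall k, `|f k| <= b k) -> cvgn (series b) ->
  `|limn (series f) - series f n| <= limn (series b) - series b n.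
Proof.
move=> fb cb; have cf := cvg_series_dominated fb cb.
have inc m : (n <= m)%N -> `|series f m - series f n| <= series b m - series b n.
  move=> nm; rewrite !sub_series_geq//.
  by apply: le_trans (ler_norm_sum _ _ _) _; exact: ler_sum.
have ndb : nondecreasing_seq (series b).
  apply/nondecreasing_seqP => m; rewrite seriesSr lerDl.
  by apply: le_trans (fb m).
have {}inc m : (n <= m)%N -> `|series f m - series f n| <= limn (series b) - series b n.
  move=> nm; apply: le_trans (inc _ nm) _; rewrite lerD2r.
  exact: nondecreasing_cvgn_le.
rewrite ler_distl; apply/andP; split.
  apply: limr_ge => //; exists n => // m /= /inc; rewrite ler_distl => /andP[+ _].
  by [].
apply: limr_le => //; exists n => // m /= /inc; rewrite ler_distl => /andP[_ +].
by [].
Qed.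

Lemma csum_to_summable u : csummable u -> csum_to u (cseries u).
Proof.
move=> su; split.
  by apply: (@cvg_series_dominated _ (fun k => cabs (u k))) => // k; exact: Re_le_cabs.
by apply: (@cvg_series_dominated _ (fun k => cabs (u k))) => // k; exact: Im_le_cabs.
Qed.

Lemma cseries_tail_le u (b : nat -> R) n :
  (forall k, cabs (u k) <= b k) -> cvgn (series b) ->
  `|cseries u - \sum_(k < n) u k| <= (2 * (limn (series b) - series b n))%:C%C.
Proof.
move=> ub cb; set z := _ - _.
have le_re : `|complex.Re z| <= limn (series b) - series b n.
  have -> : complex.Re z = limn (series (fun k => complex.Re (u k))) -
      series (fun k => complex.Re (u k)) n.
    by rewrite /z raddfB raddf_sum [series _ n]/series /= big_mkord.
  by apply: series_tail_le cb => k; apply: le_trans (ub k); exact: Re_le_cabs.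
have le_im : `|complex.Im z| <= limn (series b) - series b n.
  have -> : complex.Im z = limn (series (fun k => complex.Im (u k))) -
      series (fun k => complex.Im (u k)) n.
    by rewrite /z raddfB raddf_sum [series _ n]/series /= big_mkord.
  by apply: series_tail_le cb => k; apply: le_trans (ub k); exact: Im_le_cabs.
rewrite cabsE lecR.
apply: le_trans (_ : `|complex.Re z| + `|complex.Im z| <= _); last by lra.
rewrite -(@ler_pXn2r _ 2) ?nnegrE ?cabs_ge0 ?addr_ge0//.
rewrite /cabs sqr_sqrtr ?addr_ge0 ?sqr_ge0// sqrrD !real_normK ?num_real//.
by rewrite addrAC lerDl mulrn_wge0 ?mulr_ge0.
Qed.

Lemma sqnormE u z : csum_to (fun k => u k * (u k)^*) z -> sqnorm u = complex.Re z.
Proof.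
move=> [ur _]; apply: cvg_lim => //.
by rewrite (_ : (fun k => cabs (u k) ^+ 2) = (fun k => complex.Re (u k * (u k)^*)))//; apply/funext => k; rewrite sqr_cabs.
Qed.

End ComplexSeries.

(** * The population loss *)

Section PowerSums.
Context {R : realType}.

Lemma char_poly_conj (n : nat) (Q D : 'M[R[i]]_n) : Q \in unitmx ->
  char_poly (invmx Q *m D *m Q) = char_poly D.
Proof.
move=> Qu; have QQ : map_mx polyC (invmx Q) *m map_mx polyC Q = 1%:M.
  by rewrite -map_mxM mulVmx// map_mx1.
rewrite /char_poly.
have -> : char_poly_mx (invmx Q *m D *m Q) =
    map_mx polyC (invmx Q) *m char_poly_mx D *m map_mx polyC Q.
  rewrite /char_poly_mx mulmxBr mulmxBl !map_mxM; congr (_ - _).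
  by rewrite -scalemx1 -scalemxAr -scalemxAl mulmx1 QQ.
rewrite !det_mulmx mulrAC -det_mulmx QQ det1 mul1r //.
Qed.

(** The [x i] are known only as roots of the characteristic polynomial. A unitary matrix is normal,
    hence diagonalizable, and its diagonal is the same multiset of roots, so the power sums
    agree. *)
Lemma trace_powers (n : nat) (V : 'M[R[i]]_n) (x : 'I_n -> R[i]) k :
  unitary_mx V -> char_poly V = \prod_(i < n) ('X - (x i)%:P) ->
  \tr (V ^+ k) = \sum_(i < n) x i ^+ k.
Proof.
move=> Vu Vx; have Vn : V \is spectral.normalmx.
  apply/spectral.normalmxP.
  have -> : (V ^T ^ Num.conj)%sesqui = adjmx V by rewrite /adjmx map_trmx.
  by rewrite (unitary_mxC Vu); exact/unitary_mxP.
have := spectral.orthomx_spectralP Vn.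
set Q := spectral.spectralmx V; set D := diag_mx _ => VQ.
have Qu : Q \in unitmx := spectral.spectral_unit V.
have Vk : V ^+ k = invmx Q *m (D ^+ k) *m Q.
  elim: k => [|k IH]; first by rewrite !expr0 mulmx1 mulVmx.
  have -> : D ^+ k.+1 = D *m D ^+ k by rewrite exprS.
  have -> : V ^+ k.+1 = V *m V ^+ k by rewrite exprS.
  by rewrite IH {1}VQ; move: (D ^+ k) => E; rewrite !mulmxA mulmxK.
pose e := spectral.spectral_diag V.
have Dk : D ^+ k = diag_mx (\row_i (e 0 i ^+ k)).
  elim: k {Vk} => [|k IH].
    by rewrite expr0; apply/matrixP => i j; rewrite !mxE expr0.
  have -> : D ^+ k.+1 = D *m D ^+ k by rewrite exprS.
  rewrite IH mulmx_diag; congr diag_mx.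
  by apply/rowP => i; rewrite !mxE exprS.
have -> : \tr (V ^+ k) = \sum_i e 0 i ^+ k.
  rewrite Vk mxtrace_mulC mulmxA mulmxV// mul1mx Dk mxtrace_diag.
  by apply: eq_bigr => i _; rewrite mxE.
have : char_poly V = \prod_(i < n) ('X - (e 0 i)%:P).
  rewrite VQ char_poly_conj// char_poly_trig ?diag_mx_is_trig//.
  by apply: eq_bigr => i _; rewrite mxE eqxx.
rewrite Vx => E.
have P : perm_eq [seq x i | i <- index_enum 'I_n] [seq e 0 i | i <- index_enum 'I_n].
  by apply: prod_XsubC_eq; rewrite !big_map.
transitivity (\sum_(z <- [seq e 0 i | i <- index_enum 'I_n]) z ^+ k); first by rewrite big_map.
by rewrite -(perm_big _ P) big_map.
Qed.

End PowerSums.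

(** * Moments of a linear form against an antilinear form in the traces *)

Section WickMoments.
Context {R : realType} {N : nat} {d : measure_display} {T : measurableType d}.
Variables (P : probability T R) (U : T -> 'M[R[i]]_N).
Hypothesis haarU : haar_unitary P U.
Implicit Types (mu nu : seq nat) (x y : nat -> R[i]).

Definition antilinear_form y n (V : 'M[R[i]]_N) : R[i] := \sum_(k < n) y k * (trpow k V)^*.
Definition linear_form x n (V : 'M[R[i]]_N) : R[i] := \sum_(k < n) x k * trpow k V.

Lemma cadm_trpow k : cadm (fun t => trpow k (U t)).
Proof.
have := cadm_trmono haarU [:: k] [::]; congr cadm; apply/funext => t.
by rewrite /trmono big_seq1 big_nil mulr1.
Qed.

Lemma cadm_antilinear y n : cadm (fun t => antilinear_form y n (U t)).
Proof. by apply: cadm_sum => k; apply/cadmZ/cadmJ/cadm_trpow. Qed.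

Lemma cadm_linear x n : cadm (fun t => linear_form x n (U t)).
Proof. by apply: cadm_sum => k; apply/cadmZ/cadm_trpow. Qed.

Section Truncated.
Variables (y : nat -> R[i]) (n : nat).
Hypothesis y0 : y 0%N = 0.
Hypothesis y_trunc : forall k, (n <= k)%N -> y k = 0.

Let Y t := antilinear_form y n (U t).

Definition mixed_moment mu nu b : R[i] := cexpect P (fun t => trmono mu nu (U t) * Y t ^+ b).

Let cadm_mixed mu nu b : cadm (fun t => trmono mu nu (U t) * Y t ^+ b).
Proof. exact: (cadmM (cadm_trmono haarU mu nu) (cadmX b (cadm_antilinear y n))). Qed.

Lemma mixed_momentS mu nu b :
  mixed_moment mu nu b.+1 = \sum_(k < n) y k * mixed_moment mu ((k : nat) :: nu) b.
Proof.
transitivity (cexpect P (fun t => \sum_(k < n) y k * (trmono mu ((k : nat) :: nu) (U t) * Y t ^+ b))).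
  apply: eq_cexpect => t; rewrite exprS {1}/Y /antilinear_form.
  rewrite mulr_suml mulr_sumr; apply: eq_bigr => k _.
  by rewrite /trmono big_cons; ring.
rewrite cexpect_sum; last by move=> k; exact: cadmZ.
by apply: eq_bigr => k _; rewrite (cexpectZ _ _ (cadm_mixed _ _ _)).
Qed.

Lemma mixed_moment_perm mu nu nu' b : perm_eq nu nu' ->
  mixed_moment mu nu b = mixed_moment mu nu' b.
Proof. by move=> p; apply: eq_cexpect => t; rewrite /trmono (perm_big _ p). Qed.

Lemma mixed_moment0 mu nu : all (leq 1) mu -> all (leq 1) nu -> (sumn mu <= N)%N ->
  mixed_moment mu nu 0 = (pairing mu nu)%:R.
Proof.
move=> mu0 nu0 sN; rewrite -(moment_pairing haarU mu0 nu0 sN).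
by apply: eq_cexpect => t; rewrite expr0 mulr1.
Qed.

(** Gaussian integration by parts: the factor of index [k] is contracted either with an entry of
    [nu] or with one of the [b] copies of [Y], which yields [k * y k]. At [b = 0] the coefficient
    [b%:R] cancels the default [b.-1]. *)
Lemma mixed_wick k mu nu b : all (leq 1) (k :: mu) -> all (leq 1) nu ->
  (sumn (k :: mu) <= N)%N ->
  mixed_moment (k :: mu) nu b =
    \sum_(j <- nu | j == k) k%:R * mixed_moment mu (rem j nu) b +
    b%:R * (k%:R * y k) * mixed_moment mu nu b.-1.
Proof.
move=> kmu_gt + sN; have /andP[k0 mu_gt] : (0 < k)%N && all (leq 1) mu by [].
have smu : (sumn mu <= N)%N by apply: leq_trans sN; rewrite /= leq_addl.
elim: b nu => [|b IH] nu nu_gt.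
  rewrite mixed_moment0// wickl natr_sum !mul0r addr0 big_mkcond [RHS]big_mkcond.
  rewrite big_seq [RHS]big_seq; apply: eq_bigr => j jn; case: eqP => // ->.
  rewrite natrM mixed_moment0//.
  by apply/allP => i /mem_rem; exact: (allP nu_gt).
rewrite mixed_momentS.
have step (l : 'I_n) : y l * mixed_moment (k :: mu) ((l : nat) :: nu) b =
    (if (l : nat) == k then k%:R * y k * mixed_moment mu nu b else 0) +
    (\sum_(j <- nu | j == k) k%:R * (y l * mixed_moment mu ((l : nat) :: rem j nu) b) +
     b%:R * (k%:R * y k) * (y l * mixed_moment mu ((l : nat) :: nu) b.-1)).
  have [l0|l0] := posnP ((l : nat)).
    rewrite l0 y0 !mul0r ifF; last by apply/eqP => kk; rewrite -kk in k0.
    rewrite mulr0 add0r addr0 big1// => j _; by rewrite mul0r mulr0.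
  rewrite IH ?mulrDr /= ?l0//; rewrite addrA; congr (_ + _); last by ring.
  rewrite big_cons /=; have -> : \sum_(j <- nu | j == k)
      k%:R * (y l * mixed_moment mu ((l : nat) :: rem j nu) b) =
      \sum_(j <- nu | j == k) y l * (k%:R * mixed_moment mu (if (l : nat) == j then nu else (l : nat) :: rem j nu) b).
    rewrite big_seq_cond [RHS]big_seq_cond; apply: eq_bigr => j /andP[jn _].
    rewrite mulrCA; congr (_ * (_ * _)); case: eqP => [lj|//].
    by apply: mixed_moment_perm; rewrite lj perm_sym perm_to_rem.
  case: eqP => [lk|_]; last by rewrite add0r mulr_sumr.
  rewrite mulrDr mulr_sumr eqxx lk; congr (_ + _); ring.
under eq_bigr => l _ do rewrite step.
rewrite !big_split /= exchange_big /=.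
have -> : \sum_(i < n) (if (i : nat) == k then k%:R * y k * mixed_moment mu nu b else 0) =
    k%:R * y k * mixed_moment mu nu b.
  rewrite -big_mkcond; case: (ltnP k n) => kn.
    by rewrite (big_pred1 (Ordinal kn)).
  rewrite y_trunc// mulr0 mul0r big1// => i; by rewrite mulr0 mul0r.
have -> : \sum_(j <- nu | j == k) \sum_(i < n)
     k%:R * (y i * mixed_moment mu ((i : nat) :: rem j nu) b) =
   \sum_(j <- nu | j == k) k%:R * mixed_moment mu (rem j nu) b.+1.
  by apply: eq_bigr => j _; rewrite mixed_momentS mulr_sumr.
rewrite addrCA; congr (_ + _).
rewrite -natr1 !mulrDl mul1r addrC -mulr_sumr; congr (_ + _).
case: b {IH step} => [|b]; first by rewrite !mul0r.
by rewrite mixed_momentS.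
Qed.

Lemma mixed_moment_nil nu b : all (leq 1) nu -> (0 < size nu + b)%N ->
  mixed_moment [::] nu b = 0.
Proof.
elim: b nu => [|b IH] nu nu_gt; first by case: nu nu_gt => // j nu ? _; rewrite mixed_moment0.
move=> _; rewrite mixed_momentS big1// => k _.
have [->|k0] := posnP ((k : nat)); first by rewrite y0 mul0r.
by rewrite IH ?mulr0//= ?k0.
Qed.

Lemma mixed_moment_prod mu b : all (leq 1) mu -> (sumn mu <= N)%N ->
  mixed_moment mu [::] b = if size mu == b then b`!%:R * \prod_(j <- mu) (j%:R * y j) else 0.
Proof.
elim: mu b => [|k mu IH] b mu_gt sN.
  case: b => [|b]; last by rewrite mixed_moment_nil.
  by rewrite mixed_moment0//= big_nil mulr1.
rewrite mixed_wick// big_nil add0r; case: b => [|b]; first by rewrite !mul0r.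
have /andP[k0 mu0] : (0 < k)%N && all (leq 1) mu by [].
rewrite /= IH//; last by apply: leq_trans sN; rewrite /= leq_addl.
rewrite eqSS; case: eqP => _; last by rewrite mulr0.
by rewrite factS natrM big_cons; ring.
Qed.

Variables (x : nat -> R[i]) (K : nat).
Hypothesis x0 : x 0%N = 0.

(** The list [mu] is there for the induction on [a]: expanding one copy of the linear form moves an
    index, of weight at most [K], into [mu]. *)
Lemma form_moment a mu b : all (leq 1) mu -> (a * K + sumn mu <= N)%N ->
  cexpect P (fun t => linear_form x K.+1 (U t) ^+ a * (trmono mu [::] (U t) * Y t ^+ b)) =
  if (a + size mu == b)%N then
    b`!%:R * (\sum_(k < K.+1) x k * (k%:R * y k)) ^+ a * \prod_(j <- mu) (j%:R * y j)
  else 0.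
Proof.
have adm a' mu' : cadm (fun t => linear_form x K.+1 (U t) ^+ a' * (trmono mu' [::] (U t) * Y t ^+ b)).
  exact: (cadmM (cadmX a' (cadm_linear x K.+1)) (cadm_mixed mu' [::] b)).
elim: a mu => [|a IH] mu mu_gt sN.
  rewrite expr0 mulr1 add0n -mixed_moment_prod//.
  by apply: eq_cexpect => t; rewrite expr0 mul1r.
transitivity (cexpect P (fun t => \sum_(k < K.+1) x k *
    (linear_form x K.+1 (U t) ^+ a * (trmono ((k : nat) :: mu) [::] (U t) * Y t ^+ b)))).
  apply: eq_cexpect => t; rewrite exprS {1}/linear_form !mulr_suml.
  by apply: eq_bigr => k _; rewrite /trmono !big_cons; ring.
rewrite cexpect_sum; last by move=> k; exact: cadmZ.
have -> : \sum_(k < K.+1) cexpect P (fun t => x k *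
    (linear_form x K.+1 (U t) ^+ a * (trmono ((k : nat) :: mu) [::] (U t) * Y t ^+ b))) =
  \sum_(k < K.+1) x k * (if (a.+1 + size mu == b)%N then
    b`!%:R * (\sum_(k < K.+1) x k * (k%:R * y k)) ^+ a * (k%:R * y k * \prod_(j <- mu) (j%:R * y j))
    else 0).
  apply: eq_bigr => k _; rewrite (cexpectZ _ _ (adm _ _)).
  have [k0|k0] := posnP ((k : nat)); first by rewrite k0 x0 !mul0r.
  rewrite IH /= ?k0//; first by rewrite addnS addSn big_cons.
  by have := ltn_ord k; move: sN; rewrite mulSn; lia.
case: eqP => _; last by rewrite big1// => k _; rewrite mulr0.
rewrite exprS mulr_suml mulr_sumr mulr_suml; apply: eq_bigr => k _; ring.
Qed.

End Truncated.
End WickMoments.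

Lemma cmeasurable_lim (R : realType) (d : measure_display) (T : measurableType d)
    (F : T -> R[i]) (G : nat -> T -> R[i]) (tau : nat -> R) :
  (forall n, cmeasurable (G n)) -> (tau n @[n --> \oo] --> 0)%classic ->
  (forall n t, `|F t - G n t| <= (tau n)%:C%C) -> cmeasurable F.
Proof.
move=> mG tau0 FG; have conv (f : T -> R) (g : nat -> T -> R) :
    (forall n t, `|f t - g n t| <= tau n) ->
    forall t, setT t -> (g n t @[n --> \oo] --> f t)%classic.
  move=> fg t _; apply/cvgrPdist_le => e e0.
  have /cvgrPdist_le /(_ e e0) := tau0; apply: filterS => n; rewrite sub0r normrN => te.
  by apply: le_trans (fg n t) _; apply: le_trans te; exact: ler_norm.
split.
  apply: (measurable_fun_cvg (h := fun n t => complex.Re (G n t))).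
    by move=> n; case: (mG n).
  apply: conv => n t; rewrite -raddfB; have := norm_Re_le (FG n t).
  by [].
apply: (measurable_fun_cvg (h := fun n t => complex.Im (G n t))).
  by move=> n; case: (mG n).
apply: conv => n t; rewrite -raddfB; have := norm_Im_le (FG n t).
by [].
Qed.

(** * From truncations to the infinite feature vector *)

Section PairMoments.
Context {R : realType} {N : nat} {d : measure_display} {T : measurableType d}.
Variables (P : probability T R) (U : T -> 'M[R[i]]_N) (x : T -> 'I_N -> R[i]).
Hypotheses (haarU : haar_unitary P U) (eigx : eigenvalues_of U x).

Let Uu t : unitary_mx (U t). Proof. by case: haarU. Qed.

Lemma psum_trace t k : psum (x t) k = rC (Num.sqrt k%:R)^-1 * trpow k (U t).
Proof. by rewrite /psum /trpow (trace_powers k (Uu t) (eigx.1 t)). Qed.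

Variables (h : nat -> R[i]) (K : nat).
Hypothesis h0 : h 0%N = 0.
Hypothesis hK : forall k, (K < k)%N -> h k = 0.

Let rCJ (r : R) : (rC r)^* = rC r. Proof. exact: conjc_real. Qed.

Lemma cinner_finite t :
  cinner h (psum (x t)) = (linear_form (fun k => (h k)^* * rC (Num.sqrt k%:R)^-1) K.+1 (U t))^*.
Proof.
rewrite /cinner (csum_to_cseries (@csum_to_finite R _ K.+1 _)); last first.
  by move=> k Kk; rewrite hK// mul0r.
rewrite /linear_form rmorph_sum; apply: eq_bigr => k _.
by rewrite psum_trace cconjE !rmorphM /= conjCK mulrA.
Qed.

Variables (u : nat -> R[i]) (b : nat -> R).
Hypothesis ub : forall k, cabs (u k) <= Num.sqrt k%:R * b k.
Hypothesis cb : cvgn (series b).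

Let u0 : u 0%N = 0.
Proof.
apply/eqP; rewrite -cabs_eq0 eq_le cabs_ge0 andbT.
by have := ub 0%N; rewrite sqrtr0 mul0r.
Qed.

Let b_ge0 k : (0 < k)%N -> 0 <= b k.
Proof.
move=> k0; have := le_trans (cabs_ge0 _) (ub k).
by rewrite pmulr_rge0// sqrtr_gt0 ltr0n.
Qed.

Definition truncated_coef n k : R[i] :=
  if (k < n)%N then u k * rC (Num.sqrt k%:R)^-1 else 0.

Let term t k := u k * (psum (x t) k)^*.

Let termE t k : term t k = u k * rC (Num.sqrt k%:R)^-1 * (trpow k (U t))^*.
Proof. by rewrite /term psum_trace rmorphM /= rCJ mulrA. Qed.

(* [b 0] is unconstrained, while the series only involves [k > 0]. *)
Let c k := N%:R * (if k == 0%N then 0 else b k).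

Let cvg_c : cvgn (series c).
Proof.
apply: (@is_cvg_seriesZ _ (fun k => if k == 0%N then 0 else b k) N%:R).
rewrite -(is_cvg_series_restrict 1).
rewrite (_ : (fun n => _) = (fun n => \sum_(1 <= k < n) b k)).
  by rewrite is_cvg_series_restrict.
by apply/funext => n; apply: eq_big_nat => k /andP[k0 _]; rewrite gtn_eqF.
Qed.

Let term_le t k : cabs (term t k) <= c k.
Proof.
rewrite /c; case: eqVneq => [->|k0].
  by rewrite /term u0 mul0r cabs0 mulr0.
rewrite -lt0n in k0; have sk : 0 < Num.sqrt k%:R :> R by rewrite sqrtr_gt0 ltr0n.
rewrite termE !cabsM cabsJ cabs_rC ger0_norm ?invr_ge0 ?(ltW sk)//.
rewrite mulrC ler_pM ?mulr_ge0 ?cabs_ge0 ?invr_ge0 ?(ltW sk)//.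
  by rewrite cabs_le_norm rmorph_nat; exact: unitary_mx_trace_norm.
by rewrite ler_pdivrMr// mulrC.
Qed.

Let Y t := cinner u (psum (x t)).
Let Yn n t := antilinear_form (truncated_coef n) n (U t).
Let tau n := 2 * (limn (series c) - series c n).

Let Y_approx n t : `|Y t - Yn n t| <= (tau n)%:C%C.
Proof.
have -> : Yn n t = \sum_(k < n) term t k.
  by apply: eq_bigr => k _; rewrite termE /truncated_coef ltn_ord.
exact: (cseries_tail_le n (term_le t) cvg_c).
Qed.

Let tau_cvg0 : (tau n @[n --> \oo] --> 0)%classic.
Proof.
rewrite -(mulr0 2) -(subrr (limn (series c))).
apply: cvgM; first exact: cvg_cst.
by apply: cvgB; [exact: cvg_cst | exact: cvg_c].
Qed.

Let B := (tau 0)%:C%C.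

Let Y_bound t : `|Y t| <= B.
Proof. by have := Y_approx 0 t; rewrite /Yn /antilinear_form big_ord0 subr0. Qed.

Let series_c_ge0 n : 0 <= series c n.
Proof.
rewrite /series /= sumr_ge0// => k _; rewrite /c; case: eqP => [_|k0]; first by rewrite mulr0.
by rewrite mulr_ge0// b_ge0// lt0n; exact/eqP.
Qed.

Let Yn_bound n t : `|Yn n t| <= 2 * B.
Proof.
rewrite -[Yn n t](subKr (Y t)); apply: le_trans (ler_normB _ _) _.
rewrite mulr2n mulrDl mul1r lerD//; apply: le_trans (Y_approx n t) _.
have s0 : series c 0%N = 0 by rewrite /series /= big_geq.
by rewrite lecR ler_pM2l// lerD2l lerN2 s0.
Qed.

Lemma cadm_infinite_form : cadm (fun t => Y t).
Proof.
split; last by exists B.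
apply: (@cmeasurable_lim _ _ _ _ Yn tau) => // n.
by have [] := cadm_antilinear haarU (truncated_coef n) n.
Qed.

Let X t := linear_form (fun k => (h k)^* * rC (Num.sqrt k%:R)^-1) K.+1 (U t).

Let aX : cadm X. Proof. exact: cadm_linear haarU _ _. Qed.

Lemma exp_diff_le (z w D e : R[i]) s : 0 <= D -> `|z| <= D -> `|w| <= D -> `|z - w| <= e ->
  `|z ^+ s - w ^+ s| <= e * (s%:R * D ^+ s.-1).
Proof.
move=> D0 zD wD zwe; rewrite subrXX normrM ler_pM//.
apply: le_trans (ler_norm_sum _ _ _) _.
rewrite -[s in s%:R](card_ord s) mulr_natl -sumr_const ler_sum// => i _.
rewrite normrM !normrX; apply: (@le_trans _ _ (D ^+ (s.-1 - i) * D ^+ i)).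
  by rewrite ler_pM ?exprn_ge0// lerXn2r// nnegrE.
have is1 : (i <= s.-1)%N by move: (ltn_ord i); case: (s) i.
by rewrite -exprD subnK.
Qed.

(** Past the support of [h], truncating [u] no longer changes the value given by [form_moment]. The
    truncation error is bounded uniformly in the sample, so the expectations converge to the same
    value. *)
Lemma form_pair_moment j s : (j * K <= N)%N ->
  cexpect P (fun t => X t ^+ j * Y t ^+ s) =
  if j == s then s`!%:R * ((cinner h u)^* ) ^+ s else 0.
Proof.
move=> jK; set V := (RHS).
have aY := cadm_infinite_form.
have aXY : cadm (fun t => X t ^+ j * Y t ^+ s) by apply: cadmM; exact: cadmX.
have trunc n : (K < n)%N -> cexpect P (fun t => X t ^+ j * Yn n t ^+ s) = V.
  move=> Kn; have tc0 : truncated_coef n 0%N = 0 by rewrite /truncated_coef u0 mul0r if_same.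
  have tcn k : (n <= k)%N -> truncated_coef n k = 0 by rewrite /truncated_coef ltnNge => ->.
  pose xc k := (h k)^* * rC (Num.sqrt k%:R)^-1.
  have x0 : xc 0%N = 0 by rewrite /xc h0 conjC0 mul0r.
  have jK0 : (j * K + sumn [::] <= N)%N by rewrite addn0.
  have := @form_moment _ _ _ _ _ _ haarU _ n tc0 tcn xc K x0 j [::] s isT jK0.
  rewrite /= addn0 big_nil mulr1.
  have -> : cexpect P (fun t => X t ^+ j * (trmono [::] [::] (U t) * Yn n t ^+ s)) =
      cexpect P (fun t => X t ^+ j * Yn n t ^+ s).
    by apply: eq_cexpect => t; rewrite /trmono !big_nil !mul1r.
  move=> ->; rewrite /V; case: eqP => // ->; congr (_ * _ ^+ _).
  rewrite [in RHS]/cinner (csum_to_cseries (@csum_to_finite R _ K.+1 _)); last first.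
    by move=> k Kk; rewrite hK// mul0r.
  rewrite rmorph_sum; apply: eq_bigr => k _.
  rewrite /xc rmorphM cconjE /= conjCK /truncated_coef (leq_trans (ltn_ord k) Kn).
  have [k0|k0] := posnP (k : nat); first by rewrite k0 h0 conjC0 !mul0r.
  have kk : rC (Num.sqrt (k : nat)%:R)^-1 * rC (Num.sqrt (k : nat)%:R)^-1 * (k : nat)%:R = 1 :> R[i].
    rewrite -(rmorph_nat (real_complex R)) -!rmorphM /= -invfM -expr2 sqr_sqrtr//.
    by rewrite mulVf// pnatr_eq0 -lt0n.
  have -> : (h k)^* * rC (Num.sqrt (k : nat)%:R)^-1 * ((k : nat)%:R * (u k * rC (Num.sqrt (k : nat)%:R)^-1)) =
     (h k)^* * u k * (rC (Num.sqrt (k : nat)%:R)^-1 * rC (Num.sqrt (k : nat)%:R)^-1 * (k : nat)%:R) by ring.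
  by rewrite kk mulr1.
have [A HA] := (cadmX j aX).2.
have A0 : 0 <= A by apply: le_trans (HA point).
have B0 : 0 <= B by apply: le_trans (Y_bound point).
set D := 2 * B.
have D0 : 0 <= D by rewrite mulr_ge0.
pose W := complex.Re (2 * (A * (s%:R * D ^+ s.-1))).
have WE : 2 * (A * (s%:R * D ^+ s.-1)) = W%:C%C.
  by rewrite RRe_real// ger0_real// !mulr_ge0// exprn_ge0.
have W0 : 0 <= W by rewrite -ler0c -WE !mulr_ge0// exprn_ge0.
have close n : (K < n)%N ->
    `|cexpect P (fun t => X t ^+ j * Y t ^+ s) - V| <= (W * tau n)%:C%C.
  move=> Kn; rewrite -(trunc n Kn) -cexpectB//; last first.
    by apply: cadmM; [exact: cadmX|exact/cadmX/(cadm_antilinear haarU)].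
  have -> : (W * tau n)%:C%C = 2 * (A * ((tau n)%:C%C * (s%:R * D ^+ s.-1))).
    by rewrite rmorphM /= -WE; ring.
  apply: le_norm_cexpect.
    apply: cadmB => //; apply: cadmM; [exact: cadmX|exact/cadmX/(cadm_antilinear haarU)].
  move=> t; rewrite -mulrBr normrM ler_pM//.
  apply: exp_diff_le => //; apply: le_trans (Y_bound t) _.
  by rewrite /D mulr2n mulrDl mul1r lerDl.
apply/eqP; rewrite -subr_eq0 -normr_le0 cabsE -[0]/(0%:C)%C lecR.
have Wtau : (W * tau n @[n --> \oo] --> 0)%classic.
  by rewrite -(mulr0 W); apply: cvgM => //; exact: cvg_cst.
rewrite -(cvg_lim _ Wtau)//; apply: limr_ge; first by apply/cvg_ex; exists 0.
by exists K.+1 => // n /= Kn; rewrite -lecR -cabsE; exact: close.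
Qed.

End PairMoments.

Section ActivationBounds.
Context {R : realType} {M : nat}.
Variables (c : nat -> R[i]) (a : 'I_M -> R[i]).
Hypothesis a1 : forall m, cabs (a m) = 1.

Lemma cabs_Amat k m : cabs (Amat c a k m) = Num.sqrt k%:R * cabs (c k).
Proof.
rewrite /Amat !cabsM cabsX a1 expr1n mulr1 cabs_rC ger0_norm ?sqrtr_ge0//.
exact: mulrC.
Qed.

Lemma cabs_Aw (w : 'cV[R[i]]_M) k :
  cabs (Aw c a w k) <= Num.sqrt k%:R * (cabs (c k) * \sum_m cabs (w m 0)).
Proof.
apply: le_trans (cabs_sum _ _) _; rewrite !mulr_sumr; apply: ler_sum => m _.
by rewrite cabsM cabs_Amat mulrA.
Qed.

End ActivationBounds.

Section Loss.
Context {R : realType} {N M : nat} {d : measure_display} {T : measurableType d}.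
Variables (P : probability T R) (U : T -> 'M[R[i]]_N) (x : T -> 'I_N -> R[i]).
Hypotheses (haarU : haar_unitary P U) (eigx : eigenvalues_of U x).
Variables (c alpha h : nat -> R[i]) (a : 'I_M -> R[i]) (s : nat).
Hypothesis a1 : forall m, cabs (a m) = 1.
Hypothesis cc : cvgn (series (fun k => cabs (c k))).
Hypothesis s_le : (1 <= s <= isqrt N)%N.
Hypothesis alpha_s : alpha s != 0.
Hypothesis h_supp : forall k, ((k == 0) || (isqrt N < k))%N -> h k = 0.

Lemma isqrt_sqr_le : (isqrt N * isqrt N <= N)%N.
Proof.
rewrite /isqrt; apply: (@big_ind nat (fun k => (k * k <= N)%N)) => //.
by move=> i j iN jN; rewrite /maxn; case: ifP.
Qed.

Lemma cinnerC (u v : nat -> R[i]) n : (forall k, (n <= k)%N -> v k = 0) ->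
  cinner u v = (cinner v u)^*.
Proof.
move=> v0; rewrite /cinner.
rewrite !(csum_to_cseries (@csum_to_finite R _ n _)); first last.
- by move=> k nk; rewrite v0// cconjE conjC0 mulr0.
- by move=> k nk; rewrite v0// mul0r.
rewrite rmorph_sum; apply: eq_bigr => k _.
by rewrite !cconjE rmorphM /= conjCK mulrC.
Qed.

(** Forms of different degrees are orthogonal, so the teacher contributes only through [j = s]. The
    normalization of [g] cancels [s!] and the phase of [alpha s], leaving [|alpha_s|]. The integrand
    is the conjugate of [X ^ j * Y ^ s] up to constants, which is why [cinner h u], the conjugate of
    [m], appears before the real part is taken. *)
Lemma lossE (w : 'cV[R[i]]_M) : loss P x c a alpha s h w =
  - (cabs (alpha s) * complex.Re (mstat c a h w ^+ s)) +
  cabs (alpha s) / 2 * sqnorm (Aw c a w) ^+ s.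
Proof.
rewrite /loss; congr (_ + _); set K := isqrt N.
have sK : (1 <= s <= K)%N by exact: s_le.
have hsupp k : ((k == 0%N) || (K < k)%N) -> h k = 0 by exact: h_supp.
set u := Aw c a w; pose b k := cabs (c k) * \sum_m cabs (w m 0).
have ub k : cabs (u k) <= Num.sqrt k%:R * b k by exact: cabs_Aw.
have cb : cvgn (series b).
  rewrite (_ : b = (\sum_m cabs (w m 0)) *: (fun k => cabs (c k))).
    exact: is_cvg_seriesZ.
  by apply/funext => k; rewrite /b mulrC.
have h0 : h 0%N = 0 by exact: hsupp.
have hK k : (K < k)%N -> h k = 0 by move=> Kk; rewrite hsupp// Kk orbT.
pose X t := linear_form (fun k => (h k)^* * rC (Num.sqrt k%:R)^-1) K.+1 (U t).
pose Y t := cinner u (psum (x t)).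
have aX : cadm X by exact: (cadm_linear haarU).
have aY : cadm Y by exact: (cadm_infinite_form haarU eigx ub cb).
pose g := alpha s / rC (cabs (alpha s) * Num.sqrt s`!%:R).
pose C j := - (alpha j / rC (Num.sqrt j`!%:R) * g^*).
pose F t := \sum_(1 <= j < K.+1) C j * (X t ^+ j * Y t ^+ s)^*.
have aXY j : cadm (fun t => (X t ^+ j * Y t ^+ s)^*).
  exact: (cadmJ (cadmM (cadmX j aX) (cadmX s aY))).
transitivity (complex.Re (cexpect P F)).
  apply: eq_Rintegral => t _.
  rewrite -[LHS]raddfN; congr complex.Re.
  rewrite (cinner_finite haarU eigx hK) -/(X t) -/(Y t) /teacher /gfun -/g.
  rewrite /F cconjE rmorphM rmorphXn /= mulr_suml -sumrN; apply: eq_bigr => j _.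
  have -> : (X t ^+ j * Y t ^+ s)^* = (X t)^* ^+ j * (Y t)^* ^+ s.
    by rewrite rmorphM !rmorphXn.
  by rewrite /C; ring.
have -> : cexpect P F = C s * (s`!%:R * (cinner h u) ^+ s).
  rewrite /F cexpect_sum; last by move=> j; exact: cadmZ.
  have EXY j : (1 <= j <= K)%N -> cexpect P (fun t => C j * (X t ^+ j * Y t ^+ s)^*) =
      if j == s then C s * (s`!%:R * (cinner h u) ^+ s) else 0.
    move=> /andP[_ jK]; rewrite (cexpectZ _ _ (aXY j)).
    rewrite (cexpectJ _ (cadmM (cadmX j aX) (cadmX s aY))).
    have jKN : (j * K <= N)%N.
      by apply: leq_trans isqrt_sqr_le; rewrite leq_mul2r jK orbT.
    rewrite (form_pair_moment haarU eigx h0 hK ub cb s jKN).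
    case: eqP => [->|_]; last by rewrite conjC0 mulr0.
    by rewrite rmorphM rmorphXn /= conjCK rmorph_nat.
  rewrite (bigD1_seq s) ?iota_uniq ?mem_index_iota ?ltnS//=.
  rewrite EXY// eqxx big_seq_cond big1 ?addr0// => j /andP[].
  by rewrite mem_index_iota ltnS => jK /negPf js; rewrite EXY// js.
have hu : cinner h u = (mstat c a h w)^*.
  by rewrite /mstat (cinnerC (Aw c a w) (hK : forall k, (K.+1 <= k)%N -> h k = 0)) conjCK.
have sf0 : Num.sqrt s`!%:R != 0 :> R by rewrite sqrtr_eq0 -ltNge ltr0n fact_gt0.
have A0 : cabs (alpha s) != 0 by rewrite cabs_eq0.
have Cs : C s * s`!%:R = - rC (cabs (alpha s)).
  rewrite /C /g fmorph_div /=; set f := Num.sqrt s`!%:R in sf0 *.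
  have -> : (rC (cabs (alpha s) * f))^* = rC (cabs (alpha s)) * rC f.
    by rewrite -[rC _ * rC _]rmorphM; exact: conjc_real.
  have -> : s`!%:R = rC f * rC f.
    by rewrite -[rC f * rC f]rmorphM /= -expr2 sqr_sqrtr// rmorph_nat.
  have fn0 : rC f != 0 by rewrite -[0]/(rC 0) (inj_eq (@complexI R)).
  have An0 : rC (cabs (alpha s)) != 0 by rewrite -[0]/(rC 0) (inj_eq (@complexI R)).
  have AA : rC (cabs (alpha s)) * rC (cabs (alpha s)) = alpha s * (alpha s)^*.
    by rewrite mul_conj expr2 rmorphM.
  have -> : - rC (cabs (alpha s)) = - (alpha s * (alpha s)^*) / rC (cabs (alpha s)).
    by rewrite -AA mulNr mulfK.
  by field; rewrite fn0 An0.
rewrite mulrA Cs hu -rmorphXn mulNr raddfN /=; congr (- _).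
by case: (mstat c a h w ^+ s) => p q /=; rewrite mul0r subr0.
Qed.

End Loss.

(** * Gradient flow *)

Section FeatureSpace.
Context {R : realType} {M : nat}.
Variables (c : nat -> R[i]) (a : 'I_M -> R[i]) (h : nat -> R[i]) (K : nat).
Hypothesis a1 : forall m, cabs (a m) = 1.
Hypothesis c2 : cvgn (series (fun k => k%:R * cabs (c k) ^+ 2)).
Hypothesis Gunit : AtA c a \in unitmx.
Hypothesis hK : forall k, (K <= k)%N -> h k = 0.
Hypothesis h1 : sqnorm h = 1.
Local Notation G := (AtA c a).
Implicit Types (w : 'cV[R[i]]_M).

Lemma csum_AtA m m' : csum_to (fun k => (Amat c a k m)^* * Amat c a k m') (G m m').
Proof.
rewrite mxE; apply: csum_to_summable; apply: csummable_le c2 => k.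
rewrite cabsM cabsJ !cabs_Amat// -expr2 exprMn sqr_sqrtr//.
Qed.

Lemma AtA_herm m m' : G m m' = (G m' m)^*.
Proof.
have := csum_toJ (csum_AtA m' m) => /csum_to_cseries <-.
rewrite mxE; congr cseries; apply/funext => k.
by rewrite cconjE; move: (Amat _ _ _ m) (Amat _ _ _ m') => A B; rewrite rmorphM /= conjCK mulrC.
Qed.

(** The inner product [<A w, A w'>], written through the Gram matrix so that the dynamics only
    involves finite sums. *)
Definition quad w w' : R[i] := \sum_m \sum_m' (w m 0 * (w' m' 0)^*) * G m' m.

Lemma csum_quad w w' : csum_to (fun k => Aw c a w k * (Aw c a w' k)^*) (quad w w').
Proof.
have := @csum_to_sum R _ (index_enum 'I_M) (fun m k => \sum_m' (w m 0 * (w' m' 0)^*) *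
  ((Amat c a k m')^* * Amat c a k m)) (fun m => \sum_m' (w m 0 * (w' m' 0)^*) * G m' m).
have -> : (fun k => \sum_m \sum_m' (w m 0 * (w' m' 0)^*) * ((Amat c a k m')^* * Amat c a k m)) =
   (fun k => Aw c a w k * (Aw c a w' k)^*).
  apply/funext => k; rewrite /Aw rmorph_sum mulr_suml; apply: eq_bigr => m _.
  rewrite mulr_sumr; apply: eq_bigr => m' _.
  by move: (Amat _ _ _ m) (Amat _ _ _ m') => A B; rewrite rmorphM /=; ring.
by apply => m; apply: csum_to_sum => m'; apply: csum_toZ; exact: csum_AtA.
Qed.

Lemma quadC w w' : quad w w' = (quad w' w)^*.
Proof.
rewrite /quad rmorph_sum exchange_big; apply: eq_bigr => m _.
rewrite rmorph_sum; apply: eq_bigr => m' _.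
by rewrite !rmorphM /= conjCK -AtA_herm; ring.
Qed.

Lemma quad_real w : quad w w = (complex.Re (quad w w))%:C%C.
Proof. by rewrite RRe_real//; apply/CrealP; rewrite -quadC. Qed.

Lemma quadDl z w1 w2 w : quad (z *: w1 + w2) w = z * quad w1 w + quad w2 w.
Proof.
rewrite /quad mulr_sumr -big_split; apply: eq_bigr => m _.
rewrite mulr_sumr -big_split; apply: eq_bigr => m' _; rewrite !mxE /=; ring.
Qed.

Lemma sqnorm_Aw w : sqnorm (Aw c a w) = complex.Re (quad w w).
Proof. exact/sqnormE/csum_quad. Qed.

Local Notation b := (Adag c a h).
Local Notation m_ := (mstat c a h).

Lemma csum_Adag m : csum_to (fun k => (Amat c a k m)^* * h k) (b m 0).
Proof.
rewrite mxE.
have H : csum_to (fun k => (Amat c a k m)^* * h k) (\sum_(k < K) (Amat c a k m)^* * h k).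
  by apply: csum_to_finite => k Kk; rewrite hK// mulr0.
by have -> : cseries (fun k => cconj (Amat c a k m) * h k) = _ := csum_to_cseries H.
Qed.

Lemma csum_mstat w : csum_to (fun k => Aw c a w k * (h k)^*) (\sum_m w m 0 * (b m 0)^*).
Proof.
have := @csum_to_sum R _ (index_enum 'I_M) (fun m k => w m 0 * ((Amat c a k m)^* * h k)^*)
  (fun m => w m 0 * (b m 0)^*).
have -> : (fun k => \sum_m w m 0 * ((Amat c a k m)^* * h k)^*) =
    (fun k => Aw c a w k * (h k)^*).
  apply/funext => k; rewrite /Aw mulr_suml; apply: eq_bigr => m _.
  by move: (Amat _ _ _ m) => A; rewrite rmorphM /= conjCK; ring.
by apply => m; apply/csum_toZ/csum_toJ/csum_Adag.
Qed.

Lemma mstatE w : m_ w = \sum_m w m 0 * (b m 0)^*.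
Proof. exact/csum_to_cseries/csum_mstat. Qed.

Lemma mstatDl z w1 w2 : m_ (z *: w1 + w2) = z * m_ w1 + m_ w2.
Proof.
rewrite !mstatE mulr_sumr -big_split; apply: eq_bigr => m _; rewrite !mxE /=; ring.
Qed.

(* Coefficients of the projection of [h] onto the range of [A]. *)
Definition proj_coef : 'cV[R[i]]_M := invmx G *m b.

Lemma AtA_proj_coef : G *m proj_coef = b.
Proof. by rewrite mulmxA mulmxV// mul1mx. Qed.

(** Pairing the projection of [h] with [A w] is the same as pairing [h] with it. *)
Lemma quad_proj_coef w : quad proj_coef w = (m_ w)^*.
Proof.
rewrite mstatE rmorph_sum /quad exchange_big; apply: eq_bigr => m _.
rewrite rmorphM /= conjCK -AtA_proj_coef mxE mulr_sumr; apply: eq_bigr => m' _; ring.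
Qed.

Lemma deltaE : delta c a h = 1 - complex.Re (quad proj_coef proj_coef).
Proof. by rewrite /delta -sqnorm_Aw. Qed.

Lemma mstat_proj_coef : m_ proj_coef = (1 - delta c a h)%:C%C.
Proof.
by rewrite deltaE subKr -quad_real [RHS]quadC quad_proj_coef conjCK.
Qed.

Lemma vstatE w : vstat c a h w = sqnorm (Aw c a w) - cabs (m_ w) ^+ 2 /\
  0 <= vstat c a h w.
Proof.
set m := m_ w.
have [zh hz] : exists z, csum_to (fun k => h k * (h k)^*) z.
  exists (\sum_(k < K) h k * (h k)^*); apply: csum_to_finite => k Kk.
  by rewrite hK// mul0r.
have zh1 : complex.Re zh = 1 by rewrite -h1 (sqnormE hz).
have wm : csum_to (fun k => Aw c a w k * (h k)^*) m.
  by rewrite /m mstatE; exact: csum_mstat.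
have H := csum_toD (csum_toD (csum_quad w w) (csum_toZ (- m^*) wm))
  (csum_toD (csum_toZ (- m) (csum_toJ wm)) (csum_toZ (m * m^*) hz)).
have E : csum_to (fun k => (Aw c a w k - m * h k) * (Aw c a w k - m * h k)^*)
    (quad w w + - m^* * m + (- m * m^* + m * m^* * zh)).
  move: H; congr csum_to; apply/funext => k; rewrite rmorphB !rmorphM /= conjCK; ring.
have vE : vstat c a h w = sqnorm (Aw c a w) - cabs m ^+ 2.
  rewrite /vstat (sqnormE E) sqnorm_Aw.
  have -> : quad w w + - m^* * m + (- m * m^* + m * m^* * zh) =
    quad w w - m * m^* *+ 2 + m * m^* * zh by ring.
  rewrite mul_conj; case: (quad w w) => p1 p2; case: zh {E H hz} zh1 => z1 z2 /= ->.
  ring.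
split=> //; rewrite /vstat.
have [Er _] := E.
have -> : sqnorm (fun k => Aw c a w k - m * h k) =
    limn (series (fun k => complex.Re ((Aw c a w k - m * h k) * (Aw c a w k - m * h k)^*))).
  by congr (limn (series _)); apply/funext => k; rewrite sqr_cabs.
apply: limr_ge; first by apply/cvg_ex; eexists; exact: Er.
apply: nearW => n; rewrite /series /= sumr_ge0// => k _.
by rewrite -sqr_cabs sqr_ge0.
Qed.

(** At [proj_coef] both [|A w| ^ 2] and [m] equal [q = 1 - delta], so [v >= 0] reads
    [q - q ^ 2 >= 0]. *)
Lemma delta_ge0 : 0 <= delta c a h.
Proof.
have [vE v0] := vstatE proj_coef; move: v0; rewrite vE sqnorm_Aw mstat_proj_coef.
rewrite -[(_)%:C%C]/(rC _) cabs_rC real_normK ?num_real//.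
have -> : complex.Re (quad proj_coef proj_coef) = 1 - delta c a h by rewrite deltaE subKr.
set q := delta c a h; nra.
Qed.

End FeatureSpace.

(** * Derivatives of complex-valued curves *)

Section ComplexCurves.
Context {R : realType}.
Implicit Types (f g : R -> R[i]) (t : R).

Definition cderive f t (l : R[i]) : Prop :=
  is_derive t 1 (fun u => complex.Re (f u)) (complex.Re l) /\
  is_derive t 1 (fun u => complex.Im (f u)) (complex.Im l).

Lemma cderive_cst z t : cderive (fun=> z) t 0.
Proof. by split; exact: is_derive_cst. Qed.

Lemma cderiveD f g t l m : cderive f t l -> cderive g t m ->
  cderive (fun u => f u + g u) t (l + m).
Proof.
move=> [fr fi] [gr gi]; split.
  have -> : (fun u => complex.Re (f u + g u)) = (fun u => complex.Re (f u)) + (fun u => complex.Re (g u)).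
    by apply/funext => u; rewrite raddfD.
  by rewrite raddfD; exact: is_deriveD.
have -> : (fun u => complex.Im (f u + g u)) = (fun u => complex.Im (f u)) + (fun u => complex.Im (g u)).
  by apply/funext => u; rewrite raddfD.
by rewrite raddfD; exact: is_deriveD.
Qed.

Lemma cderiveM f g t l m : cderive f t l -> cderive g t m ->
  cderive (fun u => f u * g u) t (f t * m + g t * l).
Proof.
move=> [fr fi] [gr gi].
have E u : f u * g u = ((complex.Re (f u) * complex.Re (g u) - complex.Im (f u) * complex.Im (g u)) +i*
   (complex.Re (f u) * complex.Im (g u) + complex.Im (f u) * complex.Re (g u)))%C.
  by case: (f u) => p q; case: (g u).
split.
  have -> : (fun u => complex.Re (f u * g u)) =
      (fun u => complex.Re (f u)) * (fun u => complex.Re (g u)) -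
      (fun u => complex.Im (f u)) * (fun u => complex.Im (g u)).
    by apply/funext => u; rewrite E.
  apply: is_derive_eq (is_deriveB (is_deriveM fr gr) (is_deriveM fi gi)) _.
  rewrite /GRing.scale /=.
  case: (f t) (g t) l m {fr fi gr gi E} => [p1 p2] [r1 r2] [l1 l2] [m1 m2] /=; ring.
have -> : (fun u => complex.Im (f u * g u)) =
    (fun u => complex.Re (f u)) * (fun u => complex.Im (g u)) +
    (fun u => complex.Im (f u)) * (fun u => complex.Re (g u)).
  by apply/funext => u; rewrite E.
apply: is_derive_eq (is_deriveD (is_deriveM fr gi) (is_deriveM fi gr)) _.
rewrite /GRing.scale /=.
case: (f t) (g t) l m {fr fi gr gi E} => [p1 p2] [r1 r2] [l1 l2] [m1 m2] /=; ring.
Qed.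

Lemma cderive_eq f t l m : cderive f t l -> l = m -> cderive f t m.
Proof. by move=> fl <-. Qed.

Lemma cderiveZ z f t l : cderive f t l -> cderive (fun u => z * f u) t (z * l).
Proof.
move=> fl; apply: cderive_eq (cderiveM (cderive_cst z t) fl) _.
by rewrite mulr0 addr0.
Qed.

Lemma cderiveX n f t l : cderive f t l ->
  cderive (fun u => f u ^+ n.+1) t (n.+1%:R * f t ^+ n * l).
Proof.
move=> fl; elim: n => [|n IH].
  by have -> : (fun u => f u ^+ 1) = f by []; rewrite expr0 !mul1r.
have -> : (fun u => f u ^+ n.+2) = (fun u => f u * f u ^+ n.+1).
  by apply/funext => u; rewrite exprS.
apply: cderive_eq (cderiveM fl IH) _.
rewrite -(natr1 n.+1) (exprSr (f t) n); ring.
Qed.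

Lemma is_derive_exprn n (f : R -> R) t l : is_derive t 1 f l ->
  is_derive t 1 (fun u => f u ^+ n.+1) (n.+1%:R * f t ^+ n * l).
Proof.
move=> fl; elim: n => [|n IH].
  by have -> : (fun u => f u ^+ 1) = f by []; rewrite expr0 !mul1r.
have -> : (fun u => f u ^+ n.+2) = f * (fun u => f u ^+ n.+1).
  by apply/funext => u; rewrite exprS.
apply: is_derive_eq (is_deriveM fl IH) _.
rewrite /GRing.scale /= -(natr1 n.+1) (exprSr (f t) n); ring.
Qed.

Lemma cderive_line (z w : R[i]) t : cderive (fun r : R => z + rC r * w) t w.
Proof.
rewrite -[X in cderive _ _ X]add0r; apply: cderiveD; first exact: cderive_cst.
rewrite -[X in cderive _ _ X]mul1r.
have -> : (fun r : R => rC r * w) = (fun r => w * rC r) by apply/funext => r; rewrite mulrC.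
rewrite mulrC; apply: cderiveZ; split; first exact: is_derive_id.
exact: is_derive_cst.
Qed.

Definition cflow_deriv f (df : R -> R[i]) : Prop :=
  flow_deriv (fun t => complex.Re (f t)) (fun t => complex.Re (df t)) /\
  flow_deriv (fun t => complex.Im (f t)) (fun t => complex.Im (df t)).

Lemma cflow_deriv_eq f df dg :
  cflow_deriv f df -> (forall t, 0 < t -> df t = dg t) -> cflow_deriv f dg.
Proof.
by move=> [fr fi] e; split; [apply: flow_deriv_eq fr _|apply: flow_deriv_eq fi _] => t t0; rewrite e.
Qed.

Lemma cflow_derivP f df : (forall t, 0 < t -> cderive f t (df t)) ->
  (complex.Re (f x) @[x --> 0^'+] --> complex.Re (f 0))%classic ->
  (complex.Im (f x) @[x --> 0^'+] --> complex.Im (f 0))%classic ->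
  cflow_deriv f df.
Proof. by move=> fd fr fi; split; split=> // t /fd[]. Qed.

Lemma cflow_cst z : cflow_deriv (fun=> z) (fun=> 0).
Proof. by split; exact: flow_deriv_cst. Qed.

Lemma cflowD f g df dg : cflow_deriv f df -> cflow_deriv g dg ->
  cflow_deriv (fun t => f t + g t) (fun t => df t + dg t).
Proof.
move=> [fr fi] [gr gi]; split.
  have := flow_derivD fr gr; congr flow_deriv; apply/funext => t.
    by rewrite raddfD.
  by rewrite raddfD.
have := flow_derivD fi gi; congr flow_deriv; apply/funext => t.
  by rewrite raddfD.
by rewrite raddfD.
Qed.

Lemma cflowM f g df dg : cflow_deriv f df -> cflow_deriv g dg ->
  cflow_deriv (fun t => f t * g t) (fun t => f t * dg t + g t * df t).
Proof.
move=> [fr fi] [gr gi]; split.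
  have := flow_derivB (flow_derivM fr gr) (flow_derivM fi gi).
  congr flow_deriv; apply/funext => t.
    by case: (f t) => p q; case: (g t).
  case: (f t) (g t) (df t) (dg t) => [p1 p2] [r1 r2] [l1 l2] [m1 m2] /=; ring.
have := flow_derivD (flow_derivM fr gi) (flow_derivM fi gr).
congr flow_deriv; apply/funext => t.
  by case: (f t) => p q; case: (g t).
case: (f t) (g t) (df t) (dg t) => [p1 p2] [r1 r2] [l1 l2] [m1 m2] /=; ring.
Qed.

Lemma cflowZ z f df : cflow_deriv f df -> cflow_deriv (fun t => z * f t) (fun t => z * df t).
Proof.
move=> fd; apply: cflow_deriv_eq (cflowM (cflow_cst z) fd) _ => t _.
by rewrite mulr0 addr0.
Qed.

Lemma cflowX n f df : cflow_deriv f df ->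
  cflow_deriv (fun t => f t ^+ n.+1) (fun t => n.+1%:R * f t ^+ n * df t).
Proof.
move=> fd; elim: n => [|n IH].
  have -> : (fun t => f t ^+ 1) = f by [].
  by apply: cflow_deriv_eq fd _ => t _; rewrite expr0 !mul1r.
have -> : (fun t => f t ^+ n.+2) = (fun t => f t * f t ^+ n.+1).
  by apply/funext => t; rewrite exprS.
apply: cflow_deriv_eq (cflowM fd IH) _ => t _.
rewrite -(natr1 n.+1) (exprSr (f t) n); ring.
Qed.

Lemma cflowJ f df : cflow_deriv f df -> cflow_deriv (fun t => (f t)^*) (fun t => (df t)^*).
Proof.
move=> [fr fi]; split.
  by move: fr; congr flow_deriv; apply/funext => t; [case: (f t) | case: (df t)].
have := flow_derivN fi.
by congr flow_deriv; apply/funext => t; [case: (f t) | case: (df t)].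
Qed.

Lemma cflow_sum (I : Type) (r : seq I) (f df : I -> R -> R[i]) :
  (forall i, cflow_deriv (f i) (df i)) ->
  cflow_deriv (fun u => \sum_(i <- r) f i u) (fun u => \sum_(i <- r) df i u).
Proof.
move=> fl; elim: r => [|i r IH].
  by have := cflow_cst 0; congr cflow_deriv; apply/funext => u; rewrite big_nil.
have := cflowD (fl i) IH; congr cflow_deriv; apply/funext => u; by rewrite big_cons.
Qed.

End ComplexCurves.

(** * The preconditioned gradient *)

Section Gradient.
Context {R : realType} {M : nat}.
Variables (c : nat -> R[i]) (a : 'I_M -> R[i]) (h : nat -> R[i]) (K : nat).
Hypothesis a1 : forall m, cabs (a m) = 1.
Hypothesis c2 : cvgn (series (fun k => k%:R * cabs (c k) ^+ 2)).
Hypothesis Gunit : AtA c a \in unitmx.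
Hypothesis hK : forall k, (K <= k)%N -> h k = 0.
Hypothesis h1 : sqnorm h = 1.
Local Notation G := (AtA c a).
Local Notation b := (Adag c a h).
Local Notation m_ := (mstat c a h).
Variables (A : R) (n : nat).
Hypothesis A0 : A != 0.

Definition model_loss (w : 'cV[R[i]]_M) : R :=
  - (A * complex.Re (m_ w ^+ n.+1)) + A / 2 * sqnorm (Aw c a w) ^+ n.+1.

Lemma mstat_delta w z m : m_ (w + z *: delta_mx m 0) = m_ w + z * (b m 0)^*.
Proof.
rewrite addrC (mstatDl c a hK) addrC; congr (_ + _ * _).
rewrite (mstatE c a hK) (bigD1 m)//= big1 ?addr0; last first.
  by move=> i im; rewrite mxE (negPf im) mul0r.
by rewrite mxE !eqxx mul1r.
Qed.

Lemma quad_deltar w m : quad c a w (delta_mx m 0) = (G *m w) m 0.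
Proof.
rewrite /quad mxE; apply: eq_bigr => i _; rewrite (bigD1 m)//= big1 ?addr0; last first.
  by move=> j jm; rewrite mxE (negPf jm) conjC0 mulr0 mul0r.
by rewrite mxE !eqxx conjC1 mulr1 mulrC.
Qed.

Lemma sqnorm_delta w z m : sqnorm (Aw c a (w + z *: delta_mx m 0)) =
  sqnorm (Aw c a w) + 2 * complex.Re (z^* * (G *m w) m 0) + cabs z ^+ 2 * complex.Re (G m m).
Proof.
rewrite !(sqnorm_Aw a1 c2) addrC quadDl.
rewrite (quadC a1 c2 (delta_mx m 0)) (quadC a1 c2 w (_ + _)) !quadDl.
rewrite !quad_deltar (quadC a1 c2 (delta_mx m 0) w) quad_deltar.
have -> : (G *m (delta_mx m 0 : 'cV[R[i]]_M)) m 0 = G m m by rewrite -colE mxE.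
have -> : z * (z * G m m + (G *m w) m 0)^* + (z * ((G *m w) m 0)^* + quad c a w w)^* =
   (z * z^*) * (G m m)^* + (z^* * (G *m w) m 0)^* + z^* * (G *m w) m 0 + quad c a w w.
  rewrite !rmorphD !rmorphM /= !conjCK -(quadC a1 c2 w w); ring.
rewrite mul_conj; case: (G m m) => g1 g2; case: (z^* * _) => y1 y2; case: (quad _ _ _ _) => q1 q2 /=.
ring.
Qed.

(** Used with [z = 1] and [z = 'i]. The separate [zr] lets one statement match both directions as
    [cgrad] writes them, one of which has no explicit factor [1]. *)
Lemma derive1_model_loss w (z : R[i]) (zr : R -> R[i]) m :
  cabs z = 1 -> (forall r, zr r = rC r * z) ->
  derive1 (fun r : R => model_loss (w + zr r *: delta_mx m 0)) 0 =
  A * n.+1%:R * (- complex.Re (z * (m_ w ^+ n * (b m 0)^*)) +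
    sqnorm (Aw c a w) ^+ n * complex.Re (z^* * (G *m w) m 0)).
Proof.
move=> z1 zrE; set rho := sqnorm (Aw c a w); set g := complex.Re (z^* * _).
have E r : model_loss (w + zr r *: delta_mx m 0) =
  - (A * complex.Re ((m_ w + rC r * (z * (b m 0)^*)) ^+ n.+1)) +
  A / 2 * (rho + r * (2 * g) + r * r * complex.Re (G m m)) ^+ n.+1.
  rewrite zrE /model_loss mstat_delta sqnorm_delta mulrA cabsM z1 mulr1 cabs_rC real_normK ?num_real//.
  rewrite expr2; congr (_ + _ * (_ + _ + _) ^+ _).
  rewrite -/g; have -> : (rC r * z)^* * (G *m w) m 0 = rC r * (z^* * (G *m w) m 0).
    by rewrite rmorphM -mulrA; congr (_ * _); exact: conjc_real.
  rewrite [RHS]mulrCA; congr (_ * _); rewrite /g.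
  by case: (z^* * _) => y1 y2 /=; rewrite mul0r subr0.
have -> : (fun r : R => model_loss (w + zr r *: delta_mx m 0)) = (fun r =>
  - (A * complex.Re ((m_ w + rC r * (z * (b m 0)^*)) ^+ n.+1)) +
  A / 2 * (rho + r * (2 * g) + r * r * complex.Re (G m m)) ^+ n.+1).
  by apply/funext => r; exact: E.
have [d1 _] := cderiveX n (cderive_line (m_ w) (z * (b m 0)^*) 0).
have d2 : is_derive (0 : R) 1 (fun r => rho + r * (2 * g) + r * r * complex.Re (G m m)) (2 * g).
  have -> : (fun r => rho + r * (2 * g) + r * r * complex.Re (G m m)) =
     cst rho + id * cst (2 * g) + id * id * cst (complex.Re (G m m)) by [].
  apply: is_derive_eq (is_deriveD (is_deriveD (is_derive_cst _ _ _)
    (is_deriveM (is_derive_id _ _) (is_derive_cst _ _ _)))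
    (is_deriveM (is_deriveM (is_derive_id _ _) (is_derive_id _ _)) (is_derive_cst _ _ _))) _.
  by rewrite /GRing.scale /=; ring.
rewrite derive1E.
have d2X := is_derive_exprn n d2.
have d3 : is_derive (0 : R) 1 (- (cst A * (fun u => complex.Re ((m_ w + rC u * (z * (b m 0)^*)) ^+ n.+1))) +
  cst (A / 2) * (fun r => (rho + r * (2 * g) + r * r * complex.Re (G m m)) ^+ n.+1))
  (A * n.+1%:R * (- complex.Re (z * (m_ w ^+ n * (b m 0)^*)) + rho ^+ n * g)).
  apply: is_derive_eq (is_deriveD (is_deriveN (is_deriveM (is_derive_cst _ _ _) d1))
    (is_deriveM (is_derive_cst _ _ _) d2X)) _.
  rewrite /GRing.scale /= mulr0 !addr0.
  have -> : rC 0 * (z * (b m 0)^*) = 0 by rewrite -[rC 0]/(0 : R[i]) mul0r.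
  rewrite !(mul0r, addr0).
  have -> : complex.Re (n.+1%:R * m_ w ^+ n * (z * (b m 0)^*)) =
    n.+1%:R * complex.Re (z * (m_ w ^+ n * (b m 0)^*)).
    have -> : n.+1%:R * m_ w ^+ n * (z * (b m 0)^*) = n.+1%:R%:C%C * (z * (m_ w ^+ n * (b m 0)^*)).
      by rewrite rmorph_nat; ring.
    by case: (z * _) => y1 y2 /=; rewrite mul0r subr0.
  by field.
by case: d3.
Qed.

(** [cgrad] is twice the derivative in the conjugate of [w], so [Re (m ^ s)], with [m] linear in
    [w], contributes a power of the conjugate of [m]. *)
Lemma cgrad_model_loss w : cgrad model_loss w =
  (A * n.+1%:R)%:C%C *: (- ((m_ w)^* ^+ n *: b) + (sqnorm (Aw c a w) ^+ n)%:C%C *: (G *m w)).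
Proof.
have zi : cabs (imag_unit R) = 1 by rewrite /cabs /= expr0n expr1n add0r sqrtr1.
have zi1 : cabs (1 : R[i]) = 1 by rewrite /cabs /= expr0n expr1n addr0 sqrtr1.
apply/colP => m; rewrite [LHS]mxE.
have E1 := derive1_model_loss w (zr := @rC R) m zi1 (fun r => esym (mulr1 (rC r))).
have E2 := derive1_model_loss w (zr := fun r => rC r * imag_unit R) m zi (fun=> erefl).
refine (eq_trans (f_equal2 (@Complex R) E1 E2) _).
move: (sqnorm _ ^+ n) (m_ w) => r y; move: (G *m w) (b) => gw bv.
rewrite !mxE; move: (gw m 0) (bv m 0) => [g1 g2] [b1 b2].
have -> : y^* ^+ n = (y ^+ n)^* by rewrite rmorphXn.
case: (y ^+ n) => y1 y2; rewrite mul1r conjC1 mul1r /imag_unit.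
apply/eqP; rewrite eq_complex /=; apply/andP; split; apply/eqP; ring.
Qed.

(** The preconditioner turns [b] into the coefficients of the projection of [h] and [G *m w] into
    [w]; this is why the flow closes on [m] and [rho]. *)
Lemma precond_rhs_model_loss alpha w : cabs (alpha n.+1) = A ->
  precond_rhs c a alpha n.+1 model_loss w =
  (m_ w)^* ^+ n *: proj_coef c a h - (sqnorm (Aw c a w) ^+ n)%:C%C *: w.
Proof.
move=> AE; rewrite /precond_rhs cgrad_model_loss AE -scalemxAr scalerA.
have -> : rC (n.+1%:R * A)^-1 * (A * n.+1%:R)%:C%C = 1 :> R[i].
  by rewrite -[LHS]rmorphM /= (mulrC A) mulVf// mulf_neq0// pnatr_eq0.
rewrite scale1r mulmxDr mulmxN -!scalemxAr mulKmx// opprD opprK.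
by [].
Qed.

End Gradient.

(** * Equations of motion of the summary statistics *)

Section Flow.
Context {R : realType} {M : nat}.
Variables (c : nat -> R[i]) (a : 'I_M -> R[i]) (h : nat -> R[i]) (K : nat).
Hypothesis a1 : forall m, cabs (a m) = 1.
Hypothesis c2 : cvgn (series (fun k => k%:R * cabs (c k) ^+ 2)).
Hypothesis Gunit : AtA c a \in unitmx.
Hypothesis hK : forall k, (K <= k)%N -> h k = 0.
Hypothesis h1 : sqnorm h = 1.
Variables (n : nat) (w : R -> 'cV[R[i]]_M).
Local Notation G := (AtA c a).
Local Notation b := (Adag c a h).
Local Notation m_ := (mstat c a h).
Let q := 1 - delta c a h.
Let m t := m_ (w t).
Let rho t := sqnorm (Aw c a (w t)).
Let F (v : 'cV[R[i]]_M) := (m_ v)^* ^+ n *: proj_coef c a h - (sqnorm (Aw c a v) ^+ n)%:C%C *: v.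
Hypothesis wF : solves_flow F w.

Let w_flow i : cflow_deriv (fun t => w t i 0) (fun t => F (w t) i 0).
Proof.
have [wd w0] := wF; apply: cflow_derivP; [|by case: (w0 i)|by case: (w0 i)].
by move=> t t0; exact: wd.
Qed.

(** The trailing [0] gives [F v] the shape to which [mstatDl] and [quadDl] apply twice. *)
Let FE v : F v = - (sqnorm (Aw c a v) ^+ n)%:C%C *: v + ((m_ v)^* ^+ n *: proj_coef c a h + 0).
Proof. by rewrite /F addr0 scaleNr [RHS]addrC. Qed.

Let mstat0 : m_ 0 = 0.
Proof. by rewrite (mstatE c a hK) big1// => i _; rewrite mxE mul0r. Qed.

Lemma mstat_flow : cflow_deriv m
  (fun t => q%:C%C * (m t)^* ^+ n - (rho t ^+ n)%:C%C * m t).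
Proof.
have mE t : m t = \sum_i w t i 0 * (b i 0)^* by exact: (mstatE c a hK).
have -> : m = (fun t => \sum_i (b i 0)^* * w t i 0).
  by apply/funext => t; rewrite mE; apply: eq_bigr => i _; rewrite mulrC.
apply: cflow_deriv_eq (cflow_sum (index_enum 'I_M) (fun i => cflowZ (b i 0)^* (w_flow i))) _.
move=> t t0; transitivity (m_ (F (w t))).
  by rewrite (mstatE c a hK); apply: eq_bigr => i _; rewrite mulrC.
rewrite FE !(mstatDl c a hK) mstat0 addr0 (mstat_proj_coef a1 c2 Gunit hK) -/q.
have -> : \sum_i (b i 0)^* * w t i 0 = m t.
  by rewrite mE; apply: eq_bigr => i _; rewrite mulrC.
rewrite -/(m t) -/(rho t); ring.
Qed.

Let quad0 v : quad c a 0 v = 0.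
Proof. by rewrite /quad big1// => i _; rewrite big1// => j _; rewrite mxE !mul0r. Qed.

Lemma rho_flow : flow_deriv rho
  (fun t => 2 * complex.Re (m t ^+ n.+1) - 2 * rho t ^+ n.+1).
Proof.
have rhoE t : rho t = complex.Re (quad c a (w t) (w t)) by exact: (sqnorm_Aw a1 c2).
pose dq t := \sum_i \sum_j G j i * (w t i 0 * (F (w t) j 0)^* + (w t j 0)^* * F (w t) i 0).
have qd : cflow_deriv (fun t => quad c a (w t) (w t)) dq.
  have -> : (fun t => quad c a (w t) (w t)) =
      (fun t => \sum_i \sum_j G j i * (w t i 0 * (w t j 0)^*)).
    by apply/funext => t; apply: eq_bigr => i _; apply: eq_bigr => j _; rewrite mulrC.
  apply: cflow_sum => i; apply: cflow_sum => j; apply: cflowZ.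
  exact: cflowM (w_flow i) (cflowJ (w_flow j)).
have [re_qd _] := qd.
have -> : rho = (fun t => complex.Re (quad c a (w t) (w t))) by apply/funext => t; exact: rhoE.
apply: flow_deriv_eq re_qd _ => t _.
have -> : dq t = quad c a (w t) (F (w t)) + quad c a (F (w t)) (w t).
  rewrite /dq /quad -big_split; apply: eq_bigr => i _ /=.
  by rewrite -big_split; apply: eq_bigr => j _ /=; ring.
rewrite (quadC a1 c2 (w t)) FE !quadDl quad0 addr0 (quad_proj_coef Gunit hK) -/(m t) -/(rho t).
have ReC (r : R) : complex.Re r%:C%C = r by [].
rewrite (quad_real a1 c2 (w t)) -rhoE ReC.
have -> : - (rho t ^+ n)%:C%C * (rho t)%:C%C + (m t)^* ^+ n * (m t)^* =
  (m t ^+ n.+1)^* - (rho t ^+ n.+1)%:C%C.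
  rewrite !exprSr !rmorphM !rmorphXn /=; ring.
move: (rho t ^+ n.+1) => r; case: (m t ^+ n.+1) => p1 p2 /=; ring.
Qed.

Lemma sqr_mstat_flow : flow_deriv (fun t => cabs (m t) ^+ 2)
  (fun t => 2 * q * complex.Re (m t ^+ n.+1) - 2 * rho t ^+ n * cabs (m t) ^+ 2).
Proof.
have [re _] := cflowM mstat_flow (cflowJ mstat_flow).
have -> : (fun t => cabs (m t) ^+ 2) = (fun t => complex.Re (m t * (m t)^*)).
  by apply/funext => t; rewrite sqr_cabs.
apply: flow_deriv_eq re _ => t _; rewrite sqr_cabs.
have rJ (x : R) : (x%:C%C)^* = x%:C%C :> R[i] by exact: conjc_real.
have -> : m t * (q%:C%C * (m t)^* ^+ n - (rho t ^+ n)%:C%C * m t)^* +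
    (m t)^* * (q%:C%C * (m t)^* ^+ n - (rho t ^+ n)%:C%C * m t) =
    q%:C%C * (m t ^+ n.+1 + (m t ^+ n.+1)^*) - (2 * rho t ^+ n)%:C%C * (m t * (m t)^*).
  have -> : (2 * rho t ^+ n)%:C%C = 2 * (rho t ^+ n)%:C%C :> R[i].
    by rewrite rmorphM rmorph_nat.
  rewrite rmorphB !rmorphM /= !rJ rmorphXn /= conjCK (exprS (m t)) rmorphM !rmorphXn /=; ring.
rewrite mul_conj; case: (m t ^+ n.+1) => p1 p2 /=; ring.
Qed.

(** The drive of [m ^ s] is [|m| ^ 2n], which is real: it acts on [P] alone, while the imaginary
    part is only damped. *)
Lemma mstatX_flow : cflow_deriv (fun t => m t ^+ n.+1)
  (fun t => (n.+1%:R * q * (cabs (m t) ^+ 2) ^+ n)%:C%C -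
            (n.+1%:R * rho t ^+ n)%:C%C * m t ^+ n.+1).
Proof.
apply: cflow_deriv_eq (cflowX n mstat_flow) _ => t _.
have -> : (n.+1%:R * q * (cabs (m t) ^+ 2) ^+ n)%:C%C = n.+1%:R * q%:C%C * (m t * (m t)^*) ^+ n.
  rewrite mul_conj; move: (cabs (m t) ^+ 2) => S.
  by rewrite !rmorphM rmorph_nat rmorphXn.
have -> : (n.+1%:R * rho t ^+ n)%:C%C = n.+1%:R * (rho t ^+ n)%:C%C :> R[i].
  by rewrite rmorphM rmorph_nat.
rewrite exprMn exprSr; ring.
Qed.

Lemma flow_converge (eps : R) : 0 < eps -> 0 < cabs (m 0) <= 1 ->
  1 / 2 <= complex.Re (m 0 ^+ n.+1) / cabs (m 0) ^+ n.+1 ->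
  vstat c a h (w 0) = 1 - cabs (m 0) ^+ 2 ->
  delta c a h <= Num.min (eps / 2) (16^-1 * cabs (m 0) ^+ 4 / n.+1%:R ^+ n.+1) ->
  exists T, 0 <= T /\
    T <= (if n.+1 == 1%N then 400 * ln (1 + eps^-1)
          else 400 * (2 ^+ (n.+1 * n.+1) / cabs (m 0) ^+ (4 * n.+1) + ln (1 + eps^-1))) /\
    1 - eps <= cabs (m T) /\
    1 - eps <= complex.Re (m T ^+ n.+1) / cabs (m T) ^+ n.+1 /\
    vstat c a h (w T) <= eps.
Proof.
move=> e0 r01 cos0 v0 dmin.
have vE t : vstat c a h (w t) = rho t - cabs (m t) ^+ 2.
  by have [] := vstatE a1 c2 hK h1 (w t).
have v_ge0 t : 0 <= vstat c a h (w t) by have [] := vstatE a1 c2 hK h1 (w t).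
have [re im] := mstatX_flow.
have dP : flow_deriv (fun t => complex.Re (m t ^+ n.+1)) (fun t =>
    n.+1%:R * q * (cabs (m t) ^+ 2) ^+ n - n.+1%:R * rho t ^+ n * complex.Re (m t ^+ n.+1)).
  apply: flow_deriv_eq re _ => t _; case: (m t ^+ n.+1) => p1 p2 /=; ring.
have dI : flow_deriv (fun t => complex.Im (m t ^+ n.+1)) (fun t =>
    - n.+1%:R * rho t ^+ n * complex.Im (m t ^+ n.+1)).
  apply: flow_deriv_eq im _ => t _; case: (m t ^+ n.+1) => p1 p2 /=; ring.
have q1 : q <= 1 by rewrite /q gerBl; exact: (delta_ge0 a1 c2 Gunit hK h1).
have SPI t : 0 <= t -> (cabs (m t) ^+ 2) ^+ n.+1 =
    complex.Re (m t ^+ n.+1) ^+ 2 + complex.Im (m t ^+ n.+1) ^+ 2.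
  move=> _; rewrite -exprM mulnC exprM -cabsX.
  by rewrite /cabs sqr_sqrtr// addr_ge0 ?sqr_ge0.
have rho0 : rho 0 = 1 by have := vE 0; rewrite v0; lra.
have dq : 1 - q <= Num.min (eps / 2) (16^-1 * cabs (m 0) ^+ 4 / n.+1%:R ^+ n.+1).
  by rewrite /q subKr.
have Srho t : 0 <= t -> cabs (m t) ^+ 2 <= rho t.
  by move=> _; rewrite -subr_ge0 -vE.
have [T [T0 [Tle [rT [cT vT]]]]] := summary_dynamics_converge e0 r01 q1 dq
  sqr_mstat_flow dP dI rho_flow SPI (fun t _ => sqr_ge0 _) Srho rho0 erefl cos0.
rewrite sqrtr_sqr ger0_norm ?cabs_ge0// in rT cT.
by exists T; rewrite vE.
Qed.

End Flow.

(** The constants are chosen before all other data, which is the meaning of [O]. The logarithm is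
    [ln (1 + eps^-1)] so as to stay positive for [eps >= 1]. Summability of [|c_k|] makes
    [<A w, p (x)>] converge, and that of [k * |c_k| ^ 2] the entries of the Gram matrix. *)
Theorem theorem4p2 (R : realType) :
  exists C0 C1 : R, 0 < C0 /\ 0 < C1 /\
  forall (eps : R) (N M : nat) (d : measure_display) (T : measurableType d)
    (P : probability T R) (U : T -> 'M[R[i]]_N) (x : T -> 'I_N -> R[i])
    (a : 'I_M -> R[i]) (c alpha h : nat -> R[i]) (s : nat)
    (w : R -> 'cV[R[i]]_M),
  0 < eps ->
  haar_unitary P U -> eigenvalues_of U x ->
  (forall m, cabs (a m) = 1) ->
  cvgn (series (fun k => cabs (c k))) ->
  cvgn (series (fun k => k%:R * cabs (c k) ^+ 2)) ->
  AtA c a \in unitmx ->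
  (1 <= s <= isqrt N)%N -> alpha s != 0 ->
  (forall j, (1 <= j < s)%N -> alpha j = 0) ->
  (forall k, ((k == 0) || (isqrt N < k))%N -> h k = 0) ->
  sqnorm h = 1 ->
  solves_flow (precond_rhs c a alpha s (loss P x c a alpha s h)) w ->
  0 < rstat c a h (w 0) <= 1 ->
  1 / 2 <= cos_s_theta c a h s (w 0) ->
  vstat c a h (w 0) = 1 - rstat c a h (w 0) ^+ 2 ->
  delta c a h <= Num.min (eps / 2) (C0 * rstat c a h (w 0) ^+ 4 / s%:R ^+ s) ->
  exists Tm : R, 0 <= Tm /\
    Tm <= (if s == 1%N then C1 * ln (1 + eps^-1)
           else C1 * (2 ^+ (s * s) / rstat c a h (w 0) ^+ (4 * s) + ln (1 + eps^-1))) /\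
    1 - eps <= rstat c a h (w Tm) /\
    1 - eps <= cos_s_theta c a h s (w Tm) /\
    vstat c a h (w Tm) <= eps.
Proof.
exists 16^-1, 400; split; first by rewrite invr_gt0.
split; first by rewrite ltr0n.
move=> eps N M d T P U x a c alpha h s w e0 haarU eigx a1 c1 c2 Gunit sK alpha_s _ h_supp h1 wF.
have hK k : ((isqrt N).+1 <= k)%N -> h k = 0 by move=> Kk; rewrite h_supp// Kk orbT.
case: s sK alpha_s wF => // n sK alpha_s wF.
have lossM : loss P x c a alpha n.+1 h = model_loss c a h (cabs (alpha n.+1)) n.
  by apply/funext => v; exact: (lossE haarU eigx a1 c1 sK alpha_s h_supp).
have A0 : cabs (alpha n.+1) != 0 by rewrite cabs_eq0.
have rhsE : precond_rhs c a alpha n.+1 (loss P x c a alpha n.+1 h) =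
    (fun v => (mstat c a h v)^* ^+ n *: proj_coef c a h -
              (sqnorm (Aw c a v) ^+ n)%:C%C *: v).
  by apply/funext => v; rewrite lossM (precond_rhs_model_loss a1 c2 Gunit hK A0).
rewrite rhsE in wF.
exact: (flow_converge a1 c2 Gunit hK h1 wF e0).
Qed.
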